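(* Let $h_{11},h_{20},h_{40}\in\mathbb{R}$ with $h_{20}^2+h_{40}<0$, let $\delta=(c_{00},c_{02},c_{11},c_{20})\in\mathbb{R}^4$, and consider the near-Hamiltonian system $$\dot u=\frac{\partial H_2}{\partial v}(u,v)+\varepsilon\hat p(u,v,\delta),\qquad \dot v=-\frac{\partial H_2}{\partial u}(u,v)+\varepsilon\hat q(u,v,\delta),$$ where $$H_2(u,v)=\tfrac12v^2+(4h_{20}-2h_{11}^2)u^2v+\tfrac12v^3+2(h_{11}^4-4h_{11}^2h_{20}-4h_{40})u^4+(2h_{20}-h_{11}^2)u^2v^2+\tfrac18v^4,$$ and $\hat p,\hat q$ are polynomials of degree at most $3$ in $(u,v)$, depending linearly on $\delta$, with $$\hat p_u+\hat q_v=(c_{00}+c_{02})+(-2c_{11}+4h_{11}c_{02})u+2c_{02}v+(4c_{20}-4h_{11}c_{11}+4h_{11}^2c_{02})u^2+(-2c_{11}+4h_{11}c_{02})uv+c_{02}v^2 .$$ Let $\sigma=(h_{11},h_{20},h_{40})$, and let $\delta_0=(c_{00}^*,c_{02}^*,c_{11}^*,c_{20}^* )$, $\sigma_0=(h_{11}^*,h_{20}^*,h_{40}^* )$ satisfy $$(h_{20}^* )^2+h_{40}^*<0,\quad c_{00}^*=-c_{02}^*,\quad c_{02}^*\neq0,\quad c_{20}^*=h_{11}^*c_{11}^*-2c_{02}^*\big[(h_{11}^* )^2-h_{20}^*\big].$$ Then for some $(\varepsilon,\delta,\sigma)$ near $(0,\delta_0,\sigma_0)$ (with $\varepsilon\neq0$)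 the system has $2$ limit cycles near the origin.
   Context: This system is the normal form, near the point $(0,1)$, of the perturbed symmetric cubic Hamiltonian system $\dot x=H_y+\varepsilon p,\ \dot y=-H_x+\varepsilon q$ with $H=\sum_{i+j\in\{2,4\}}h_{ij}x^iy^j$, $h_{04}=-h_{02}/2$, $h_{13}=-h_{11}$, $p,q$ odd cubic polynomials, in the case $-4h_{11}^2-8h_{02}(h_{20}+h_{22})=0$, $h_{31}=-2h_{11}h_{20}$, normalized by $h_{02}=\tfrac12$, $h_{22}=-h_{11}^2-h_{20}$, after the change $u=-\tfrac12x$, $v=h_{11}x+y-1$; for $h_{20}^2+h_{40}<0$ the origin is a nilpotent center of order 1 of the unperturbed system. ''For some $(\varepsilon,\delta,\sigma)$ near $(0,\delta_0,\sigma_0)$ the system has $N$ limit cycles near the origin'' means: for every neighborhood $V$ of the origin and every $\eta>0$ there exist $\varepsilon,\delta,\sigma$ with $0<|\varepsilon|<\eta$, $|\delta-\delta_0|<\eta$, $|\sigma-\sigma_0|<\eta$ for which the system has $N$ limit cycles in $V$. *)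

(* Defs.v *)
From Stdlib Require Import Reals Lra.
Open Scope R_scope.

Definition is_solution (F1 F2 : R -> R -> R) (x y : R -> R) : Prop :=
  forall t, derivable_pt_lim x t (F1 (x t) (y t)) /\
            derivable_pt_lim y t (F2 (x t) (y t)).

Definition periodic_orbit (F1 F2 : R -> R -> R) (G : R -> R -> Prop) : Prop :=
  exists (x y : R -> R) (T : R),
    0 < T /\ is_solution F1 F2 x y /\
    (forall t, x (t + T) = x t /\ y (t + T) = y t) /\
    (exists t1 t2, x t1 <> x t2 \/ y t1 <> y t2) /\
    (forall a b, G a b <-> exists t, x t = a /\ y t = b).

Definition dist2 (a b c d : R) : R := sqrt ((a - c)^2 + (b - d)^2).

Definition limit_cycle (F1 F2 : R -> R -> R) (G : R -> R -> Prop) : Prop :=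
  periodic_orbit F1 F2 G /\
  exists r, 0 < r /\
    forall G', periodic_orbit F1 F2 G' ->
      (exists a b c d, G a b /\ G' c d /\ dist2 a b c d < r) ->
      (forall a b, G' a b <-> G a b).

Definition H2 (h11 h20 h40 u v : R) : R :=
  /2 * v^2 + (4*h20 - 2*h11^2) * u^2 * v + /2 * v^3
  + 2*(h11^4 - 4*h11^2*h20 - 4*h40) * u^4 + (2*h20 - h11^2) * u^2 * v^2
  + /8 * v^4.

Definition H2_v (h11 h20 h40 u v : R) : R :=
  v + (4*h20 - 2*h11^2) * u^2 + 3/2 * v^2
  + 2*(2*h20 - h11^2) * u^2 * v + /2 * v^3.

Definition H2_u (h11 h20 h40 u v : R) : R :=
  2*(4*h20 - 2*h11^2) * u * v
  + 4*(2*(h11^4 - 4*h11^2*h20 - 4*h40)) * u^3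
  + 2*(2*h20 - h11^2) * u * v^2.

Definition poly2 (a : nat -> nat -> R) (u v : R) : R :=
  sum_f_R0 (fun i => sum_f_R0 (fun j => a i j * u^i * v^j) 3) 3.

Definition poly2_du (a : nat -> nat -> R) (u v : R) : R :=
  sum_f_R0 (fun i => sum_f_R0 (fun j => INR i * a i j * u^(i-1) * v^j) 3) 3.
Definition poly2_dv (a : nat -> nat -> R) (u v : R) : R :=
  sum_f_R0 (fun i => sum_f_R0 (fun j => INR j * a i j * u^i * v^(j-1)) 3) 3.

(* Coefficient families of hat p, hat q, indexed by
   sigma = (h11,h20,h40), delta = (c00,c02,c11,c20), then exponents i j. *)
Definition coef_family := R -> R -> R -> R -> R -> R -> R -> nat -> nat -> R.

Definition deg_le3 (a : coef_family) : Prop :=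
  forall h11 h20 h40 c00 c02 c11 c20 i j,
    (3 < i + j)%nat -> a h11 h20 h40 c00 c02 c11 c20 i j = 0.

Definition linear_in_delta (a : coef_family) : Prop :=
  forall h11 h20 h40 i j, exists k0 k1 k2 k3,
    forall c00 c02 c11 c20,
      a h11 h20 h40 c00 c02 c11 c20 i j = k0*c00 + k1*c02 + k2*c11 + k3*c20.

Definition div_target (h11 c00 c02 c11 c20 u v : R) : R :=
  (c00 + c02) + (-2*c11 + 4*h11*c02) * u + 2*c02 * v
  + (4*c20 - 4*h11*c11 + 4*h11^2*c02) * u^2
  + (-2*c11 + 4*h11*c02) * u * v + c02 * v^2.

Definition div_condition (pc qc : coef_family) : Prop :=
  forall h11 h20 h40 c00 c02 c11 c20 u v,
    poly2_du (pc h11 h20 h40 c00 c02 c11 c20) u v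
    + poly2_dv (qc h11 h20 h40 c00 c02 c11 c20) u v
    = div_target h11 c00 c02 c11 c20 u v.

Definition field_u (pc : coef_family) (eps h11 h20 h40 c00 c02 c11 c20 : R)
  (u v : R) : R :=
  H2_v h11 h20 h40 u v + eps * poly2 (pc h11 h20 h40 c00 c02 c11 c20) u v.
Definition field_v (qc : coef_family) (eps h11 h20 h40 c00 c02 c11 c20 : R)
  (u v : R) : R :=
  - H2_u h11 h20 h40 u v + eps * poly2 (qc h11 h20 h40 c00 c02 c11 c20) u v.

(* Main.v *)
Require Import Defs.
From Stdlib Require Import Reals ZArith Lra Psatz IndefiniteDescription.
From Coquelicot Require Import Coquelicot.
Open Scope R_scope.

(** The energy of the unperturbed system is a sum of squares: with
    [a = 2 h20 - h11^2], [W = v + v^2/2 + 2 a u^2] and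
    [k^2 = -16 (h20^2 + h40) > 0] one has [2 H2 = W^2 + k^2 u^4].  Hence the
    explicit coordinates [u = rho cos t], [W = - k rho^2 sin t sqrt (1 + cos^2 t)]
    turn [H2] into [k^2 rho^4 / 2], and the perturbed system becomes the
    2 pi-periodic scalar equation
    [d rho / d t = eps F / (2 k^2 rho^3 - eps G)], where [F] and [G] are the fluxes
    of [(p, q)] through the coordinate lines.  By Green's formula the derivative
    of the Melnikov function [I rho = int F dt] is the integral over [t] of the
    divergence times the Jacobian, so only the prescribed divergence matters.
    Perturbing [c00] at order [mu^4] and [c20] at order [mu^2] gives
    [I = - 2 k N (rho^7 - 3 mu^2 rho^5 + 2 mu^4 rho^3) + O(mu^9)] with [N <> 0],
    which has simple zeros near [rho = mu] and [rho = sqrt 2 mu].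
    Near a simple zero of the averaged equation, the return map has a fixed point
    by the intermediate value theorem, and the distance to it shrinks at each turn
    (forwards or backwards in time), so the periodic orbit is isolated. *)

(** * Differential inequalities and the Picard theorem *)

(** The linear part at the origin is nilpotent, so ordinary polar angles degenerate; the weights are
    u ~ rho, v ~ rho^2. The factorisation 1 - cos^4 t = sin^2 t (1 + cos^2 t) supplies a smooth
    angle without generalised trigonometric functions. The equalities on delta_0 say that the
    divergence reduces to 2 c02 W + beta u (1 + v). The second term has mean zero exactly and the
    first has mean zero at leading order, so the Melnikov function starts at rho^7. Moving c00 and
    c20 restores the rho^3 and rho^5 terms independently, and they are tuned to give rho^3 (rho^2 -
    mu^2)(rho^2 - 2 mu^2). The radius mu is fixed before eps. All the analysis then lives in the
    annulus mu/2 < rho < 2 mu, away from the degenerate origin, and eps may depend on mu. A limit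
    cycle must be isolated among periodic orbits of arbitrary period, so a competitor that closes up
    only after n turns has to be excluded too. This is why the contraction is iterated, and why each
    cycle is followed in the time direction in which it attracts: only there do its neighbours stay
    in the annulus. *)

Lemma is_derive_R_plus (f g : R -> R) (x a b : R) :
  is_derive f x a -> is_derive g x b -> is_derive (fun t => f t + g t) x (a + b).
Proof. intros. now apply (is_derive_plus f g). Qed.

Lemma is_derive_R_minus (f g : R -> R) (x a b : R) :
  is_derive f x a -> is_derive g x b -> is_derive (fun t => f t - g t) x (a - b).
Proof. intros. now apply (is_derive_minus f g). Qed.

Lemma is_derive_R_mult (f g : R -> R) (x a b : R) :
  is_derive f x a -> is_derive g x b ->
  is_derive (fun t => f t * g t) x (a * g x + f x * b).
Proof. intros. apply (is_derive_mult f g x a b); auto. exact Rmult_comm. Qed.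

Lemma is_derive_R_comp (f g : R -> R) (x a b : R) :
  is_derive f (g x) a -> is_derive g x b -> is_derive (fun t => f (g t)) x (a * b).
Proof. intros. rewrite Rmult_comm. now apply (is_derive_comp f g). Qed.

Lemma is_derive_R_scal (f : R -> R) (c x a : R) :
  is_derive f x a -> is_derive (fun t => c * f t) x (c * a).
Proof. intros. now apply is_derive_scal. Qed.

Lemma is_derive_eq (f : R -> R) (x a b : R) :
  is_derive f x a -> a = b -> is_derive f x b.
Proof. now intros H <-. Qed.

Lemma ex_RInt_continuous_R (h : R -> R) (a b : R) :
  (forall s, continuous h s) -> ex_RInt h a b.
Proof. intros H. apply (ex_RInt_continuous (V := R_CompleteNormedModule)). auto. Qed.

Lemma segment_mvt (f df : R -> R) (a b : R) :
  (forall t, Rmin a b <= t <= Rmax a b -> is_derive f t (df t)) ->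
  exists c, Rmin a b <= c <= Rmax a b /\ f b - f a = df c * (b - a).
Proof.
  intros H. apply MVT_gen.
  - intros x Hx. apply H. lra.
  - intros x Hx. apply continuity_pt_filterlim.
    apply (ex_derive_continuous f x). exists (df x). now apply H.
Qed.

Lemma derive_bound_lipschitz (f df : R -> R) (K a b : R) :
  (forall t, Rmin a b <= t <= Rmax a b -> is_derive f t (df t)) ->
  (forall t, Rmin a b <= t <= Rmax a b -> Rabs (df t) <= K) ->
  Rabs (f b - f a) <= K * Rabs (b - a).
Proof.
  intros H HK. destruct (segment_mvt f df a b H) as [c [Hc E]].
  rewrite E, Rabs_mult. apply Rmult_le_compat_r; [apply Rabs_pos | auto].
Qed.

Lemma derive_nonneg_incr (f df : R -> R) (a b : R) :
  a <= b ->
  (forall t, a <= t <= b -> is_derive f t (df t)) ->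
  (forall t, a <= t <= b -> 0 <= df t) ->
  f a <= f b.
Proof.
  intros Hab H Hd. destruct (segment_mvt f df a b) as [c [Hc E]].
  - intros t Ht. rewrite Rmin_left, Rmax_right in Ht by lra. auto.
  - rewrite Rmin_left, Rmax_right in Hc by lra. specialize (Hd c Hc). nra.
Qed.

(** The endpoints are unordered because the Picard iterates are compared on both sides of the
    initial time. *)
Lemma derive_domination (f df g dg : R -> R) (a b : R) :
  (forall t, is_derive f t (df t)) -> (forall t, is_derive g t (dg t)) ->
  (forall t, Rabs (df t) <= dg t) ->
  Rabs (f b - f a) <= Rabs (g b - g a).
Proof.
  intros Hf Hg Hd.
  assert (key : forall a b, a <= b -> Rabs (f b - f a) <= g b - g a).
  { clear a b. intros a b Hab.
    assert (H1 : g a - f a <= g b - f b).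
    { apply (derive_nonneg_incr (fun t => g t - f t) (fun t => dg t - df t)); auto.
      - intros t _. apply (is_derive_minus g f); auto.
      - intros t _. specialize (Hd t). apply Rabs_le_between in Hd. lra. }
    assert (H2 : g a + f a <= g b + f b).
    { apply (derive_nonneg_incr (fun t => g t + f t) (fun t => dg t + df t)); auto.
      - intros t _. apply (is_derive_plus g f); auto.
      - intros t _. specialize (Hd t). apply Rabs_le_between in Hd. lra. }
    apply Rabs_le. lra. }
  destruct (Rle_dec a b) as [Hab | Hab].
  - eapply Rle_trans; [apply key; lra | apply Rle_abs].
  - rewrite Rabs_minus_sym, (Rabs_minus_sym (g b)).
    eapply Rle_trans; [apply key; lra | apply Rle_abs].
Qed.

(** Valid in both time directions: phi exp(-L t) decreases, which serves a <= b, and phi exp(L t)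
    increases, which serves b < a. *)
Lemma gronwall (phi dphi : R -> R) (L a b : R) :
  (forall t, Rmin a b <= t <= Rmax a b -> is_derive phi t (dphi t)) ->
  (forall t, Rmin a b <= t <= Rmax a b -> Rabs (dphi t) <= L * phi t) ->
  phi b <= phi a * exp (L * Rabs (b - a)).
Proof.
  intros H HL.
  destruct (Rle_dec a b) as [Hab | Hab].
  - rewrite Rmin_left, Rmax_right in H, HL by lra.
    assert (D : - (phi a * exp (- L * a)) <= - (phi b * exp (- L * b))).
    { apply (derive_nonneg_incr (fun t => - (phi t * exp (- L * t)))
        (fun t => - (dphi t * exp (- L * t) + phi t * (- L * exp (- L * t))))); auto.
      - intros t Ht. apply (is_derive_opp (fun t => phi t * exp (- L * t))).
        apply (is_derive_R_mult phi (fun t => exp (- L * t))).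
        + now apply H.
        + auto_derive; auto. ring.
      - intros t Ht. specialize (HL t Ht). apply Rabs_le_between in HL.
        assert (P := exp_pos (- L * t)). nra. }
    rewrite Rabs_pos_eq by lra.
    replace (L * (b - a)) with (- L * a + L * b) by ring.
    rewrite exp_plus. assert (P := exp_pos (L * b)).
    replace (phi b) with (phi b * exp (- L * b) * exp (L * b)).
    + nra.
    + rewrite Rmult_assoc, <- exp_plus. replace (- L * b + L * b) with 0 by ring.
      rewrite exp_0. ring.
  - rewrite Rmin_right, Rmax_left in H, HL by lra.
    assert (D : phi b * exp (L * b) <= phi a * exp (L * a)).
    { apply (derive_nonneg_incr (fun t => phi t * exp (L * t))
        (fun t => dphi t * exp (L * t) + phi t * (L * exp (L * t)))); [lra | | ].
      - intros t Ht. apply (is_derive_R_mult phi (fun t => exp (L * t))).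
        + apply H; lra.
        + auto_derive; auto. ring.
      - intros t Ht. specialize (HL t Ht). apply Rabs_le_between in HL.
        assert (P := exp_pos (L * t)). nra. }
    rewrite Rabs_left by lra.
    replace (L * - (b - a)) with (L * a + - (L * b)) by ring.
    rewrite exp_plus. assert (P := exp_pos (- (L * b))).
    replace (phi b) with (phi b * exp (L * b) * exp (- (L * b))).
    + nra.
    + rewrite Rmult_assoc, <- exp_plus. replace (L * b + - (L * b)) with 0 by ring.
      rewrite exp_0. ring.
Qed.

Lemma is_derive_Rint_upper (h : R -> R) (a t : R) :
  (forall s, continuous h s) -> is_derive (fun t => RInt h a t) t (h t).
Proof.
  intros Hc. apply (is_derive_RInt h _ a); [| auto].
  apply filter_forall. intros b. apply (RInt_correct h).
  apply ex_RInt_continuous_R. auto.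
Qed.

Lemma continuous_lipschitz_bound (f : R -> R) (K t : R) :
  (forall s, Rabs (f s - f t) <= K * Rabs (s - t)) -> continuous f t.
Proof.
  intros H. apply filterlim_locally. intros eps.
  assert (HK : 0 < Rabs K + 1) by (assert (P := Rabs_pos K); lra).
  assert (Hd : 0 < eps / (Rabs K + 1)).
  { apply Rdiv_lt_0_compat; auto. apply cond_pos. }
  exists (mkposreal _ Hd). intros s Hs.
  change (Rabs (s - t) < eps / (Rabs K + 1)) in Hs.
  change (Rabs (f s - f t) < eps).
  apply Rle_lt_trans with (1 := H s).
  apply Rle_lt_trans with ((Rabs K + 1) * Rabs (s - t)).
  - apply Rmult_le_compat_r; [apply Rabs_pos |]. assert (P := Rle_abs K). lra.
  - apply Rmult_lt_reg_r with (/ (Rabs K + 1)); [now apply Rinv_0_lt_compat |].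
    replace ((Rabs K + 1) * Rabs (s - t) * / (Rabs K + 1)) with (Rabs (s - t)) by (field; lra).
    exact Hs.
Qed.

(** Separate continuity in time and a Lipschitz bound in the state, uniform in time, replace joint
    continuity. *)
Lemma continuous_diag (f : R -> R -> R) (x : R -> R) (L t : R) :
  (forall y, continuous (fun s => f s y) t) ->
  (forall s y y', Rabs (f s y - f s y') <= L * Rabs (y - y')) ->
  continuous x t -> continuous (fun s => f s (x s)) t.
Proof.
  intros Hf HL Hx. apply filterlim_locally. intros eps.
  assert (HK : 0 < Rabs L + 1) by (assert (P := Rabs_pos L); lra).
  assert (He : 0 < eps / 2) by (assert (P := cond_pos eps); lra).
  assert (Hd : 0 < eps / 2 / (Rabs L + 1)) by (apply Rdiv_lt_0_compat; auto).
  assert (H1 := proj1 (filterlim_locally _ _) (Hf (x t)) (mkposreal _ He)).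
  assert (H2 := proj1 (filterlim_locally _ _) Hx (mkposreal _ Hd)).
  generalize (filter_and _ _ H1 H2). apply filter_imp. intros s [A B].
  change (Rabs (f s (x t) - f t (x t)) < eps / 2) in A.
  change (Rabs (x s - x t) < eps / 2 / (Rabs L + 1)) in B.
  change (Rabs (f s (x s) - f t (x t)) < eps).
  replace (f s (x s) - f t (x t)) with ((f s (x s) - f s (x t)) + (f s (x t) - f t (x t))) by ring.
  eapply Rle_lt_trans; [apply Rabs_triang |].
  assert (B' : (Rabs L + 1) * Rabs (x s - x t) < eps / 2).
  { apply Rmult_lt_reg_r with (/ (Rabs L + 1)); [now apply Rinv_0_lt_compat |].
    replace ((Rabs L + 1) * Rabs (x s - x t) * / (Rabs L + 1)) with (Rabs (x s - x t)) by (field; lra).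
    exact B. }
  specialize (HL s (x s) (x t)). assert (P := Rle_abs L). assert (Q := Rabs_pos (x s - x t)). nra.
Qed.

Lemma geometric_limit (a : nat -> R) (c : R) :
  (forall n, Rabs (a (S n) - a n) <= c * (/2)^n) ->
  exists l, forall n, Rabs (l - a n) <= 2 * c * (/2)^n.
Proof.
  intros H.
  (* The factor 1 - 2^(-m) is the exact partial sum of the geometric series, which lets the
     induction on m close. *)
  assert (T : forall n m, Rabs (a (n + m)%nat - a n) <= 2 * c * (/2)^n * (1 - (/2)^m)).
  { intros n m. induction m as [| m IH].
    - rewrite Nat.add_0_r. simpl. rewrite Rminus_diag, Rabs_R0. lra.
    - replace (n + S m)%nat with (S (n + m)) by lia.
      replace (a (S (n + m)) - a n) with ((a (S (n + m)) - a (n + m)%nat) + (a (n + m)%nat - a n)) by ring.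
      eapply Rle_trans; [apply Rabs_triang |].
      specialize (H (n + m)%nat). rewrite pow_add in H. simpl. nra. }
  assert (Hc : 0 <= c).
  { specialize (H O). simpl in H. assert (P := Rabs_pos (a 1%nat - a O)). lra. }
  assert (pw : forall n, 0 < (/2)^n) by (intros; apply pow_lt; lra).
  assert (Cau : Cauchy_crit a).
  { intros eps He.
    destruct (pow_lt_1_zero (/2)) with (y := eps / (4 * c + 1)) as [N HN].
    - rewrite Rabs_pos_eq; lra.
    - apply Rdiv_lt_0_compat; lra.
    - exists N.
      assert (Q : 4 * c * (/2)^N < eps).
      { specialize (HN N (le_n _)). rewrite Rabs_pos_eq in HN by (left; apply pw).
        apply Rmult_lt_compat_r with (r := 4 * c + 1) in HN; [| lra].
        unfold Rdiv in HN. rewrite Rmult_assoc, Rinv_l in HN by lra.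
        specialize (pw N). nra. }
      intros n m Hn Hm. unfold Rdist.
      assert (A := T N (n - N)%nat). assert (B := T N (m - N)%nat).
      replace (N + (n - N))%nat with n in A by lia.
      replace (N + (m - N))%nat with m in B by lia.
      replace (a n - a m) with ((a n - a N) - (a m - a N)) by ring.
      eapply Rle_lt_trans; [apply Rabs_triang |]. rewrite Rabs_Ropp.
      assert (P1 := pw (n - N)%nat). assert (P2 := pw (m - N)%nat). specialize (pw N).
      assert (0 <= c * (/2)^N) by nra. nra. }
  destruct (Rcomplete.R_complete a Cau) as [l Hl]. exists l. intros n.
  apply le_epsilon. intros eps He. destruct (Hl eps He) as [N HN].
  specialize (HN (n + N)%nat ltac:(lia)). unfold Rdist in HN. specialize (T n N).
  replace (l - a n) with ((a (n + N)%nat - a n) - (a (n + N)%nat - l)) by ring.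
  eapply Rle_trans; [apply Rabs_triang |]. rewrite Rabs_Ropp.
  assert (P1 := pw N). specialize (pw n). assert (0 <= c * (/2)^n) by nra. nra.
Qed.

Section Picard.

Variables (f : R -> R -> R) (K L t0 x0 : R).
Hypothesis L_pos : 0 < L.
Hypothesis f_cont : forall x t, continuous (fun s => f s x) t.
Hypothesis f_bound : forall t x, Rabs (f t x) <= K.
Hypothesis f_lip : forall t x y, Rabs (f t x - f t y) <= L * Rabs (x - y).

Fixpoint picard_iter (n : nat) (t : R) : R :=
  match n with
  | O => x0
  | S n => x0 + RInt (fun s => f s (picard_iter n s)) t0 t
  end.

(* A smooth symmetric weight: the primitive of [weight] is at most [weight / (2L)]
   on both sides of [t0], so the Picard operator halves weighted distances. *)
Let weight (t : R) := exp (2 * L * (t - t0)) + exp (- (2 * L * (t - t0))).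

Lemma picard_iter_cont n t : continuous (picard_iter n) t.
Proof.
  revert t. induction n as [| n IH]; intros t.
  - apply continuous_const.
  - apply (continuous_plus (fun _ => x0)); [apply continuous_const |].
    apply ex_derive_continuous. eexists.
    apply is_derive_Rint_upper. intros s.
    apply (continuous_diag f _ L); auto.
Qed.

Lemma field_along_cont x : (forall t, continuous x t) ->
  forall t, continuous (fun s => f s (x s)) t.
Proof. intros Hx t. apply (continuous_diag f x L); auto. Qed.

(** Absorbs the linear growth K |t - t0| of the first Picard step into the weight. *)
Lemma picard_weight_ge t : 2 * L * Rabs (t - t0) <= weight t.
Proof.
  unfold weight. assert (P := exp_pos (2 * L * (t - t0))).
  assert (Q := exp_pos (- (2 * L * (t - t0)))).
  assert (E1 := exp_ineq1_le (2 * L * (t - t0))).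
  assert (E2 := exp_ineq1_le (- (2 * L * (t - t0)))).
  unfold Rabs. destruct (Rcase_abs (t - t0)); lra.
Qed.

Lemma integral_weight_bound (h : R -> R) (c t : R) :
  (forall s, continuous h s) -> 0 <= c ->
  (forall s, Rabs (h s) <= L * (c * weight s)) ->
  Rabs (RInt h t0 t) <= c / 2 * weight t.
Proof.
  intros Hc Pc Hh.
  replace (RInt h t0 t) with (RInt h t0 t - RInt h t0 t0) by (rewrite RInt_point; unfold zero; simpl; ring).
  eapply Rle_trans.
  - apply (derive_domination (fun t => RInt h t0 t) h
      (fun t => c / 2 * (exp (2 * L * (t - t0)) - exp (- (2 * L * (t - t0)))))
      (fun s => L * (c * weight s))); auto.
    + intros s. now apply is_derive_Rint_upper.
    + intros s. unfold weight. auto_derive; auto. unfold Rminus. field.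
  - rewrite Rminus_diag, Rmult_0_r, Ropp_0, exp_0, Rminus_diag, Rmult_0_r, Rminus_0_r.
    unfold weight. rewrite Rabs_mult, (Rabs_pos_eq (c / 2)) by lra.
    apply Rmult_le_compat_l; [lra |].
    assert (P := exp_pos (2 * L * (t - t0))). assert (Q := exp_pos (- (2 * L * (t - t0)))).
    apply Rabs_le. lra.
Qed.

Lemma picard_iter_step n t :
  Rabs (picard_iter (S n) t - picard_iter n t) <= K / (2 * L) * weight t * (/2)^n.
Proof.
  assert (HK : 0 <= K) by (eapply Rle_trans; [apply Rabs_pos | apply (f_bound 0 0)]).
  assert (HKL : 0 <= K / (2 * L)) by (apply Rcomplements.Rdiv_le_0_compat; lra).
  assert (pw : forall n, 0 < (/2)^n) by (intros; apply pow_lt; lra).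
  revert t. induction n as [| n IH]; intros t.
  - simpl. replace (x0 + RInt (fun s => f s x0) t0 t - x0) with
      (RInt (fun s => f s x0) t0 t - RInt (fun s => f s x0) t0 t0)
      by (rewrite RInt_point; unfold zero; simpl; ring).
    eapply Rle_trans.
    + apply (derive_bound_lipschitz (fun t => RInt (fun s => f s x0) t0 t) (fun s => f s x0) K).
      * intros s _. apply (is_derive_Rint_upper (fun s => f s x0)). auto.
      * auto.
    + rewrite Rmult_1_r. assert (W := picard_weight_ge t).
      replace (K * Rabs (t - t0)) with (K / (2 * L) * (2 * L * Rabs (t - t0))) by (field; lra).
      now apply Rmult_le_compat_l.
  - change (picard_iter (S (S n)) t) with (x0 + RInt (fun s => f s (picard_iter (S n) s)) t0 t).
    change (picard_iter (S n) t) with (x0 + RInt (fun s => f s (picard_iter n s)) t0 t).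
    set (h1 := fun s => f s (picard_iter (S n) s)). set (h2 := fun s => f s (picard_iter n s)).
    assert (C1 : forall s, continuous h1 s) by (apply field_along_cont; intros; apply picard_iter_cont).
    assert (C2 : forall s, continuous h2 s) by (apply field_along_cont; intros; apply picard_iter_cont).
    replace (x0 + RInt h1 t0 t - (x0 + RInt h2 t0 t)) with (RInt (fun s => h1 s - h2 s) t0 t).
    2:{ rewrite (RInt_minus h1 h2); try (apply ex_RInt_continuous_R; auto).
        unfold minus, plus, opp; simpl. ring. }
    replace (K / (2 * L) * weight t * (/ 2) ^ S n) with (K / (2 * L) * (/ 2) ^ n / 2 * weight t)
      by (simpl; field; lra).
    apply integral_weight_bound.
    + intros s. apply (continuous_minus h1 h2); auto.
    + specialize (pw n). nra.
    + intros s. unfold h1, h2. eapply Rle_trans; [apply f_lip |].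
      apply Rmult_le_compat_l; [lra |]. eapply Rle_trans; [apply IH |]. right; ring.
Qed.

(** The field is bounded and Lipschitz on the whole line, so the solution is global. Convergence is
    only pointwise with a constant depending on t, since the weight is unbounded; the limit is
    continuous because all the iterates share the Lipschitz constant [K]. *)
Lemma picard : exists x : R -> R, x t0 = x0 /\ forall t, is_derive x t (f t (x t)).
Proof.
  assert (HK : 0 <= K) by (eapply Rle_trans; [apply Rabs_pos | apply (f_bound 0 0)]).
  assert (HKL : 0 <= K / (2 * L)) by (apply Rcomplements.Rdiv_le_0_compat; lra).
  assert (pw : forall n, 0 < (/2)^n) by (intros; apply pow_lt; lra).
  assert (Hlim : forall t, exists l, forall n,
    Rabs (l - picard_iter n t) <= 2 * (K / (2 * L) * weight t) * (/2)^n).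
  { intros t. apply geometric_limit. intros n. apply picard_iter_step. }
  destruct (functional_choice _ Hlim) as [x Hx]. clear Hlim.
  assert (Xlip : forall n s t, Rabs (picard_iter n s - picard_iter n t) <= K * Rabs (s - t)).
  { intros [| n] s t.
    - simpl. rewrite Rminus_diag, Rabs_R0. apply Rmult_le_pos; [auto | apply Rabs_pos].
    - apply (derive_bound_lipschitz (picard_iter (S n)) (fun s => f s (picard_iter n s))).
      + intros r _. apply is_derive_eq with (0 + f r (picard_iter n r)); [| ring].
        apply (is_derive_R_plus (fun _ => x0)); [auto_derive; auto |].
        apply (is_derive_Rint_upper (fun s => f s (picard_iter n s))).
        apply field_along_cont. apply picard_iter_cont.
      + auto. }
  assert (small : forall c d e, (forall n, c <= d + e * (/2)^n) -> c <= d).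
  { intros c d e H. apply le_epsilon. intros eps He.
    destruct (pow_lt_1_zero (/2)) with (y := eps / (Rabs e + 1)) as [N HN].
    - rewrite Rabs_pos_eq; lra.
    - apply Rdiv_lt_0_compat; auto. assert (P := Rabs_pos e). lra.
    - specialize (HN N (le_n _)). rewrite Rabs_pos_eq in HN by (left; apply pw).
      assert (P := Rabs_pos e).
      apply Rmult_lt_compat_r with (r := Rabs e + 1) in HN; [| lra].
      unfold Rdiv in HN. rewrite Rmult_assoc, Rinv_l in HN by lra.
      specialize (pw N). specialize (H N). assert (Q := Rle_abs e). nra. }
  assert (xlip : forall s t, Rabs (x s - x t) <= K * Rabs (s - t)).
  { intros s t.
    apply (small _ _ (2 * (K / (2 * L) * weight s) + 2 * (K / (2 * L) * weight t))).
    intros n. assert (A := Hx s n). assert (B := Hx t n). assert (Cc := Xlip n s t).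
    replace (x s - x t) with ((x s - picard_iter n s) + (picard_iter n s - picard_iter n t)
      - (x t - picard_iter n t)) by ring.
    eapply Rle_trans; [apply Rabs_triang |]. rewrite Rabs_Ropp.
    eapply Rle_trans; [apply Rplus_le_compat_r, Rabs_triang |]. lra. }
  assert (xcont : forall t, continuous x t).
  { intros t. apply (continuous_lipschitz_bound x K). auto. }
  assert (eqn : forall t, x t = x0 + RInt (fun s => f s (x s)) t0 t).
  { intros t. apply Rminus_diag_uniq.
    assert (Z : Rabs (x t - (x0 + RInt (fun s => f s (x s)) t0 t)) <= 0).
    { apply (small _ _ (K / (2 * L) * weight t + K / (2 * L) * weight t)). intros n.
      assert (A := Hx t (S n)).
      set (h1 := fun s => f s (picard_iter n s)). set (h2 := fun s => f s (x s)).
      assert (C1 : forall s, continuous h1 s) by (apply field_along_cont; intros; apply picard_iter_cont).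
      assert (C2 : forall s, continuous h2 s) by (apply field_along_cont; auto).
      assert (B : Rabs (RInt (fun s => h1 s - h2 s) t0 t) <= 2 * (K / (2 * L)) * (/2)^n / 2 * weight t).
      { apply integral_weight_bound.
        - intros s. apply (continuous_minus h1 h2); auto.
        - specialize (pw n). nra.
        - intros s. unfold h1, h2. eapply Rle_trans; [apply f_lip |].
          apply Rmult_le_compat_l; [lra |]. rewrite Rabs_minus_sym.
          eapply Rle_trans; [apply Hx |]. right; ring. }
      replace (RInt (fun s => h1 s - h2 s) t0 t) with (RInt h1 t0 t - RInt h2 t0 t) in B.
      2:{ rewrite (RInt_minus h1 h2); try (apply ex_RInt_continuous_R; auto). reflexivity. }
      change (picard_iter (S n) t) with (x0 + RInt h1 t0 t) in A.
      replace (x t - (x0 + RInt h2 t0 t)) with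
        ((x t - (x0 + RInt h1 t0 t)) + (RInt h1 t0 t - RInt h2 t0 t)) by ring.
      eapply Rle_trans; [apply Rabs_triang |]. simpl in A. lra. }
    assert (P := Rabs_pos (x t - (x0 + RInt (fun s => f s (x s)) t0 t))).
    destruct (Req_dec (x t - (x0 + RInt (fun s => f s (x s)) t0 t)) 0) as [| NZ]; auto.
    apply Rabs_pos_lt in NZ. lra. }
  exists x. split.
  - rewrite eqn, RInt_point. unfold zero; simpl. ring.
  - intros t. apply (is_derive_ext (fun t => x0 + RInt (fun s => f s (x s)) t0 t)).
    + intros s. symmetry. apply eqn.
    + apply is_derive_eq with (0 + f t (x t)); [| ring].
      apply (is_derive_R_plus (fun _ => x0)); [auto_derive; auto |].
      apply (is_derive_Rint_upper (fun s => f s (x s))).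
      apply field_along_cont. auto.
Qed.

End Picard.

(** Gronwall is applied to the squared distance, which is differentiable even where the solutions
    meet. *)
Lemma scalar_gronwall (f : R -> R -> R) (L : R) (x y : R -> R) (a b : R) :
  (forall t u v, Rabs (f t u - f t v) <= L * Rabs (u - v)) ->
  (forall t, is_derive x t (f t (x t))) -> (forall t, is_derive y t (f t (y t))) ->
  Rabs (x b - y b) <= Rabs (x a - y a) * exp (L * Rabs (b - a)).
Proof.
  intros HL Hx Hy.
  assert (G : (x b - y b) ^ 2 <= (x a - y a) ^ 2 * exp (2 * L * Rabs (b - a))).
  { apply (gronwall (fun t => (x t - y t) ^ 2)
      (fun t => 2 * (x t - y t) * (f t (x t) - f t (y t)))).
    - intros t _. apply is_derive_eq with
        ((f t (x t) - f t (y t)) * (x t - y t) + (x t - y t) * (f t (x t) - f t (y t))); [| ring].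
      apply (is_derive_ext (fun t => (x t - y t) * (x t - y t))); [intros s; simpl; ring |].
      apply (is_derive_R_mult (fun t => x t - y t) (fun t => x t - y t));
        apply (is_derive_R_minus x y); auto.
    - intros t _. rewrite 2!Rabs_mult, (Rabs_pos_eq 2) by lra.
      rewrite <- (pow2_abs (x t - y t)). specialize (HL t (x t) (y t)).
      assert (P := Rabs_pos (x t - y t)). nra. }
  replace (2 * L * Rabs (b - a)) with (L * Rabs (b - a) + L * Rabs (b - a)) in G by ring.
  rewrite exp_plus in G. rewrite <- (pow2_abs (x b - y b)), <- (pow2_abs (x a - y a)) in G.
  assert (P := exp_pos (L * Rabs (b - a))).
  assert (P1 := Rabs_pos (x b - y b)). assert (P2 := Rabs_pos (x a - y a)).
  apply Rsqr_incr_0.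
  - unfold Rsqr. nra.
  - auto.
  - nra.
Qed.

Lemma scalar_ode_unique (f : R -> R -> R) (L : R) (x y : R -> R) (a : R) :
  (forall t u v, Rabs (f t u - f t v) <= L * Rabs (u - v)) ->
  (forall t, is_derive x t (f t (x t))) -> (forall t, is_derive y t (f t (y t))) ->
  x a = y a -> forall b, x b = y b.
Proof.
  intros HL Hx Hy E b. assert (G := scalar_gronwall f L x y a b HL Hx Hy).
  rewrite E, Rminus_diag, Rabs_R0, Rmult_0_l in G.
  assert (P := Rle_abs (x b - y b)). assert (Q := Rle_abs (- (x b - y b))).
  rewrite Rabs_Ropp in Q. lra.
Qed.

(** * Averaging of periodic scalar equations *)

Lemma RInt_period (h : R -> R) (T a : R) :
  (forall s, continuous h s) -> (forall s, h (s + T) = h s) ->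
  RInt h a (a + T) = RInt h 0 T.
Proof.
  intros Hc Hp.
  assert (ex : forall a b, ex_RInt h a b) by (intros; apply ex_RInt_continuous_R; auto).
  assert (C1 := RInt_Chasles h a 0 (a + T) (ex _ _) (ex _ _)).
  assert (C2 := RInt_Chasles h 0 T (a + T) (ex _ _) (ex _ _)).
  assert (C3 := RInt_comp_lin h 1 T 0 a (ex _ _)).
  assert (C4 := RInt_Chasles h 0 a 0 (ex _ _) (ex _ _)).
  rewrite RInt_point in C4.
  replace (1 * 0 + T) with T in C3 by ring. replace (1 * a + T) with (a + T) in C3 by ring.
  rewrite (RInt_ext _ h) in C3.
  - unfold plus, zero in *. simpl in *. lra.
  - intros x _. unfold scal; simpl; unfold mult; simpl. rewrite !Rmult_1_l. apply Hp.
Qed.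

Lemma periodic_nat (h : R -> R) (T t : R) (n : nat) :
  (forall s, h (s + T) = h s) -> h (t + INR n * T) = h t.
Proof.
  intros Hp. induction n as [| n IH].
  - simpl. f_equal. ring.
  - rewrite S_INR. replace (t + (INR n + 1) * T) with (t + INR n * T + T) by ring.
    now rewrite Hp.
Qed.

Lemma periodic_representative (h : R -> R) (T t : R) :
  0 < T -> (forall s, h (s + T) = h s) -> exists s, 0 <= s <= T /\ h t = h s.
Proof.
  intros HT Hp.
  destruct (nfloor_ex (Rabs t / T)) as [n [N1 N2]].
  { apply Rcomplements.Rdiv_le_0_compat; auto. apply Rabs_pos. }
  assert (E : Rabs t = Rabs t / T * T) by (field; lra).
  destruct (Rle_dec 0 t) as [P | P].
  - rewrite Rabs_pos_eq in * by auto. exists (t - INR n * T). split; [nra |].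
    rewrite <- (periodic_nat h T (t - INR n * T) n Hp). f_equal. ring.
  - rewrite Rabs_left in * by lra. exists (t + INR (S n) * T). split.
    + rewrite S_INR. nra.
    + now rewrite periodic_nat.
Qed.

Section StableAveraging.

Variables (f g : R -> R -> R) (T K m e lo hi eps : R).
Hypothesis T_pos : 0 < T.
Hypothesis K_pos : 0 < K.
Hypothesis m_pos : 0 < m.
Hypothesis e_pos : 0 < e.
Hypothesis eps_pos : 0 < eps.
(** Each smallness condition has one task: [small1] keeps the Gronwall factor over one period below
    exp 1 <= 3; [small2] keeps the drift over one period below [e]; [small3] makes the second-order
    error at most half of the contraction rate; [small4] keeps the multiplier of the return map
    nonnegative. *)
Hypothesis small1 : eps * K * T <= 1.
Hypothesis small2 : eps * K * T <= e.
Hypothesis small3 : eps * (3 * K + 4 * K ^ 2 * T) * T <= m / 2.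
Hypothesis small4 : eps * (T * K + m / 2) <= 1.
Hypothesis f_cont : forall x t, continuous (fun s => f s x) t.
Hypothesis g_cont : forall x t, continuous (fun s => g s x) t.
Hypothesis f_per : forall t x, f (t + T) x = f t x.
Hypothesis g_per : forall t x, g (t + T) x = g t x.
Hypothesis g_bound : forall t x, Rabs (g t x) <= K.
Hypothesis f_lip : forall t x y, Rabs (f t x - f t y) <= K * Rabs (x - y).
Hypothesis g_lip : forall t x y, Rabs (g t x - g t y) <= K * Rabs (x - y).
Hypothesis gf_bound : forall t x, Rabs (g t x - f t x) <= eps * K.
Hypothesis gf_lip : forall t x y,
  Rabs ((g t x - f t x) - (g t y - f t y)) <= eps * K * Rabs (x - y).
(** A derivative-free form of a Lipschitz derivative in x. It is asked only on [lo, hi], because the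
    field used later is truncated there and has corners at the ends. *)
Hypothesis f_second : forall t x y d,
  lo <= x <= hi -> lo <= y <= hi -> lo <= x + d <= hi -> lo <= y + d <= hi ->
  Rabs ((f t (x + d) - f t x) - (f t (y + d) - f t y)) <= K * Rabs (x - y) * Rabs d.

Let M (x : R) := RInt (fun s => f s x) 0 T.

Hypothesis M_decr : forall x y, lo <= x -> x < y -> y <= hi -> M y - M x <= - m * (y - x).
Hypothesis M_lo : m <= M (lo + 3 * e).
Hypothesis M_hi : M (hi - 3 * e) <= - m.
Hypothesis lo_hi : lo + 3 * e <= hi - 3 * e.

Definition solves (h : R -> R -> R) (x : R -> R) := forall t, is_derive x t (eps * h t (x t)).

Lemma M_lip x y : Rabs (M x - M y) <= T * K * Rabs (x - y).
Proof.
  unfold M.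
  assert (ex : forall x, ex_RInt (fun s => f s x) 0 T) by (intros; apply ex_RInt_continuous_R; auto).
  replace (RInt (fun s => f s x) 0 T - RInt (fun s => f s y) 0 T)
    with (RInt (fun s => f s x - f s y) 0 T).
  2:{ rewrite (RInt_minus (fun s => f s x) (fun s => f s y)); auto. }
  eapply Rle_trans.
  - apply (abs_RInt_le_const _ 0 T (K * Rabs (x - y))); [lra | | auto].
    apply (ex_RInt_minus (fun s => f s x) (fun s => f s y)); auto.
  - right; ring.
Qed.

Lemma averaging_drift x a s :
  solves g x -> Rabs (s - a) <= T -> Rabs (x s - x a) <= eps * K * T.
Proof.
  intros Hx Hs. eapply Rle_trans.
  - apply (derive_bound_lipschitz x (fun t => eps * g t (x t)) (eps * K)); auto.
    intros t _. rewrite Rabs_mult, (Rabs_pos_eq eps) by lra.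
    apply Rmult_le_compat_l; [lra | auto].
  - apply Rmult_le_compat_l; [| auto]. apply Rmult_le_pos; lra.
Qed.

Lemma averaging_gronwall x y a s :
  solves g x -> solves g y -> Rabs (s - a) <= T ->
  Rabs (x s - y s) <= 3 * Rabs (x a - y a).
Proof.
  intros Hx Hy Hs. eapply Rle_trans.
  - apply (scalar_gronwall (fun t x => eps * g t x) (eps * K) x y a s); auto.
    intros t u v. rewrite <- Rmult_minus_distr_l, Rabs_mult, (Rabs_pos_eq eps) by lra.
    rewrite Rmult_assoc. apply Rmult_le_compat_l; [lra | auto].
  - rewrite Rmult_comm. apply Rmult_le_compat_r; [apply Rabs_pos |].
    apply Rle_trans with (exp 1); [| apply exp_le_3].
      assert (Q : eps * K * Rabs (s - a) <= 1).
    { apply Rle_trans with (eps * K * T); auto.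
      apply Rmult_le_compat_l; auto. apply Rmult_le_pos; lra. }
    destruct (Rle_lt_or_eq_dec _ _ Q) as [Q' | ->]; [left; now apply exp_increasing | lra].
Qed.

Lemma averaging_unique x y a :
  solves g x -> solves g y -> x a = y a -> forall t, x t = y t.
Proof.
  intros Hx Hy E. apply (scalar_ode_unique (fun t x => eps * g t x) (eps * K) x y a); auto.
  intros t u v. rewrite <- Rmult_minus_distr_l, Rabs_mult, (Rabs_pos_eq eps) by lra.
  rewrite Rmult_assoc. apply Rmult_le_compat_l; [lra | auto].
Qed.

Lemma averaged_integral x a :
  RInt (fun s => f s x) a (a + T) = M x.
Proof. apply (RInt_period (fun s => f s x)); auto. Qed.

(** Over one period the gap d between the two solutions becomes d + eps (M(c + d) - M(c)) up to an
    error eps (m/2) |d|. As M decreases at rate at least m, the first-order term shrinks the gap by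
    more than the error can restore. Having q >= 0 means that the order of the two solutions is
    preserved. *)
Lemma return_contracts x xs a :
  solves g x -> solves g xs -> xs (a + T) = xs a ->
  lo + e <= x a <= hi - e -> lo + e <= xs a <= hi - e -> x a <> xs a ->
  exists q, 0 <= q < 1 /\ x (a + T) - xs (a + T) = q * (x a - xs a).
Proof.
  intros Hx Hxs Hper Ix Ixs Hne.
  set (c := xs a) in *. set (d := x a - c) in *.
  assert (Hd : d <> 0) by (unfold d; lra).
  set (D := fun s => x s - xs s - eps * RInt (fun r => f r (c + d) - f r c) a s).
  assert (B : Rabs (D (a + T) - D a) <= eps * (eps * (3 * K + 4 * K ^ 2 * T) * Rabs d) * Rabs (a + T - a)).
  { apply (derive_bound_lipschitz D
      (fun s => eps * g s (x s) - eps * g s (xs s) - eps * (f s (c + d) - f s c))).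
    - intros s _. unfold D.
      apply (is_derive_R_minus (fun s => x s - xs s)).
      + apply (is_derive_R_minus x xs); auto.
      + apply (is_derive_R_scal (fun s => RInt (fun r => f r (c + d) - f r c) a s)).
        apply (is_derive_Rint_upper (fun r => f r (c + d) - f r c)).
        intros r. apply (continuous_minus (fun r => f r (c + d)) (fun r => f r c)); auto.
    - intros s Hs. rewrite Rmin_left, Rmax_right in Hs by lra.
      assert (sT : Rabs (s - a) <= T) by (rewrite Rabs_pos_eq; lra).
      assert (G := averaging_gronwall x xs a s Hx Hxs sT). fold c d in G.
      assert (dr := averaging_drift xs a s Hxs sT). fold c in dr.
      assert (dr2 := averaging_drift x a s Hx sT).
      assert (dd : Rabs (x s - (xs s + d)) <= 3 * eps * K * T * Rabs d).
      { replace (x s - (xs s + d)) with ((x s - xs s) - (x a - xs a)) by (unfold d, c; ring).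
        eapply Rle_trans.
        - apply (derive_bound_lipschitz (fun s => x s - xs s)
            (fun t => eps * g t (x t) - eps * g t (xs t)) (3 * eps * K * Rabs d)).
          + intros t _. apply (is_derive_R_minus x xs); auto.
          + intros t Ht. rewrite Rmin_left, Rmax_right in Ht by lra.
            rewrite <- Rmult_minus_distr_l, Rabs_mult, (Rabs_pos_eq eps) by lra.
            replace (3 * eps * K * Rabs d) with (eps * (K * (3 * Rabs d))) by ring.
            apply Rmult_le_compat_l; [lra |]. eapply Rle_trans; [apply g_lip |].
            apply Rmult_le_compat_l; [lra |]. apply (averaging_gronwall x xs a t); auto.
            rewrite Rabs_pos_eq; lra.
        - replace (3 * eps * K * T * Rabs d) with (3 * eps * K * Rabs d * T) by ring.
          apply Rmult_le_compat_l; [| auto].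
          repeat apply Rmult_le_pos; try lra. apply Rabs_pos. }
      apply Rabs_le_between in dr.
      assert (F2 := f_second s (xs s) c d ltac:(lra) ltac:(lra) ltac:(unfold d; lra) ltac:(unfold d; lra)).
      assert (F1 := f_lip s (x s) (xs s + d)).
      assert (F0 := gf_lip s (x s) (xs s)).
      assert (K * Rabs (x s - (xs s + d)) <= K * (3 * eps * K * T * Rabs d))
        by (apply Rmult_le_compat_l; [lra | auto]).
      assert (eps * K * Rabs (x s - xs s) <= eps * K * (3 * Rabs d)).
      { apply Rmult_le_compat_l; [apply Rmult_le_pos; lra | auto]. }
      assert (K * Rabs (xs s - c) * Rabs d <= K * (eps * K * T) * Rabs d).
      { apply Rmult_le_compat_r; [apply Rabs_pos |]. apply Rmult_le_compat_l; [lra |].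
        apply Rabs_le. lra. }
      (* Three errors, each O(eps |d|) inside the bracket: the perturbation g - f, the deviation of
         the current gap from d, and the drift of the periodic solution away from c. They contribute
         3K, 3K^2 T and K^2 T, whence 3K + 4K^2 T. *)
      replace (eps * g s (x s) - eps * g s (xs s) - eps * (f s (c + d) - f s c)) with
        (eps * (((g s (x s) - f s (x s)) - (g s (xs s) - f s (xs s)))
         + (f s (x s) - f s (xs s + d))
         + ((f s (xs s + d) - f s (xs s)) - (f s (c + d) - f s c)))) by ring.
      rewrite Rabs_mult, (Rabs_pos_eq eps) by lra. apply Rmult_le_compat_l; [lra |].
      eapply Rle_trans; [apply Rabs_triang |].
      eapply Rle_trans; [apply Rplus_le_compat_r, Rabs_triang |]. nra. }
  assert (ex : forall x, ex_RInt (fun s => f s x) a (a + T)) by (intros; apply ex_RInt_continuous_R; auto).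
  assert (EI : RInt (fun r => f r (c + d) - f r c) a (a + T) = M (c + d) - M c).
  { rewrite (RInt_minus (fun s => f s (c + d)) (fun s => f s c)) by auto.
    rewrite !averaged_integral. reflexivity. }
  assert (EB : D (a + T) - D a = x (a + T) - xs (a + T) - d - eps * (M (c + d) - M c)).
  { unfold D. rewrite EI, RInt_point. unfold zero; simpl. unfold d, c. ring. }
  rewrite EB in B. replace (a + T - a) with T in B by ring. rewrite (Rabs_pos_eq T) in B by lra.
  assert (B' : Rabs (x (a + T) - xs (a + T) - d - eps * (M (c + d) - M c)) <= eps * (m / 2) * Rabs d).
  { eapply Rle_trans; [apply B |].
    replace (eps * (eps * (3 * K + 4 * K ^ 2 * T) * Rabs d) * T)
      with (eps * (eps * (3 * K + 4 * K ^ 2 * T) * T) * Rabs d) by ring.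
    apply Rmult_le_compat_r; [apply Rabs_pos |]. apply Rmult_le_compat_l; [lra | auto]. }
  assert (ML := M_lip (c + d) c). replace (c + d - c) with d in ML by ring.
  set (y := x (a + T) - xs (a + T)) in *. set (dm := M (c + d) - M c) in *.
  exists (y / d). split; [| field; auto].
  destruct (Rlt_dec 0 d) as [Pd | Pd].
  - assert (dm <= - m * d).
    { unfold dm. replace (- m * d) with (- m * (c + d - c)) by ring. apply M_decr; unfold d in *; lra. }
    rewrite (Rabs_pos_eq d) in * by lra. apply Rabs_le_between in B'. apply Rabs_le_between in ML.
    assert (eps * dm <= eps * (- m * d)) by (apply Rmult_le_compat_l; lra).
    assert (eps * (- (T * K * d)) <= eps * dm) by (apply Rmult_le_compat_l; lra).
    assert (0 < eps * m * d) by (repeat apply Rmult_lt_0_compat; lra).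
    assert (0 <= y) by nra. assert (y < d) by nra.
    split.
    + apply Rcomplements.Rdiv_le_0_compat; lra.
    + apply Rmult_lt_reg_r with d; auto. unfold Rdiv. rewrite Rmult_assoc, Rinv_l; lra.
  - assert (Nd : d < 0) by lra.
    assert (- m * d <= dm).
    { unfold dm. assert (Q : M c - M (c + d) <= - m * (c - (c + d))) by (apply M_decr; unfold d in *; lra). lra. }
    rewrite (Rabs_left d) in * by lra. apply Rabs_le_between in B'. apply Rabs_le_between in ML.
    assert (eps * (- m * d) <= eps * dm) by (apply Rmult_le_compat_l; lra).
    assert (eps * dm <= eps * (- (T * K * d))) by (apply Rmult_le_compat_l; lra).
    assert (0 < eps * m * (- d)) by (repeat apply Rmult_lt_0_compat; lra).
    assert (y <= 0) by nra. assert (d < y) by nra.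
    replace (y / d) with ((- y) / (- d)) by (field; auto).
    split.
    + apply Rcomplements.Rdiv_le_0_compat; lra.
    + apply Rmult_lt_reg_r with (- d); [lra |]. unfold Rdiv. rewrite Rmult_assoc, Rinv_l; lra.
Qed.

(** Since the multipliers lie in [0, 1], every iterate stays between its starting point and the
    periodic solution, so the contraction applies again at each turn. The alternative [n = O] is
    needed as the multiplier is 1 before the first turn. *)
Lemma stable_iterates x xs a n :
  solves g x -> solves g xs -> (forall t, xs (t + T) = xs t) ->
  lo + e <= x a <= hi - e -> lo + e <= xs a <= hi - e ->
  exists q, 0 <= q <= 1 /\ (q < 1 \/ n = O) /\
    x (a + INR n * T) - xs a = q * (x a - xs a).
Proof.
  intros Hx Hxs Hper Ix Ixs.
  destruct (Req_dec (x a) (xs a)) as [E | NE].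
  { exists 0. repeat split; try lra. rewrite (averaging_unique x xs a Hx Hxs E).
    rewrite (periodic_nat xs T a n Hper). lra. }
  induction n as [| n [q [Q1 [Q2 Q3]]]].
  - exists 1. repeat split; auto; try lra. simpl. rewrite Rmult_0_l, Rplus_0_r. ring.
  - rewrite S_INR. replace (a + (INR n + 1) * T) with ((a + INR n * T) + T) by ring.
    assert (P := periodic_nat xs T a n Hper).
    assert (ne' : x (a + INR n * T) <> xs (a + INR n * T)).
    { intros E'. apply NE. exact (averaging_unique x xs _ Hx Hxs E' a). }
    destruct (return_contracts x xs (a + INR n * T)) as [r [R1 R2]]; auto.
    + nra.
    + now rewrite P.
    + rewrite Hper, P in R2. rewrite P in ne'. exists (r * q). repeat split; try nra.
Qed.

(** The displacement over one period is within eps m/2 of eps M, hence changes sign between lo + 3e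
    and hi - 3e and vanishes there. The nested margins pay for drift, at most [e] per period: 3e for
    the fixed point, 2e for the whole periodic solution, e for the start of a neighbour, 0 for its
    entire future. *)
Lemma stable_averaging :
  exists xs, solves g xs /\ (forall t, xs (t + T) = xs t) /\
    (forall t, lo + 2 * e <= xs t <= hi - 2 * e) /\
    forall x a, solves g x -> lo + e <= x a <= hi - e ->
      (forall t, 0 <= t -> lo <= x (a + t) <= hi) /\
      (forall n, (0 < n)%nat -> x (a + INR n * T) = x a -> x a = xs a).
Proof.
  assert (HX : forall c, exists x, x 0 = c /\ solves g x).
  { intros c. apply (picard (fun t x => eps * g t x) (eps * K) (eps * K) 0 c).
    - apply Rmult_lt_0_compat; auto.
    - intros x t. apply (continuous_scal_r eps (fun s => g s x)). auto.
    - intros t x. rewrite Rabs_mult, (Rabs_pos_eq eps) by lra. apply Rmult_le_compat_l; [lra | auto].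
    - intros t u v. rewrite <- Rmult_minus_distr_l, Rabs_mult, (Rabs_pos_eq eps) by lra.
      rewrite Rmult_assoc. apply Rmult_le_compat_l; [lra | auto]. }
  destruct (functional_choice _ HX) as [X HX']. clear HX.
  assert (X0 : forall c, X c 0 = c) by (intros; apply HX').
  assert (Xs : forall c, solves g (X c)) by (intros; apply HX'). clear HX'.
  assert (rT : Rabs (T - 0) <= T) by (rewrite Rabs_pos_eq; lra).
  set (P := fun c => X c T - c).
  assert (Pcont : continuity P).
  (* 4 = 3 + 1: the Gronwall factor over a period plus the identity subtracted in [P]. *)
  { intros c. apply continuity_pt_filterlim. apply (continuous_lipschitz_bound P 4).
    intros c'. unfold P. assert (G := averaging_gronwall (X c') (X c) 0 T (Xs _) (Xs _) rT).
    rewrite !X0 in G.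
    replace (X c' T - c' - (X c T - c)) with ((X c' T - X c T) - (c' - c)) by ring.
    eapply Rle_trans; [apply Rabs_triang |]. rewrite Rabs_Ropp. lra. }
  assert (Pest : forall c, Rabs (P c - eps * M c) <= eps * (m / 2)).
  { intros c. set (D := fun s => X c s - eps * RInt (fun r => f r c) 0 s).
    replace (P c - eps * M c) with (D T - D 0).
    2:{ unfold D, P, M. rewrite X0, RInt_point. unfold zero; simpl. ring. }
    eapply Rle_trans.
    - apply (derive_bound_lipschitz D (fun s => eps * g s (X c s) - eps * f s c)
        (eps * (eps * (K + K ^ 2 * T)))).
      + intros s _. apply (is_derive_R_minus (X c)); [apply Xs |].
        apply (is_derive_R_scal (fun s => RInt (fun r => f r c) 0 s)).
        apply (is_derive_Rint_upper (fun r => f r c)). auto.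
      + intros s Hs. rewrite Rmin_left, Rmax_right in Hs by lra.
        assert (dr := averaging_drift (X c) 0 s (Xs c) ltac:(rewrite Rabs_pos_eq; lra)).
        rewrite X0 in dr.
        rewrite <- Rmult_minus_distr_l, Rabs_mult, (Rabs_pos_eq eps) by lra.
        apply Rmult_le_compat_l; [lra |].
        replace (g s (X c s) - f s c) with ((g s (X c s) - f s (X c s)) + (f s (X c s) - f s c)) by ring.
        eapply Rle_trans; [apply Rabs_triang |].
        assert (A1 := gf_bound s (X c s)). assert (A2 := f_lip s (X c s) c).
        assert (K * Rabs (X c s - c) <= K * (eps * K * T)) by (apply Rmult_le_compat_l; lra). nra.
    - rewrite Rminus_0_r, (Rabs_pos_eq T) by lra. rewrite Rmult_assoc.
      apply Rmult_le_compat_l; [lra |].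
      assert (0 <= eps * (2 * K + 3 * (K ^ 2 * T)) * T).
      { repeat apply Rmult_le_pos; try lra. apply Rplus_le_le_0_compat; [lra |].
        repeat apply Rmult_le_pos; try lra. }
      lra. }
  destruct (IVT_gen P (lo + 3 * e) (hi - 3 * e) 0 Pcont) as [c [Ic Zc]].
  { assert (A := Pest (lo + 3 * e)). assert (B := Pest (hi - 3 * e)).
    apply Rabs_le_between in A. apply Rabs_le_between in B.
    assert (eps * m <= eps * M (lo + 3 * e)) by (apply Rmult_le_compat_l; lra).
    assert (eps * M (hi - 3 * e) <= eps * - m) by (apply Rmult_le_compat_l; lra).
    assert (0 < eps * m) by (apply Rmult_lt_0_compat; lra).
    rewrite Rmin_right, Rmax_left by lra. lra. }
  rewrite Rmin_left, Rmax_right in Ic by lra.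
  assert (Hper : forall t, X c (t + T) = X c t).
  { intros t. apply (averaging_unique (fun t => X c (t + T)) (X c) 0).
    - intros s. apply is_derive_eq with (eps * g (s + T) (X c (s + T)) * 1); [| rewrite g_per; ring].
      apply (is_derive_R_comp (X c) (fun s => s + T)); [apply Xs |]. auto_derive; auto.
    - apply Xs.
    - rewrite Rplus_0_l, X0. unfold P in Zc. lra. }
  assert (Hin : forall t, lo + 2 * e <= X c t <= hi - 2 * e).
  { intros t. destruct (periodic_representative (X c) T t T_pos Hper) as [s [Is ->]].
    assert (dr := averaging_drift (X c) 0 s (Xs c) ltac:(rewrite Rabs_pos_eq; lra)).
    rewrite X0 in dr. apply Rabs_le_between in dr. lra. }
  exists (X c). split; [apply Xs |]. split; [exact Hper |]. split; [exact Hin |].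
  intros x a Hx Ix. assert (Ia := Hin a). split.
  - intros t Ht. destruct (nfloor_ex (t / T)) as [n [N1 N2]].
    { apply Rcomplements.Rdiv_le_0_compat; auto. }
    assert (Et : t = t / T * T) by (field; lra).
    destruct (stable_iterates x (X c) a n Hx (Xs c) Hper Ix ltac:(lra)) as [q [Q1 [_ Q2]]].
    assert (dr := averaging_drift x (a + INR n * T) (a + t) Hx
      ltac:(rewrite Rabs_pos_eq; nra)).
    apply Rabs_le_between in dr.
    assert (lo + e <= x (a + INR n * T) <= hi - e) by nra. lra.
  - intros n Hn E.
    destruct (stable_iterates x (X c) a n Hx (Xs c) Hper Ix ltac:(lra)) as [q [Q1 [[Q2 | Q2] Q3]]]; [| lia].
    rewrite E in Q3. nra.
Qed.

End StableAveraging.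

Record averageable (T K m e lo hi sg : R) (f : R -> R -> R) : Prop := {
  av_cont : forall x t, continuous (fun s => f s x) t;
  av_per : forall t x, f (t + T) x = f t x;
  av_lip : forall t x y, Rabs (f t x - f t y) <= K * Rabs (x - y);
  av_second : forall t x y d,
    lo <= x <= hi -> lo <= y <= hi -> lo <= x + d <= hi -> lo <= y + d <= hi ->
    Rabs ((f t (x + d) - f t x) - (f t (y + d) - f t y)) <= K * Rabs (x - y) * Rabs d;
  av_decr : forall x y, lo <= x -> x < y -> y <= hi ->
    sg * (RInt (fun s => f s y) 0 T - RInt (fun s => f s x) 0 T) <= - m * (y - x);
  av_lo : m <= sg * RInt (fun s => f s (lo + 3 * e)) 0 T;
  av_hi : sg * RInt (fun s => f s (hi - 3 * e)) 0 T <= - m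
}.

Record close_field (T K eps : R) (f g : R -> R -> R) : Prop := {
  cl_cont : forall x t, continuous (fun s => g s x) t;
  cl_per : forall t x, g (t + T) x = g t x;
  cl_bound : forall t x, Rabs (g t x) <= K;
  cl_lip : forall t x y, Rabs (g t x - g t y) <= K * Rabs (x - y);
  cl_diff : forall t x, Rabs (g t x - f t x) <= eps * K;
  cl_diff_lip : forall t x y,
    Rabs ((g t x - f t x) - (g t y - f t y)) <= eps * K * Rabs (x - y)
}.

(* [sg = 1] for an attracting periodic solution, [sg = -1] for a repelling one,
   whose neighbours are followed backwards. *)
Definition isolated_periodic (T e lo hi sg eps : R) (g : R -> R -> R) : Prop :=
  (forall t0 x0, exists x, x t0 = x0 /\ solves eps g x) /\
  exists xs, solves eps g xs /\ (forall t, xs (t + T) = xs t) /\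
    (forall t, lo + 2 * e <= xs t <= hi - 2 * e) /\
    forall x a, solves eps g x -> lo + e <= x a <= hi - e ->
      (x a = xs a -> forall t, x t = xs t) /\
      (forall t, 0 <= t -> lo <= x (a + sg * t) <= hi) /\
      (forall n, (0 < n)%nat -> x (a + sg * (INR n * T)) = x a -> x a = xs a).

Lemma continuous_reflect (h : R -> R) (t : R) :
  continuous h (- t) -> continuous (fun s => h (- s)) t.
Proof.
  intros H. apply (continuous_comp Ropp h); [| exact H].
  apply (ex_derive_continuous Ropp). auto_derive; auto.
Qed.

Lemma RInt_reflect_period (h : R -> R) (T : R) :
  (forall s, continuous h s) -> (forall s, h (s + T) = h s) ->
  RInt (fun s => - h (- s)) 0 T = - RInt h 0 T.
Proof.
  intros Hc Hp.
  assert (ex : forall a b, ex_RInt h a b) by (intros; apply ex_RInt_continuous_R; auto).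
  assert (C := RInt_comp_lin h (-1) 0 0 T (ex _ _)).
  rewrite (RInt_ext _ (fun s => - h (- s))) in C.
  - rewrite C. replace (-1 * 0 + 0) with 0 by ring. replace (-1 * T + 0) with (- T) by ring.
    rewrite <- (RInt_period h T (- T) Hc Hp). replace (- T + T) with 0 by ring.
    rewrite <- (opp_RInt_swap h (- T) 0) by auto. reflexivity.
  - intros x _. unfold scal; simpl; unfold mult; simpl.
    replace (-1 * x + 0) with (- x) by ring. ring.
Qed.

(** The threshold is fixed before [eps], [f] and [g], because in the application [g] itself depends
    on [eps]. The case sg = -1 is reduced to the attracting one by t -> -t, which turns [f] into
    -f(-t) and changes the sign of its mean. *)
Lemma averaging (T K m e : R) :
  0 < T -> 0 < K -> 0 < m -> 0 < e ->
  exists eps0, 0 < eps0 /\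
    forall eps lo hi sg f g, 0 < eps < eps0 -> sg = 1 \/ sg = -1 ->
      lo + 3 * e <= hi - 3 * e ->
      averageable T K m e lo hi sg f -> close_field T K eps f g ->
      isolated_periodic T e lo hi sg eps g.
Proof.
  intros HT HK Hm He.
  assert (P1 : 0 < K * T) by (apply Rmult_lt_0_compat; auto).
  assert (P2 : 0 < (3 * K + 4 * K ^ 2 * T) * T).
  { apply Rmult_lt_0_compat; auto. assert (0 < K ^ 2) by (apply pow_lt; auto).
    assert (0 < K ^ 2 * T) by (apply Rmult_lt_0_compat; auto). lra. }
  assert (P3 : 0 < T * K + m / 2) by nra.
  exists (Rmin (Rmin (1 / (K * T)) (e / (K * T)))
    (Rmin ((m / 2) / ((3 * K + 4 * K ^ 2 * T) * T)) (1 / (T * K + m / 2)))).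
  split.
  { repeat apply Rmin_case; apply Rdiv_lt_0_compat; lra. }
  intros eps lo hi sg f g [Pe He0] Hsg Hlh Hf Hg.
  apply Rmin_Rgt in He0. destruct He0 as [E1 E2].
  apply Rmin_Rgt in E1. apply Rmin_Rgt in E2. destruct E1 as [E1 E1'], E2 as [E2 E2'].
  assert (mulS : forall c d, 0 < d -> c / d > eps -> eps * d <= c).
  { intros c d Hd Hc. apply Rmult_le_reg_r with (/ d); [now apply Rinv_0_lt_compat |].
    rewrite Rmult_assoc, Rinv_r by lra. fold (c / d). lra. }
  apply mulS in E1; auto. apply mulS in E1'; auto. apply mulS in E2; auto. apply mulS in E2'; auto.
  destruct Hf as [f1 f2 f3 f4 f5 f6 f7], Hg as [g1 g2 g3 g4 g5 g6].
  split.
  { intros t0 x0. apply (picard (fun t x => eps * g t x) (eps * K) (eps * K) t0 x0).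
    - apply Rmult_lt_0_compat; auto.
    - intros x t. apply (continuous_scal_r eps (fun s => g s x)). auto.
    - intros t x. rewrite Rabs_mult, (Rabs_pos_eq eps) by lra. apply Rmult_le_compat_l; [lra | auto].
    - intros t u v. rewrite <- Rmult_minus_distr_l, Rabs_mult, (Rabs_pos_eq eps) by lra.
      rewrite Rmult_assoc. apply Rmult_le_compat_l; [lra | auto]. }
  destruct Hsg as [-> | ->].
  - destruct (stable_averaging f g T K m e lo hi eps) as [xs [X1 [X2 [X3 X4]]]]; auto; try lra.
    + intros x y A B C. assert (D := f5 x y A B C). lra.
    + exists xs. split; [exact X1 |]. split; [exact X2 |]. split; [exact X3 |]. intros x a Hx Ha.
      destruct (X4 x a Hx Ha) as [Y1 Y2].
      split; [intros E; apply (averaging_unique g K eps) with a; auto |]. split.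
      * intros t Ht. rewrite Rmult_1_l. auto.
      * intros n Hn E. rewrite Rmult_1_l in E. eauto.
  - set (f' := fun t x => - f (- t) x). set (g' := fun t x => - g (- t) x).
    assert (rev_solves : forall h x, solves eps h x ->
      solves eps (fun t x => - h (- t) x) (fun t => x (- t))).
    { intros h x Hx t. apply is_derive_eq with (eps * h (- t) (x (- t)) * -1); [| ring].
      apply (is_derive_R_comp x Ropp); [apply Hx |]. auto_derive; auto. }
    assert (EI : forall x, RInt (fun s => - f (- s) x) 0 T = - RInt (fun s => f s x) 0 T).
    { intros x. apply (RInt_reflect_period (fun s => f s x)); auto. }
    assert (Pm : forall (h : R -> R -> R), (forall t x, h (t + T) x = h t x) ->
      forall t x, h (- (t + T)) x = h (- t) x).
    { intros h Hh t x. rewrite <- (Hh (- (t + T)) x). f_equal. ring. }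
    destruct (stable_averaging f' g' T K m e lo hi eps) as [xs [X1 [X2 [X3 X4]]]];
      unfold f', g'; auto; try lra.
    + intros x t. apply (continuous_opp (V := R_NormedModule) (fun s => f (- s) x)), (continuous_reflect (fun s => f s x)); auto.
    + intros x t. apply (continuous_opp (V := R_NormedModule) (fun s => g (- s) x)), (continuous_reflect (fun s => g s x)); auto.
    + intros t x. f_equal. now apply Pm.
    + intros t x. f_equal. now apply Pm.
    + intros t x. rewrite Rabs_Ropp. auto.
    + intros t x y. replace (- f (- t) x - - f (- t) y) with (- (f (- t) x - f (- t) y)) by ring.
      rewrite Rabs_Ropp. auto.
    + intros t x y. replace (- g (- t) x - - g (- t) y) with (- (g (- t) x - g (- t) y)) by ring.
      rewrite Rabs_Ropp. auto.
    + intros t x. replace (- g (- t) x - - f (- t) x) with (- (g (- t) x - f (- t) x)) by ring.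
      rewrite Rabs_Ropp. auto.
    + intros t x y.
      replace (- g (- t) x - - f (- t) x - (- g (- t) y - - f (- t) y)) with
        (- (g (- t) x - f (- t) x - (g (- t) y - f (- t) y))) by ring.
      rewrite Rabs_Ropp. auto.
    + intros t x y d A B C D.
      replace (- f (- t) (x + d) - - f (- t) x - (- f (- t) (y + d) - - f (- t) y)) with
        (- (f (- t) (x + d) - f (- t) x - (f (- t) (y + d) - f (- t) y))) by ring.
      rewrite Rabs_Ropp. auto.
    + intros x y A B C. assert (D := f5 x y A B C). rewrite !EI. lra.
    + rewrite EI. lra.
    + rewrite EI. lra.
    + assert (back : forall x, solves eps g' x -> solves eps g (fun t => x (- t))).
      { intros x Hx t. apply is_derive_eq with (eps * - g' (- t) (x (- t))); [apply (rev_solves g' x Hx t) |].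
        unfold g'. rewrite !Ropp_involutive. reflexivity. }
      exists (fun t => xs (- t)). split; [now apply back |]. split.
      { intros t. rewrite <- (X2 (- (t + T))). f_equal. ring. }
      split; [intros t; apply X3 |]. intros x a Hx Ha.
      destruct (X4 (fun t => x (- t)) (- a)) as [Y1 Y2].
      { now apply rev_solves. }
      { now rewrite Ropp_involutive. }
      split; [intros E; apply (averaging_unique g K eps) with a; auto |]. split.
      * intros t Ht. specialize (Y1 t Ht). now replace (a + -1 * t) with (- (- a + t)) by ring.
      * intros n Hn E. rewrite <- (Y2 n Hn); [now rewrite Ropp_involutive |].
        rewrite Ropp_involutive, <- E. f_equal. ring.
Qed.

(** * Families of functions with Lipschitz derivative *)

Record bounded_lipschitz (lo hi K : R) (F : R -> R -> R) : Prop := {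
  bl_bound : forall t x, lo < x < hi -> Rabs (F t x) <= K;
  bl_lip : forall t x y, lo < x < hi -> lo < y < hi -> Rabs (F t x - F t y) <= K * Rabs (x - y);
  bl_cont : forall t x, lo < x < hi -> continuous (fun s => F s x) t
}.

(** The bounds are uniform in t. A Lipschitz derivative in x is enough both for the
    second-difference bound and for differentiation under the integral, and the class is stable
    under the operations that build the coordinates, so membership is proved by combinators. *)
Definition C11 (lo hi : R) (F : R -> R -> R) : Prop :=
  exists DF K, (forall t x, lo < x < hi -> is_derive (F t) x (DF t x)) /\
    bounded_lipschitz lo hi K F /\ bounded_lipschitz lo hi K DF.

Lemma bl_weaken lo hi K K' F : K <= K' -> bounded_lipschitz lo hi K F -> bounded_lipschitz lo hi K' F.
Proof.
  intros HK [B L Cc]. split; auto.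
  - intros t x Hx. specialize (B t x Hx). lra.
  - intros t x y Hx Hy. eapply Rle_trans; [now apply L |].
    apply Rmult_le_compat_r; [apply Rabs_pos | auto].
Qed.

Lemma bl_ext lo hi K F G : (forall t x, F t x = G t x) ->
  bounded_lipschitz lo hi K F -> bounded_lipschitz lo hi K G.
Proof.
  intros E [B L Cc]. split.
  - intros t x Hx. rewrite <- E. auto.
  - intros t x y Hx Hy. rewrite <- !E. auto.
  - intros t x Hx. apply (continuous_ext (fun s => F s x)); auto.
Qed.

Lemma bl_plus lo hi K1 K2 F G : bounded_lipschitz lo hi K1 F -> bounded_lipschitz lo hi K2 G ->
  bounded_lipschitz lo hi (K1 + K2) (fun t x => F t x + G t x).
Proof.
  intros [B1 L1 C1] [B2 L2 C2]. split.
  - intros t x Hx. eapply Rle_trans; [apply Rabs_triang |].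
    specialize (B1 t x Hx). specialize (B2 t x Hx). lra.
  - intros t x y Hx Hy.
    replace (F t x + G t x - (F t y + G t y)) with ((F t x - F t y) + (G t x - G t y)) by ring.
    eapply Rle_trans; [apply Rabs_triang |].
    specialize (L1 t x y Hx Hy). specialize (L2 t x y Hx Hy). lra.
  - intros t x Hx. apply (continuous_plus (fun s => F s x) (fun s => G s x)); auto.
Qed.

Lemma bl_mult lo hi K1 K2 F G : bounded_lipschitz lo hi K1 F -> bounded_lipschitz lo hi K2 G ->
  bounded_lipschitz lo hi (2 * Rabs K1 * Rabs K2) (fun t x => F t x * G t x).
Proof.
  intros [B1 L1 C1] [B2 L2 C2].
  assert (P1 := Rle_abs K1). assert (P2 := Rle_abs K2).
  assert (Q1 := Rabs_pos K1). assert (Q2 := Rabs_pos K2). split.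
  - intros t x Hx. rewrite Rabs_mult. specialize (B1 t x Hx). specialize (B2 t x Hx).
    assert (R1 := Rabs_pos (F t x)). assert (R2 := Rabs_pos (G t x)).
    assert (Rabs (F t x) * Rabs (G t x) <= Rabs K1 * Rabs K2) by (apply Rmult_le_compat; lra).
    nra.
  - intros t x y Hx Hy.
    replace (F t x * G t x - F t y * G t y) with
      (F t x * (G t x - G t y) + (F t x - F t y) * G t y) by ring.
    eapply Rle_trans; [apply Rabs_triang |]. rewrite !Rabs_mult.
    specialize (B1 t x Hx). specialize (B2 t y Hy).
    specialize (L1 t x y Hx Hy). specialize (L2 t x y Hx Hy).
    assert (R0 := Rabs_pos (x - y)).
    assert (Rabs (F t x) * Rabs (G t x - G t y) <= Rabs K1 * (Rabs K2 * Rabs (x - y))).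
    { apply Rmult_le_compat; try apply Rabs_pos; try lra. nra. }
    assert (Rabs (F t x - F t y) * Rabs (G t y) <= (Rabs K1 * Rabs (x - y)) * Rabs K2).
    { apply Rmult_le_compat; try apply Rabs_pos; try lra. nra. }
    lra.
  - intros t x Hx. apply (continuous_mult (fun s => F s x) (fun s => G s x)); auto.
Qed.

Lemma bl_inv lo hi K c F : 0 < c -> (forall t x, lo < x < hi -> c <= F t x) ->
  bounded_lipschitz lo hi K F ->
  bounded_lipschitz lo hi (/ c + Rabs K * (/ c * / c)) (fun t x => / F t x).
Proof.
  intros Hc HF [B L Cc].
  assert (P := Rle_abs K). assert (Q := Rabs_pos K).
  assert (Ic : 0 < / c) by now apply Rinv_0_lt_compat.
  assert (I : forall t x, lo < x < hi -> 0 < / F t x <= / c).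
  { intros t x Hx. specialize (HF t x Hx). split; [apply Rinv_0_lt_compat; lra |].
    apply Rinv_le_contravar; lra. }
  assert (Icc : 0 < / c * / c) by nra.
  split.
  - intros t x Hx. specialize (I t x Hx). rewrite Rabs_pos_eq by lra. nra.
  - intros t x y Hx Hy. assert (Ix := I t x Hx). assert (Iy := I t y Hy).
    assert (Fx := HF t x Hx). assert (Fy := HF t y Hy).
    replace (/ F t x - / F t y) with ((F t y - F t x) * (/ F t x * / F t y)) by (field; lra).
    rewrite Rabs_mult, (Rabs_pos_eq (/ F t x * / F t y)) by nra.
    assert (E : / F t x * / F t y <= / c * / c) by (apply Rmult_le_compat; lra).
    assert (Lx := L t y x Hy Hx). rewrite (Rabs_minus_sym y x) in Lx.
    assert (R0 := Rabs_pos (x - y)).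
    assert (Rabs (F t y - F t x) * (/ F t x * / F t y) <= (Rabs K * Rabs (x - y)) * (/ c * / c)).
    { apply Rmult_le_compat; try apply Rabs_pos; try nra. }
    nra.
  - intros t x Hx. apply (continuous_Rinv_comp (fun s => F s x)); auto.
    specialize (HF t x Hx). lra.
Qed.

(** The part 1 + |K| bounds the values, by sqrt y <= 1 + y; the part |K| / sqrt c is the Lipschitz
    constant obtained by rationalising the difference of two roots. *)
Lemma bl_sqrt lo hi K c F : 0 < c -> (forall t x, lo < x < hi -> c <= F t x) ->
  bounded_lipschitz lo hi K F ->
  bounded_lipschitz lo hi (1 + Rabs K + Rabs K * / sqrt c) (fun t x => sqrt (F t x)).
Proof.
  intros Hc HF [B L Cc].
  assert (P := Rle_abs K). assert (Q := Rabs_pos K).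
  assert (Sc : 0 < sqrt c) by now apply sqrt_lt_R0.
  assert (Ic : 0 < / sqrt c) by now apply Rinv_0_lt_compat.
  split.
  - intros t x Hx. specialize (B t x Hx). specialize (HF t x Hx).
    rewrite Rabs_pos_eq in B by lra.
    assert (Sx := sqrt_pos (F t x)). rewrite Rabs_pos_eq by auto.
    assert (E : sqrt (F t x) * sqrt (F t x) = F t x) by (apply sqrt_sqrt; lra).
    assert (0 <= Rabs K * / sqrt c) by (apply Rmult_le_pos; lra). nra.
  - intros t x y Hx Hy. assert (Fx := HF t x Hx). assert (Fy := HF t y Hy).
    assert (Ex := sqrt_sqrt (F t x) ltac:(lra)). assert (Ey := sqrt_sqrt (F t y) ltac:(lra)).
    assert (Gx := sqrt_le_1 c (F t x) ltac:(lra) ltac:(lra) Fx).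
    assert (Gy := sqrt_pos (F t y)).
    assert (R0 := Rabs_pos (x - y)).
    replace (sqrt (F t x) - sqrt (F t y)) with
      ((F t x - F t y) * / (sqrt (F t x) + sqrt (F t y))).
    2:{ replace (F t x - F t y) with ((sqrt (F t x) - sqrt (F t y)) * (sqrt (F t x) + sqrt (F t y))).
        - field. lra.
        - transitivity (sqrt (F t x) * sqrt (F t x) - sqrt (F t y) * sqrt (F t y)); [ring |].
          now rewrite Ex, Ey. }
    rewrite Rabs_mult, (Rabs_pos_eq (/ _)) by (left; apply Rinv_0_lt_compat; lra).
    assert (Rabs (F t x - F t y) * / (sqrt (F t x) + sqrt (F t y)) <= (Rabs K * Rabs (x - y)) * / sqrt c).
    { apply Rmult_le_compat; [apply Rabs_pos | | | apply Rinv_le_contravar; lra].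
      - left; apply Rinv_0_lt_compat; lra.
      - eapply Rle_trans; [now apply L | nra]. }
    nra.
  - intros t x Hx. apply (continuous_comp (fun s => F s x) sqrt); auto. apply continuous_sqrt.
Qed.

Lemma bl_param lo hi K h : (forall t, Rabs (h t) <= K) -> (forall t, continuous h t) ->
  bounded_lipschitz lo hi K (fun t _ => h t).
Proof.
  intros B Cc. split; auto. intros t x y _ _. rewrite Rminus_diag, Rabs_R0.
  apply Rmult_le_pos; [| apply Rabs_pos].
  eapply Rle_trans; [apply Rabs_pos | apply (B 0)].
Qed.

Lemma bl_id lo hi : bounded_lipschitz lo hi (1 + Rabs lo + Rabs hi) (fun _ x => x).
Proof.
  split.
  - intros _ x Hx. unfold Rabs. repeat destruct Rcase_abs; lra.
  - intros _ x y _ _. assert (P := Rabs_pos (x - y)).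
    assert (P1 := Rabs_pos lo). assert (P2 := Rabs_pos hi). nra.
  - intros t x _. apply continuous_const.
Qed.

Lemma bl_sub lo hi lo' hi' K F : lo <= lo' -> hi' <= hi ->
  bounded_lipschitz lo hi K F -> bounded_lipschitz lo' hi' K F.
Proof.
  intros H1 H2 [B L Cc]. split; intros; (apply B || apply L || apply Cc); lra.
Qed.

Section C11.

Variables lo hi : R.

Lemma C11_intro F DF K1 K2 :
  (forall t x, lo < x < hi -> is_derive (F t) x (DF t x)) ->
  bounded_lipschitz lo hi K1 F -> bounded_lipschitz lo hi K2 DF -> C11 lo hi F.
Proof.
  intros D B1 B2. exists DF, (Rmax K1 K2). split; [auto | split].
  - apply bl_weaken with K1; auto. apply Rmax_l.
  - apply bl_weaken with K2; auto. apply Rmax_r.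
Qed.

Lemma C11_bl F : C11 lo hi F -> exists K, bounded_lipschitz lo hi K F.
Proof. intros [DF [K [_ [B _]]]]. now exists K. Qed.

Lemma C11_ext F G : (forall t x, F t x = G t x) -> C11 lo hi F -> C11 lo hi G.
Proof.
  intros E [DF [K [D [B1 B2]]]]. apply (C11_intro G DF K K); auto.
  - intros t x Hx. apply (is_derive_ext (F t)); auto.
  - now apply (bl_ext lo hi K F).
Qed.

Lemma C11_param (h : R -> R) K :
  (forall t, Rabs (h t) <= K) -> (forall t, continuous h t) -> C11 lo hi (fun t _ => h t).
Proof.
  intros B Cc. eapply (C11_intro _ (fun _ _ => 0) K 0).
  - intros t x _. apply (is_derive_const (h t) x).
  - now apply bl_param.
  - apply (bl_param _ _ _ (fun _ => 0)).
    + intros _. rewrite Rabs_R0. lra.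
    + intros t. apply continuous_const.
Qed.

Lemma C11_const c : C11 lo hi (fun _ _ => c).
Proof.
  apply (C11_param (fun _ => c) (Rabs c)); [intros; lra |]. intros; apply continuous_const.
Qed.

Lemma C11_id : C11 lo hi (fun _ x => x).
Proof.
  eapply (C11_intro _ (fun _ _ => 1) _ 1).
  - intros t x _. apply (is_derive_id x).
  - apply bl_id.
  - apply (bl_param _ _ _ (fun _ => 1)).
    + intros _. rewrite Rabs_R1. lra.
    + intros t. apply continuous_const.
Qed.

Lemma C11_plus F G : C11 lo hi F -> C11 lo hi G -> C11 lo hi (fun t x => F t x + G t x).
Proof.
  intros [DF [K [D [B1 B2]]]] [DG [K' [D' [B1' B2']]]].
  eapply (C11_intro _ (fun t x => DF t x + DG t x) (K + K') (K + K')).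
  - intros t x Hx. apply is_derive_R_plus; auto.
  - now apply bl_plus.
  - now apply bl_plus.
Qed.

Lemma C11_mult F G : C11 lo hi F -> C11 lo hi G -> C11 lo hi (fun t x => F t x * G t x).
Proof.
  intros [DF [K [D [B1 B2]]]] [DG [K' [D' [B1' B2']]]].
  eapply (C11_intro _ (fun t x => DF t x * G t x + F t x * DG t x)).
  - intros t x Hx. apply is_derive_R_mult; auto.
  - apply bl_mult; eauto.
  - apply bl_plus; apply bl_mult; eauto.
Qed.

Lemma C11_scal c F : C11 lo hi F -> C11 lo hi (fun t x => c * F t x).
Proof. intros H. apply C11_mult; auto. apply C11_const. Qed.

Lemma C11_opp F : C11 lo hi F -> C11 lo hi (fun t x => - F t x).
Proof. intros H. apply (C11_ext (fun t x => -1 * F t x)); [intros; ring |]. now apply C11_scal. Qed.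

Lemma C11_minus F G : C11 lo hi F -> C11 lo hi G -> C11 lo hi (fun t x => F t x - G t x).
Proof. intros HF HG. apply C11_plus; auto. now apply C11_opp. Qed.

Lemma C11_pow F n : C11 lo hi F -> C11 lo hi (fun t x => F t x ^ n).
Proof.
  intros H. induction n as [| n IH]; simpl; [apply C11_const | now apply C11_mult].
Qed.

Lemma C11_sum (F : nat -> R -> R -> R) n :
  (forall i, C11 lo hi (F i)) -> C11 lo hi (fun t x => sum_f_R0 (fun i => F i t x) n).
Proof.
  intros H. induction n as [| n IH]; simpl; [auto | now apply C11_plus].
Qed.

Lemma C11_inv F c : 0 < c -> (forall t x, lo < x < hi -> c <= F t x) ->
  C11 lo hi F -> C11 lo hi (fun t x => / F t x).
Proof.
  intros Hc HF [DF [K [D [B1 B2]]]].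
  assert (BI := bl_inv lo hi K c F Hc HF B1).
  eapply (C11_intro _ (fun t x => -1 * (DF t x * (/ F t x * / F t x)))).
  - intros t x Hx. specialize (HF t x Hx).
    apply is_derive_eq with (- DF t x / F t x ^ 2); [| field; lra].
    apply (is_derive_inv (F t)); auto. lra.
  - exact BI.
  - apply bl_mult.
    + apply (bl_param _ _ 1 (fun _ => -1)).
      * intros _. rewrite Rabs_left; lra.
      * intros t. apply continuous_const.
    + apply bl_mult; eauto. apply bl_mult; eauto.
Qed.

Lemma C11_sqrt F c : 0 < c -> (forall t x, lo < x < hi -> c <= F t x) ->
  C11 lo hi F -> C11 lo hi (fun t x => sqrt (F t x)).
Proof.
  intros Hc HF [DF [K [D [B1 B2]]]].
  assert (BS := bl_sqrt lo hi K c F Hc HF B1).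
  assert (Sc : 0 < sqrt c) by now apply sqrt_lt_R0.
  assert (HS : forall t x, lo < x < hi -> sqrt c <= sqrt (F t x)).
  { intros t x Hx. apply sqrt_le_1; try lra; specialize (HF t x Hx); lra. }
  assert (BI := bl_inv lo hi _ (sqrt c) _ Sc HS BS).
  eapply (C11_intro _ (fun t x => /2 * (DF t x * / sqrt (F t x)))).
  - intros t x Hx. specialize (HF t x Hx).
    apply is_derive_eq with (DF t x / (2 * sqrt (F t x))).
    + apply (is_derive_sqrt (F t)); auto. lra.
    + assert (0 < sqrt (F t x)) by (apply sqrt_lt_R0; lra). field. lra.
  - exact BS.
  - apply bl_mult.
    + apply (bl_param _ _ (/2) (fun _ => /2)).
      * intros _. rewrite Rabs_pos_eq; lra.
      * intros t. apply continuous_const.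
    + apply bl_mult; eauto.
Qed.

Lemma C11_poly2 (a : nat -> nat -> R) F G : C11 lo hi F -> C11 lo hi G ->
  C11 lo hi (fun t x => poly2 a (F t x) (G t x)).
Proof.
  intros HF HG. unfold poly2.
  apply (C11_sum (fun i t x => sum_f_R0 (fun j => a i j * F t x ^ i * G t x ^ j) 3)).
  intros i. apply (C11_sum (fun j t x => a i j * F t x ^ i * G t x ^ j)).
  intros j. apply C11_mult; [apply C11_scal |]; now apply C11_pow.
Qed.

(* The second difference is the increment over [0, d] of
   [s -> F t (x + s) - F t (y + s)], whose derivative is Lipschitz in [x - y]. *)
Lemma C11_second_difference F : C11 lo hi F ->
  exists K, forall t x y d, lo < x < hi -> lo < y < hi -> lo < x + d < hi -> lo < y + d < hi ->
    Rabs ((F t (x + d) - F t x) - (F t (y + d) - F t y)) <= K * Rabs (x - y) * Rabs d.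
Proof.
  intros [DF [K [D [B1 B2]]]]. exists K. intros t x y d Hx Hy Hxd Hyd.
  set (phi := fun s => F t (x + s) - F t (y + s)).
  assert (E : F t (x + d) - F t x - (F t (y + d) - F t y) = phi d - phi 0).
  { unfold phi. rewrite !Rplus_0_r. ring. }
  rewrite E. replace (Rabs d) with (Rabs (d - 0)) by (f_equal; ring).
  assert (in_seg : forall z s, lo < z < hi -> lo < z + d < hi -> Rmin 0 d <= s <= Rmax 0 d -> lo < z + s < hi).
  { intros z s Hz Hzd. unfold Rmin, Rmax. destruct (Rle_dec 0 d); lra. }
  apply (derive_bound_lipschitz phi (fun s => DF t (x + s) - DF t (y + s))).
  - intros s Hs. unfold phi.
    assert (C : forall z, lo < z + s < hi -> is_derive (fun s => F t (z + s)) s (DF t (z + s))).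
    { intros z Hz. apply is_derive_eq with (DF t (z + s) * 1); [| ring].
      apply (is_derive_R_comp (F t) (fun s => z + s)); [now apply D |]. auto_derive; auto. }
    apply (is_derive_R_minus (fun s => F t (x + s)) (fun s => F t (y + s))); apply C; auto.
  - intros s Hs. replace (x - y) with (x + s - (y + s)) by ring. apply (bl_lip _ _ _ _ B2); auto.
Qed.

(** The mean value theorem with a Lipschitz derivative bounds the remainder of F quadratically,
    uniformly in t, and integration keeps the bound. The derivative comes out as an abstract
    function, identified later by uniqueness of derivatives. *)
Lemma C11_integral F T : 0 < T -> C11 lo hi F ->
  forall x, lo < x < hi -> exists DF,
    (forall t, is_derive (F t) x (DF t)) /\ (forall t, continuous DF t) /\
    is_derive (fun x => RInt (fun t => F t x) 0 T) x (RInt DF 0 T).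
Proof.
  intros HT [DF [K [D [B1 B2]]]] x Hx. exists (fun t => DF t x).
  split; [now auto |]. split; [intros t; now apply (bl_cont _ _ _ _ B2) |].
  assert (ex : forall y, lo < y < hi -> ex_RInt (fun t => F t y) 0 T).
  { intros y Hy. apply ex_RInt_continuous_R. intros s. now apply (bl_cont _ _ _ _ B1). }
  assert (exD : ex_RInt (fun t => DF t x) 0 T).
  { apply ex_RInt_continuous_R. intros s. now apply (bl_cont _ _ _ _ B2). }
  assert (quad : forall y, lo < y < hi ->
    Rabs (RInt (fun t => F t y) 0 T - RInt (fun t => F t x) 0 T - (y - x) * RInt (fun t => DF t x) 0 T)
      <= T * (K * Rabs (y - x)) * Rabs (y - x)).
  { intros y Hy.
    replace (RInt (fun t => F t y) 0 T - RInt (fun t => F t x) 0 T - (y - x) * RInt (fun t => DF t x) 0 T)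
      with (RInt (fun t => (F t y - F t x) - (y - x) * DF t x) 0 T).
    2:{ rewrite (RInt_minus (fun t => F t y - F t x) (fun t => (y - x) * DF t x)).
        - rewrite (RInt_minus (fun t => F t y) (fun t => F t x)) by auto.
          rewrite (RInt_scal (fun t => DF t x)) by auto. reflexivity.
        - apply (ex_RInt_minus (fun t => F t y) (fun t => F t x)); auto.
        - apply (ex_RInt_scal (fun t => DF t x)); auto. }
    replace (T * (K * Rabs (y - x)) * Rabs (y - x)) with ((T - 0) * (K * Rabs (y - x) * Rabs (y - x))) by ring.
    apply abs_RInt_le_const; [lra | |].
    - apply (ex_RInt_minus (fun t => F t y - F t x) (fun t => (y - x) * DF t x)).
      + apply (ex_RInt_minus (fun t => F t y) (fun t => F t x)); auto.
      + apply (ex_RInt_scal (fun t => DF t x)); auto.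
    - intros t _.
      assert (seg : forall s, Rmin x y <= s <= Rmax x y -> lo < s < hi).
      { intros s. unfold Rmin, Rmax. destruct (Rle_dec x y); lra. }
      destruct (segment_mvt (F t) (DF t) x y) as [c [Ic ->]]; [intros s Hs; apply D; auto |].
      replace (DF t c * (y - x) - (y - x) * DF t x) with ((DF t c - DF t x) * (y - x)) by ring.
      rewrite Rabs_mult. apply Rmult_le_compat_r; [apply Rabs_pos |].
      eapply Rle_trans; [apply (bl_lip _ _ _ _ B2); auto |].
      apply Rmult_le_compat_l.
      + eapply Rle_trans; [apply Rabs_pos | apply (bl_bound _ _ _ _ B1 0 x Hx)].
      + revert Ic. unfold Rmin, Rmax, Rabs. destruct (Rle_dec x y); repeat destruct Rcase_abs; lra. }
  apply is_derive_Reals. intros eps He.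
  assert (TK : 0 < T * Rabs K + 1) by (assert (P := Rabs_pos K); nra).
  assert (Hd : 0 < Rmin (eps / (T * Rabs K + 1)) (Rmin (x - lo) (hi - x))).
  { repeat apply Rmin_case; try lra. now apply Rdiv_lt_0_compat. }
  exists (mkposreal _ Hd). intros h Hh Hh'. simpl in Hh'.
  apply Rmin_Rgt in Hh'. destruct Hh' as [H1 H2]. apply Rmin_Rgt in H2.
  assert (Iy : lo < x + h < hi).
  { revert H2. unfold Rabs. destruct Rcase_abs; lra. }
  assert (Q := quad (x + h) Iy). replace (x + h - x) with h in Q by ring.
  replace ((RInt (fun t => F t (x + h)) 0 T - RInt (fun t => F t x) 0 T) / h - RInt (fun t => DF t x) 0 T)
    with ((RInt (fun t => F t (x + h)) 0 T - RInt (fun t => F t x) 0 T - h * RInt (fun t => DF t x) 0 T) / h)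
    by (field; auto).
  unfold Rdiv at 1. rewrite Rabs_mult, Rabs_inv.
  assert (Ph := Rabs_pos_lt h Hh).
  apply Rmult_lt_reg_r with (Rabs h); auto.
  rewrite Rmult_assoc, Rinv_l, Rmult_1_r by lra.
  eapply Rle_lt_trans; [apply Q |]. apply Rmult_lt_compat_r; auto.
  assert (H1' : Rabs h * (T * Rabs K + 1) < eps).
  { apply Rmult_lt_reg_r with (/ (T * Rabs K + 1)); [now apply Rinv_0_lt_compat |].
    rewrite Rmult_assoc, Rinv_r, Rmult_1_r by lra. exact H1. }
  assert (P := Rle_abs K). assert (T * K * Rabs h <= T * Rabs K * Rabs h).
  { apply Rmult_le_compat_r; [lra |]. apply Rmult_le_compat_l; lra. }
  nra.
Qed.

End C11.

Lemma C11_sub lo hi lo' hi' F : lo <= lo' -> hi' <= hi -> C11 lo hi F -> C11 lo' hi' F.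
Proof.
  intros H1 H2 [DF [K [D [B1 B2]]]]. exists DF, K. split; [| split].
  - intros t x Hx. apply D. lra.
  - now apply (bl_sub lo hi).
  - now apply (bl_sub lo hi).
Qed.

(** * Coordinates adapted to the Hamiltonian *)

Lemma is_derive_sum_f_R0 (f df : nat -> R -> R) (x : R) (n : nat) :
  (forall i, is_derive (f i) x (df i x)) ->
  is_derive (fun t => sum_f_R0 (fun i => f i t) n) x (sum_f_R0 (fun i => df i x) n).
Proof.
  intros H. induction n as [| n IH]; simpl; [apply H |].
  apply (is_derive_R_plus (fun t => sum_f_R0 (fun i => f i t) n) (f (S n))); auto.
Qed.

Lemma is_derive_poly2 (a : nat -> nat -> R) (x y : R -> R) (t x' y' : R) :
  is_derive x t x' -> is_derive y t y' ->
  is_derive (fun s => poly2 a (x s) (y s)) t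
    (poly2_du a (x t) (y t) * x' + poly2_dv a (x t) (y t) * y').
Proof.
  intros Hx Hy. unfold poly2, poly2_du, poly2_dv.
  eapply is_derive_eq.
  - apply (is_derive_sum_f_R0
      (fun i s => sum_f_R0 (fun j => a i j * x s ^ i * y s ^ j) 3)
      (fun i _ => sum_f_R0 (fun j =>
         INR i * a i j * x t ^ (i - 1) * y t ^ j * x' + INR j * a i j * x t ^ i * y t ^ (j - 1) * y') 3)).
    intros i.
    apply (is_derive_sum_f_R0 (fun j s => a i j * x s ^ i * y s ^ j)
      (fun j _ => INR i * a i j * x t ^ (i - 1) * y t ^ j * x' + INR j * a i j * x t ^ i * y t ^ (j - 1) * y')).
    intros j. eapply is_derive_eq.
    + apply (is_derive_R_mult (fun s => a i j * x s ^ i) (fun s => y s ^ j)).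
      * apply (is_derive_R_scal (fun s => x s ^ i)). apply (is_derive_pow x); eauto.
      * apply (is_derive_pow y); eauto.
    + rewrite !Nat.sub_1_r. ring.
  - simpl. ring.
Qed.

Section Coordinates.

(* [Ucrd], [Vcrd] parametrize a neighbourhood of the origin by [t] and [rho]
   so that [H2] becomes [k ^ 2 * rho ^ 4 / 2], with [a = 2 h20 - h11 ^ 2] and
   [k ^ 2 = -16 (h20 ^ 2 + h40)]; [om] is [(v + v ^ 2 / 2) / rho ^ 2]. *)
Variables k a : R.

Definition cs (t : R) := sqrt (1 + cos t ^ 2).
(** A smooth square root of 1 - cos^4 t whose sign follows -sin t. With u = rho cos t and W = k
    rho^2 [sn t] it gives W^2 + k^2 u^4 = k^2 rho^4. For k > 0 the minus sign makes t increase along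
    the unperturbed flow. *)
Definition sn (t : R) := - sin t * cs t.
Definition om (t : R) := k * sn t - 2 * a * cos t ^ 2.
Definition om' (t : R) := - 2 * k * cos t ^ 3 / cs t + 4 * a * cos t * sin t.
(** This is 1 + v for the root v near 0 of v + v^2/2 = rho^2 om. *)
Definition zz (t rho : R) := sqrt (1 + 2 * rho ^ 2 * om t).
Definition Ucrd (t rho : R) := rho * cos t.
Definition Vcrd (t rho : R) := zz t rho - 1.
Definition U_t (t rho : R) := - (rho * sin t).
Definition U_r (t rho : R) := cos t.
Definition V_t (t rho : R) := rho ^ 2 * om' t / zz t rho.
Definition V_r (t rho : R) := 2 * rho * om t / zz t rho.
Definition jac (t rho : R) := 2 * k * rho ^ 2 / (cs t * zz t rho).
Definition Om := 2 * Rabs k + 2 * Rabs a.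

Lemma cs_sq t : cs t * cs t = 1 + cos t ^ 2.
Proof. unfold cs. apply sqrt_sqrt. assert (P := pow2_ge_0 (cos t)). lra. Qed.

Lemma cs_bounds t : 1 <= cs t <= 2.
Proof.
  assert (P := pow2_ge_0 (cos t)). assert (Q := COS_bound t).
  assert (cos t ^ 2 <= 1) by nra.
  assert (E := cs_sq t). assert (0 <= cs t) by apply sqrt_pos. split; nra.
Qed.

Lemma sin_sq t : sin t * sin t = 1 - cos t ^ 2.
Proof. assert (P := sin2_cos2 t). unfold Rsqr in P. lra. Qed.

Lemma sn_sq t : sn t ^ 2 = 1 - cos t ^ 4.
Proof.
  unfold sn. transitivity ((sin t * sin t) * (cs t * cs t)); [ring |].
  rewrite cs_sq, sin_sq. ring.
Qed.

Lemma sn_bound t : Rabs (sn t) <= 2.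
Proof.
  unfold sn. rewrite Rabs_mult, Rabs_Ropp.
  assert (Q := SIN_bound t). assert (P := cs_bounds t).
  rewrite (Rabs_pos_eq (cs t)) by lra.
  assert (Rabs (sin t) <= 1) by (apply Rabs_le; lra).
  assert (R0 := Rabs_pos (sin t)). nra.
Qed.

Lemma om_bound t : Rabs (om t) <= Om.
Proof.
  unfold om, Om. eapply Rle_trans; [apply Rabs_triang |]. rewrite Rabs_Ropp, !Rabs_mult.
  rewrite (Rabs_pos_eq 2) by lra. assert (S := sn_bound t).
  assert (P := pow2_ge_0 (cos t)). assert (Q := COS_bound t).
  rewrite (Rabs_pos_eq (cos t ^ 2)) by auto. assert (cos t ^ 2 <= 1) by nra.
  assert (R1 := Rabs_pos k). assert (R2 := Rabs_pos a). nra.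
Qed.

Lemma Om_nonneg : 0 <= Om.
Proof. unfold Om. assert (R1 := Rabs_pos k). assert (R2 := Rabs_pos a). lra. Qed.

Lemma is_derive_cs t : is_derive cs t (- cos t * sin t / cs t).
Proof.
  assert (P := pow2_ge_0 (cos t)). assert (Q := cs_bounds t).
  unfold cs. eapply is_derive_eq.
  - apply (is_derive_sqrt (fun t => 1 + cos t ^ 2)); [| lra].
    apply (is_derive_R_plus (fun _ => 1)); [apply (is_derive_const 1) |].
    apply (is_derive_pow cos), is_derive_cos.
  - fold (cs t). unfold zero; simpl. field. lra.
Qed.

Lemma is_derive_sn t : is_derive sn t (- 2 * cos t ^ 3 / cs t).
Proof.
  assert (Q := cs_bounds t).
  apply is_derive_eq with (- cos t * cs t + - sin t * (- cos t * sin t / cs t)).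
  - apply (is_derive_R_mult (fun t => - sin t) cs); [| apply is_derive_cs].
    auto_derive; auto. ring.
  - assert (E := cs_sq t). assert (E' := sin_sq t).
    apply Rmult_eq_reg_r with (cs t); [| lra].
    transitivity (cos t * (sin t * sin t - cs t * cs t)); [field; lra |].
    rewrite E, E'. field. lra.
Qed.

Lemma is_derive_om t : is_derive om t (om' t).
Proof.
  unfold om. eapply is_derive_eq.
  - apply (is_derive_R_minus (fun t => k * sn t) (fun t => 2 * a * cos t ^ 2)).
    + apply (is_derive_R_scal sn). apply is_derive_sn.
    + apply (is_derive_R_scal (fun t => cos t ^ 2)). apply (is_derive_pow cos), is_derive_cos.
  - unfold om'. assert (Q := cs_bounds t). simpl. field. lra.
Qed.

Variable R0 : R.
(** Gives 2 rho^2 |om| <= 1/2, so the radicand of [zz] stays in [1/2, 3/2]. The interval of radii is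
    symmetric so that rho = 0, where the Melnikov function vanishes, is an interior point. *)
Hypothesis R0_small : 4 * Om * R0 ^ 2 <= 1.

Lemma om_small t rho : - R0 < rho < R0 -> Rabs (rho ^ 2 * om t) <= Om * rho ^ 2 /\ 4 * (Om * rho ^ 2) <= 1.
Proof.
  intros H. assert (B := om_bound t). assert (P := pow2_ge_0 rho).
  assert (rho ^ 2 <= R0 ^ 2) by nra. assert (N := Om_nonneg). split.
  - rewrite Rabs_mult, (Rabs_pos_eq (rho ^ 2)) by auto. nra.
  - nra.
Qed.

Lemma zz_arg t rho : - R0 < rho < R0 -> / 2 <= 1 + 2 * rho ^ 2 * om t <= 3 / 2.
Proof.
  intros H. destruct (om_small t rho H) as [A B]. apply Rabs_le_between in A. lra.
Qed.

Lemma zz_sq t rho : - R0 < rho < R0 -> zz t rho * zz t rho = 1 + 2 * rho ^ 2 * om t.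
Proof. intros H. apply sqrt_sqrt. assert (A := zz_arg t rho H). lra. Qed.

Lemma zz_bounds t rho : - R0 < rho < R0 -> / 2 <= zz t rho <= 2.
Proof.
  intros H. assert (A := zz_arg t rho H). assert (E := zz_sq t rho H).
  assert (P : 0 <= zz t rho) by apply sqrt_pos. split; nra.
Qed.

Lemma is_derive_U_t t rho : is_derive (fun t => Ucrd t rho) t (U_t t rho).
Proof.
  apply is_derive_eq with (rho * - sin t); [| unfold U_t; ring].
  apply (is_derive_R_scal cos), is_derive_cos.
Qed.

Lemma is_derive_U_r t rho : is_derive (Ucrd t) rho (U_r t rho).
Proof.
  apply is_derive_eq with (1 * cos t + rho * 0); [| unfold U_r; ring].
  apply (is_derive_R_mult (fun r => r) (fun _ => cos t)); [apply (is_derive_id rho) | apply (is_derive_const (cos t))].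
Qed.

(** Stated along a curve, so that one computation yields both partial derivatives and, later, the
    velocity of the planar solution. *)
Lemma is_derive_zz (x y : R -> R) (s x' y' : R) :
  - R0 < y s < R0 -> is_derive x s x' -> is_derive y s y' ->
  is_derive (fun s => zz (x s) (y s)) s (V_t (x s) (y s) * x' + V_r (x s) (y s) * y').
Proof.
  intros H Hx Hy. assert (A := zz_arg (x s) (y s) H). assert (B := zz_bounds (x s) (y s) H).
  unfold zz. eapply is_derive_eq.
  - apply (is_derive_sqrt (fun s => 1 + 2 * y s ^ 2 * om (x s))); [| lra].
    apply (is_derive_R_plus (fun _ => 1)); [apply (is_derive_const 1) |].
    apply (is_derive_R_mult (fun s => 2 * y s ^ 2) (fun s => om (x s))).
    + apply (is_derive_R_scal (fun s => y s ^ 2)). apply (is_derive_pow y); eauto.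
    + apply (is_derive_R_comp om x); [apply is_derive_om | exact Hx].
  - fold (zz (x s) (y s)). unfold V_t, V_r, zero; simpl. field. lra.
Qed.

Lemma is_derive_V_t t rho : - R0 < rho < R0 -> is_derive (fun t => Vcrd t rho) t (V_t t rho).
Proof.
  intros H. unfold Vcrd. eapply is_derive_eq.
  - apply (is_derive_R_minus (fun t => zz t rho) (fun _ => 1)); [| apply (is_derive_const 1)].
    apply (is_derive_zz (fun t => t) (fun _ => rho) t 1 0); auto.
    + apply (is_derive_id t).
    + apply (is_derive_const rho).
  - unfold zero; simpl. ring.
Qed.

Lemma is_derive_V_r t rho : - R0 < rho < R0 -> is_derive (Vcrd t) rho (V_r t rho).
Proof.
  intros H. unfold Vcrd. eapply is_derive_eq.
  - apply (is_derive_R_minus (fun rho => zz t rho) (fun _ => 1)); [| apply (is_derive_const 1)].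
    apply (is_derive_zz (fun _ => t) (fun rho => rho) rho 0 1); auto.
    + apply (is_derive_const t).
    + apply (is_derive_id rho).
  - unfold zero; simpl. ring.
Qed.

(** The common value of the two mixed partial derivatives of [Vcrd]; their cancellation is what
    makes Green's identity pointwise. *)
Definition V_tr (t rho : R) := 2 * rho * om' t / zz t rho - 2 * rho ^ 3 * om t * om' t / zz t rho ^ 3.

Lemma is_derive_V_t_r t rho : - R0 < rho < R0 -> is_derive (V_t t) rho (V_tr t rho).
Proof.
  intros H. assert (B := zz_bounds t rho H).
  apply is_derive_eq with ((2 * rho * om' t * zz t rho - rho ^ 2 * om' t * V_r t rho) / zz t rho ^ 2).
  - apply (is_derive_div (fun rho => rho ^ 2 * om' t) (zz t)); [| | lra].
    + auto_derive; auto. ring.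
    + apply is_derive_eq with (V_t t rho * 0 + V_r t rho * 1); [| ring].
      apply (is_derive_zz (fun _ => t) (fun rho => rho)); auto.
      * apply (is_derive_const t).
      * apply (is_derive_id rho).
  - unfold V_tr, V_r. field. lra.
Qed.

Lemma is_derive_V_r_t t rho : - R0 < rho < R0 -> is_derive (fun t => V_r t rho) t (V_tr t rho).
Proof.
  intros H. assert (B := zz_bounds t rho H).
  apply is_derive_eq with ((2 * rho * om' t * zz t rho - 2 * rho * om t * V_t t rho) / zz t rho ^ 2).
  - apply (is_derive_div (fun t => 2 * rho * om t) (fun t => zz t rho)); [| | lra].
    + apply (is_derive_R_scal om). apply is_derive_om.
    + apply is_derive_eq with (V_t t rho * 1 + V_r t rho * 0); [| ring].
      apply (is_derive_zz (fun t => t) (fun _ => rho)); auto.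
      * apply (is_derive_id t).
      * apply (is_derive_const rho).
  - unfold V_tr, V_t. field. lra.
Qed.

(** The terms in [a] cancel, and what is left is sin^2 t (1 + cos^2 t) + cos^4 t = 1. *)
Lemma jac_identity t rho : - R0 < rho < R0 ->
  U_t t rho * V_r t rho - U_r t rho * V_t t rho = jac t rho.
Proof.
  intros H. assert (B := zz_bounds t rho H). assert (Q := cs_bounds t).
  unfold U_t, U_r, V_t, V_r, jac, om, om', sn.
  apply Rmult_eq_reg_r with (zz t rho * cs t); [| nra].
  transitivity (2 * k * rho ^ 2 * ((sin t * sin t) * (cs t * cs t) + cos t ^ 4)); [field; lra |].
  rewrite sin_sq, cs_sq. field. lra.
Qed.

Lemma coord_periodic t rho :
  cs (t + 2 * PI) = cs t /\ om (t + 2 * PI) = om t /\ om' (t + 2 * PI) = om' t /\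
  Ucrd (t + 2 * PI) rho = Ucrd t rho /\ Vcrd (t + 2 * PI) rho = Vcrd t rho /\
  U_t (t + 2 * PI) rho = U_t t rho /\ U_r (t + 2 * PI) rho = U_r t rho /\
  V_t (t + 2 * PI) rho = V_t t rho /\ V_r (t + 2 * PI) rho = V_r t rho /\
  jac (t + 2 * PI) rho = jac t rho.
Proof.
  assert (E1 : cos (t + 2 * PI) = cos t) by (rewrite <- (cos_period t 1); f_equal; simpl; ring).
  assert (E2 : sin (t + 2 * PI) = sin t) by (rewrite <- (sin_period t 1); f_equal; simpl; ring).
  unfold Ucrd, Vcrd, U_t, U_r, V_t, V_r, jac, zz, om, om', sn, cs. rewrite !E1, !E2.
  repeat split; reflexivity.
Qed.

Lemma om_continuous t : continuous om t.
Proof. apply (ex_derive_continuous om t). eexists. apply is_derive_om. Qed.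

Lemma cs_continuous t : continuous cs t.
Proof. apply (ex_derive_continuous cs t). eexists. apply is_derive_cs. Qed.

Lemma cos_continuous t : continuous cos t.
Proof. apply (ex_derive_continuous cos t). eexists. apply is_derive_cos. Qed.

Lemma sin_continuous t : continuous sin t.
Proof. apply (ex_derive_continuous sin t). eexists. apply is_derive_sin. Qed.

Lemma C11_cos : C11 (- R0) R0 (fun t _ => cos t).
Proof.
  apply C11_param with 1; [| apply cos_continuous]. intros t. assert (Q := COS_bound t).
  apply Rabs_le. lra.
Qed.

Lemma C11_sin : C11 (- R0) R0 (fun t _ => sin t).
Proof.
  apply C11_param with 1; [| apply sin_continuous]. intros t. assert (Q := SIN_bound t).
  apply Rabs_le. lra.
Qed.

Lemma C11_cs : C11 (- R0) R0 (fun t _ => cs t).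
Proof.
  apply C11_param with 2; [| apply cs_continuous]. intros t. assert (Q := cs_bounds t).
  apply Rabs_le. lra.
Qed.

Lemma C11_inv_cs : C11 (- R0) R0 (fun t _ => / cs t).
Proof.
  apply (C11_inv _ _ (fun t _ => cs t) 1); [lra | | apply C11_cs]. intros t x _. apply cs_bounds.
Qed.

Lemma C11_om : C11 (- R0) R0 (fun t _ => om t).
Proof. apply C11_param with Om; [apply om_bound | apply om_continuous]. Qed.

Lemma C11_om' : C11 (- R0) R0 (fun t _ => om' t).
Proof.
  unfold om', Rdiv. apply C11_plus.
  - apply C11_mult; [| apply C11_inv_cs].
    apply (C11_scal _ _ (- 2 * k) (fun t _ => cos t ^ 3)).
    apply (C11_pow _ _ (fun t _ => cos t)), C11_cos.
  - apply (C11_mult _ _ (fun t _ => 4 * a * cos t)); [| apply C11_sin].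
    apply (C11_scal _ _ (4 * a) (fun t _ => cos t)), C11_cos.
Qed.

Lemma C11_zz : C11 (- R0) R0 zz.
Proof.
  apply (C11_sqrt _ _ (fun t rho => 1 + 2 * rho ^ 2 * om t) (/ 2)); [lra | |].
  - intros t x H. apply (zz_arg t x H).
  - apply C11_plus; [apply C11_const |].
    apply (C11_mult _ _ (fun t rho => 2 * rho ^ 2) (fun t _ => om t)); [| apply C11_om].
    apply C11_scal, C11_pow, C11_id.
Qed.

Lemma C11_inv_zz : C11 (- R0) R0 (fun t rho => / zz t rho).
Proof.
  apply (C11_inv _ _ zz (/ 2)); [lra | | apply C11_zz]. intros t x H. apply (zz_bounds t x H).
Qed.

Lemma C11_Ucrd : C11 (- R0) R0 Ucrd.
Proof. apply (C11_mult _ _ (fun _ rho => rho)); [apply C11_id | apply C11_cos]. Qed.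

Lemma C11_Vcrd : C11 (- R0) R0 Vcrd.
Proof. apply C11_minus; [apply C11_zz | apply C11_const]. Qed.

Lemma C11_U_t : C11 (- R0) R0 U_t.
Proof. apply C11_opp. apply (C11_mult _ _ (fun _ rho => rho)); [apply C11_id | apply C11_sin]. Qed.

Lemma C11_V_t : C11 (- R0) R0 V_t.
Proof.
  unfold V_t, Rdiv. apply (C11_mult _ _ (fun t rho => rho ^ 2 * om' t)); [| apply C11_inv_zz].
  apply (C11_mult _ _ (fun t rho => rho ^ 2) (fun t _ => om' t)); [| apply C11_om'].
  apply C11_pow, C11_id.
Qed.

Lemma C11_V_r : C11 (- R0) R0 V_r.
Proof.
  unfold V_r, Rdiv. apply (C11_mult _ _ (fun t rho => 2 * rho * om t)); [| apply C11_inv_zz].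
  apply (C11_mult _ _ (fun t rho => 2 * rho) (fun t _ => om t)); [| apply C11_om].
  apply C11_scal, C11_id.
Qed.

Lemma C11_jac : C11 (- R0) R0 jac.
Proof.
  apply (C11_ext _ _ (fun t rho => 2 * k * rho ^ 2 * (/ cs t * / zz t rho))).
  - intros t rho. unfold jac, Rdiv. now rewrite Rinv_mult.
  - apply C11_mult.
    + apply C11_scal, C11_pow, C11_id.
    + apply (C11_mult _ _ (fun t _ => / cs t)); [apply C11_inv_cs | apply C11_inv_zz].
Qed.

Section Flux.

Variables p q : nat -> nat -> R.

Definition flux (t rho : R) :=
  poly2 q (Ucrd t rho) (Vcrd t rho) * U_t t rho - poly2 p (Ucrd t rho) (Vcrd t rho) * V_t t rho.
Definition radial_flux (t rho : R) :=
  poly2 q (Ucrd t rho) (Vcrd t rho) * U_r t rho - poly2 p (Ucrd t rho) (Vcrd t rho) * V_r t rho.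

Lemma C11_flux : C11 (- R0) R0 flux.
Proof.
  apply (C11_minus _ _ (fun t rho => poly2 q (Ucrd t rho) (Vcrd t rho) * U_t t rho)
    (fun t rho => poly2 p (Ucrd t rho) (Vcrd t rho) * V_t t rho)).
  - apply (C11_mult _ _ (fun t rho => poly2 q (Ucrd t rho) (Vcrd t rho)) U_t); [| apply C11_U_t].
    apply C11_poly2; [apply C11_Ucrd | apply C11_Vcrd].
  - apply (C11_mult _ _ (fun t rho => poly2 p (Ucrd t rho) (Vcrd t rho)) V_t); [| apply C11_V_t].
    apply C11_poly2; [apply C11_Ucrd | apply C11_Vcrd].
Qed.

Lemma C11_radial_flux : C11 (- R0) R0 radial_flux.
Proof.
  apply (C11_minus _ _ (fun t rho => poly2 q (Ucrd t rho) (Vcrd t rho) * U_r t rho)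
    (fun t rho => poly2 p (Ucrd t rho) (Vcrd t rho) * V_r t rho)).
  - apply (C11_mult _ _ (fun t rho => poly2 q (Ucrd t rho) (Vcrd t rho)) U_r); [| apply C11_cos].
    apply C11_poly2; [apply C11_Ucrd | apply C11_Vcrd].
  - apply (C11_mult _ _ (fun t rho => poly2 p (Ucrd t rho) (Vcrd t rho)) V_r); [| apply C11_V_r].
    apply C11_poly2; [apply C11_Ucrd | apply C11_Vcrd].
Qed.

Lemma flux_periodic t rho : flux (t + 2 * PI) rho = flux t rho.
Proof.
  destruct (coord_periodic t rho) as [_ [_ [_ [E1 [E2 [E3 [E4 [E5 [E6 _]]]]]]]]].
  unfold flux. now rewrite E1, E2, E3, E5.
Qed.

Lemma radial_flux_periodic t rho : radial_flux (t + 2 * PI) rho = radial_flux t rho.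
Proof.
  destruct (coord_periodic t rho) as [_ [_ [_ [E1 [E2 [E3 [E4 [E5 [E6 _]]]]]]]]].
  unfold radial_flux. now rewrite E1, E2, E4, E6.
Qed.

(* Green's formula in the coordinates (t, rho). *)
Lemma green_identity t rho : - R0 < rho < R0 -> exists b,
  is_derive (fun t => radial_flux t rho) t b /\
  is_derive (flux t) rho (b +
    (poly2_du p (Ucrd t rho) (Vcrd t rho) + poly2_dv q (Ucrd t rho) (Vcrd t rho)) * jac t rho).
Proof.
  intros H. eexists. split.
  - unfold radial_flux.
    apply (is_derive_R_minus
      (fun t => poly2 q (Ucrd t rho) (Vcrd t rho) * U_r t rho)
      (fun t => poly2 p (Ucrd t rho) (Vcrd t rho) * V_r t rho)).
    + apply (is_derive_R_mult (fun t => poly2 q (Ucrd t rho) (Vcrd t rho)) (fun t => U_r t rho)).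
      * apply (is_derive_poly2 q (fun t => Ucrd t rho) (fun t => Vcrd t rho));
          [apply is_derive_U_t | now apply is_derive_V_t].
      * apply is_derive_cos.
    + apply (is_derive_R_mult (fun t => poly2 p (Ucrd t rho) (Vcrd t rho)) (fun t => V_r t rho)).
      * apply (is_derive_poly2 p (fun t => Ucrd t rho) (fun t => Vcrd t rho));
          [apply is_derive_U_t | now apply is_derive_V_t].
      * now apply is_derive_V_r_t.
  - unfold flux. eapply is_derive_eq.
    + apply (is_derive_R_minus
        (fun rho => poly2 q (Ucrd t rho) (Vcrd t rho) * U_t t rho)
        (fun rho => poly2 p (Ucrd t rho) (Vcrd t rho) * V_t t rho)).
      * apply (is_derive_R_mult (fun rho => poly2 q (Ucrd t rho) (Vcrd t rho)) (U_t t)).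
        -- apply (is_derive_poly2 q (Ucrd t) (Vcrd t));
             [apply is_derive_U_r | now apply is_derive_V_r].
        -- unfold U_t. instantiate (1 := - sin t). auto_derive; auto. ring.
      * apply (is_derive_R_mult (fun rho => poly2 p (Ucrd t rho) (Vcrd t rho)) (V_t t)).
        -- apply (is_derive_poly2 p (Ucrd t) (Vcrd t));
             [apply is_derive_U_r | now apply is_derive_V_r].
        -- now apply is_derive_V_t_r.
    + rewrite <- jac_identity by auto. unfold U_r. ring.
Qed.

Lemma flux_integral_derive rho (dv : R -> R) : - R0 < rho < R0 ->
  (forall t, continuous dv t) ->
  (forall t, (poly2_du p (Ucrd t rho) (Vcrd t rho) + poly2_dv q (Ucrd t rho) (Vcrd t rho))
     * jac t rho = dv t) ->
  is_derive (fun rho => RInt (fun t => flux t rho) 0 (2 * PI)) rho (RInt dv 0 (2 * PI)).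
Proof.
  intros H Cdv Edv. assert (PP := PI_RGT_0).
  destruct (C11_integral (- R0) R0 flux (2 * PI) ltac:(lra) C11_flux rho H) as [DF [D1 [D2 D3]]].
  apply is_derive_eq with (1 := D3).
  (* The difference between the rho-derivative of the flux and [dv] is the t-derivative of the
     periodic radial flux, so it integrates to zero over a turn. *)
  assert (Db : forall t, is_derive (fun t => radial_flux t rho) t (DF t - dv t)).
  { intros t. destruct (green_identity t rho H) as [b [B1 B2]].
    apply is_derive_eq with (1 := B1).
    apply is_derive_unique in B2. rewrite (is_derive_unique _ _ _ (D1 t)) in B2.
    rewrite B2, <- Edv. unfold Rminus. rewrite Rplus_assoc, Rplus_opp_r, Rplus_0_r. reflexivity. }
  assert (I := is_RInt_derive (fun t => radial_flux t rho) (fun t => DF t - dv t) 0 (2 * PI)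
    (fun t _ => Db t) (fun t _ => continuous_minus DF dv t (D2 t) (Cdv t))).
  apply is_RInt_unique in I.
  rewrite (RInt_minus DF dv) in I by now apply ex_RInt_continuous_R.
  assert (P := radial_flux_periodic 0 rho). rewrite Rplus_0_l in P.
  rewrite P in I. unfold minus, plus, opp in I; simpl in I. lra.
Qed.

Lemma flux_center t : flux t 0 = 0.
Proof. unfold flux, U_t, V_t, Rdiv. ring. Qed.

End Flux.

End Coordinates.

(** * The Melnikov function *)

(** Lets the main part of an integral be read off from a primitive while the error is estimated
    pointwise. *)
Lemma RInt_near_primitive (h G G' : R -> R) (T E : R) :
  0 <= T -> (forall t, continuous h t) -> (forall t, is_derive G t (G' t)) ->
  (forall t, Rabs (h t - G' t) <= E) ->
  Rabs (RInt h 0 T - (G T - G 0)) <= E * T.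
Proof.
  intros HT Hc HG HE.
  replace (RInt h 0 T - (G T - G 0)) with ((RInt h 0 T - G T) - (RInt h 0 0 - G 0))
    by (rewrite RInt_point; unfold zero; simpl; ring).
  eapply Rle_trans.
  - apply (derive_bound_lipschitz (fun t => RInt h 0 t - G t) (fun t => h t - G' t) E); auto.
    intros t _. apply (is_derive_R_minus (fun t => RInt h 0 t) G); auto. now apply is_derive_Rint_upper.
  - rewrite Rminus_0_r, (Rabs_pos_eq T) by auto. lra.
Qed.

Lemma RInt_ge_primitive (h G G' : R -> R) (T : R) :
  0 <= T -> (forall t, continuous h t) -> (forall t, is_derive G t (G' t)) ->
  (forall t, G' t <= h t) -> G T - G 0 <= RInt h 0 T.
Proof.
  intros HT Hc HG HE.
  assert (D : RInt h 0 0 - G 0 <= RInt h 0 T - G T).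
  { apply (derive_nonneg_incr (fun t => RInt h 0 t - G t) (fun t => h t - G' t)); auto.
    - intros t _. apply (is_derive_R_minus (fun t => RInt h 0 t) G); auto. now apply is_derive_Rint_upper.
    - intros t _. specialize (HE t). lra. }
  rewrite RInt_point in D. unfold zero in D; simpl in D. lra.
Qed.

(** Complete elliptic integrals, left unevaluated: their positivity suffices to divide by [J0] and
    [J2] and to see that the rho^7 coefficient, proportional to [JS], is nonzero. *)
Definition J0 := RInt (fun t => / cs t) 0 (2 * PI).
Definition J2 := RInt (fun t => cos t ^ 2 / cs t) 0 (2 * PI).
Definition JS := RInt (fun t => sn t ^ 2 / cs t) 0 (2 * PI).

Lemma inv_cs_continuous t : continuous (fun t => / cs t) t.
Proof.
  apply (continuous_Rinv_comp cs); [apply cs_continuous |]. assert (Q := cs_bounds t). lra.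
Qed.

Lemma sn_continuous t : continuous sn t.
Proof. apply (ex_derive_continuous sn t). eexists. apply is_derive_sn. Qed.

Lemma pow_continuous (h : R -> R) n t : continuous h t -> continuous (fun s => h s ^ n) t.
Proof.
  intros H. induction n as [| n IH]; simpl; [apply continuous_const |].
  apply (continuous_mult h (fun s => h s ^ n)); auto.
Qed.

Lemma J2_continuous t : continuous (fun t => cos t ^ 2 / cs t) t.
Proof.
  apply (continuous_mult (fun t => cos t ^ 2) (fun t => / cs t));
    [apply pow_continuous, cos_continuous | apply inv_cs_continuous].
Qed.

Lemma JS_continuous t : continuous (fun t => sn t ^ 2 / cs t) t.
Proof.
  apply (continuous_mult (fun t => sn t ^ 2) (fun t => / cs t));
    [apply pow_continuous, sn_continuous | apply inv_cs_continuous].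
Qed.

Lemma J0_pos : 0 < J0.
Proof.
  assert (PP := PI_RGT_0).
  assert (H : / 2 * (2 * PI) - / 2 * 0 <= J0); [| lra].
  apply (RInt_ge_primitive _ (fun t => / 2 * t) (fun _ => / 2)); [lra | apply inv_cs_continuous | |].
  - intros t. auto_derive; auto. ring.
  - intros t. assert (Q := cs_bounds t). apply Rinv_le_contravar; lra.
Qed.

Lemma J2_pos : 0 < J2.
Proof.
  assert (PP := PI_RGT_0).
  assert (H : (2 * PI + sin (2 * PI) * cos (2 * PI)) / 4 - (0 + sin 0 * cos 0) / 4 <= J2).
  { apply (RInt_ge_primitive _ (fun t => (t + sin t * cos t) / 4) (fun t => / 2 * cos t ^ 2));
      [lra | apply J2_continuous | |].
    - intros t. auto_derive; auto. assert (E := sin_sq t).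
      transitivity ((1 + cos t ^ 2 - sin t * sin t) / 4); [field | rewrite E; field].
    - intros t. assert (Q := cs_bounds t). assert (P := pow2_ge_0 (cos t)).
      unfold Rdiv. rewrite Rmult_comm. apply Rmult_le_compat_l; auto.
      apply Rinv_le_contravar; lra. }
  rewrite sin_2PI, sin_0 in H. lra.
Qed.

Lemma JS_pos : 0 < JS.
Proof.
  assert (PP := PI_RGT_0).
  assert (H : (2 * PI - sin (2 * PI) * cos (2 * PI)) / 2 - (0 - sin 0 * cos 0) / 2 <= JS).
  { apply (RInt_ge_primitive _ (fun t => (t - sin t * cos t) / 2) (fun t => sin t * sin t));
      [lra | apply JS_continuous | |].
    - intros t. auto_derive; auto. assert (E := sin_sq t).
      transitivity ((1 - cos t ^ 2 + sin t * sin t) / 2); [field | rewrite E; field].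
    - intros t. assert (Q := cs_bounds t).
      replace (sn t ^ 2 / cs t) with (sin t * sin t * cs t) by (unfold sn; field; lra).
      assert (P := Rle_0_sqr (sin t)). unfold Rsqr in P. nra. }
  rewrite sin_2PI, sin_0 in H. lra.
Qed.

(** The relation cs^2 + sin^2 = 2 makes cos/cs the derivative of a 2 pi-periodic function; hence the
    divergence term beta u (1 + v) contributes nothing to the mean. *)
Lemma is_derive_atan_ratio t : is_derive (fun t => atan (sin t / cs t)) t (cos t / cs t).
Proof.
  assert (Q := cs_bounds t). assert (E := cs_sq t). assert (E' := sin_sq t).
  apply is_derive_eq with (/ (1 + (sin t / cs t) ^ 2) *
    ((cos t * cs t - sin t * (- cos t * sin t / cs t)) / cs t ^ 2)).
  - apply (is_derive_R_comp atan (fun t => sin t / cs t)).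
    + apply is_derive_eq with (/ (1 + (sin t / cs t)²)).
      * apply is_derive_atan.
      * unfold Rsqr. f_equal. ring.
    + apply (is_derive_div sin cs); [apply is_derive_sin | apply is_derive_cs | lra].
  - assert (N : cs t * cs t + sin t * sin t = 2) by lra.
    assert (F : 1 + (sin t / cs t) ^ 2 = 2 / (cs t * cs t)).
    { rewrite <- N. field. lra. }
    rewrite F.
    transitivity (cos t * (cs t * cs t + sin t * sin t) / (2 * cs t)); [field; lra |].
    rewrite N. field. lra.
Qed.

Section Asymptotics.

Variables (k a R0 c A B beta : R) (p q : nat -> nat -> R).
Hypothesis k_pos : 0 < k.
Hypothesis R0_small : 4 * Om k a * R0 ^ 2 <= 1.

(** The prescribed divergence rewritten with v + v^2/2 = rho^2 om. Here A and B measure the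
    deviation from the two equalities imposed on delta_0, the c-term is 2 c W, and the last term is
    beta u (1 + v). *)
Definition div_coord (t rho : R) :=
  A + B * rho ^ 2 * cos t ^ 2 + 2 * c * k * rho ^ 2 * sn t + beta * rho * cos t * zz k a t rho.

Hypothesis divergence : forall t rho, - R0 < rho < R0 ->
  poly2_du p (Ucrd t rho) (Vcrd k a t rho) + poly2_dv q (Ucrd t rho) (Vcrd k a t rho)
  = div_coord t rho.

Definition melnikov (rho : R) := RInt (fun t => flux k a p q t rho) 0 (2 * PI).
Definition melnikov' (rho : R) := RInt (fun t => div_coord t rho * jac k a t rho) 0 (2 * PI).

Lemma zz_continuous t rho : - R0 < rho < R0 -> continuous (fun t => zz k a t rho) t.
Proof.
  intros H. destruct (C11_bl _ _ _ (C11_zz k a R0 R0_small)) as [K [_ _ Hc]]. auto.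
Qed.

Lemma div_jac_continuous t rho : - R0 < rho < R0 ->
  continuous (fun t => div_coord t rho * jac k a t rho) t.
Proof.
  intros H. apply (continuous_mult (fun t => div_coord t rho) (fun t => jac k a t rho)).
  - unfold div_coord.
    apply (continuous_plus (fun t => A + B * rho ^ 2 * cos t ^ 2 + 2 * c * k * rho ^ 2 * sn t)
      (fun t => beta * rho * cos t * zz k a t rho)).
    + apply (continuous_plus (fun t => A + B * rho ^ 2 * cos t ^ 2) (fun t => 2 * c * k * rho ^ 2 * sn t)).
      * apply (continuous_plus (fun t => A) (fun t => B * rho ^ 2 * cos t ^ 2)); [apply continuous_const |].
        apply (continuous_mult (fun t => B * rho ^ 2) (fun t => cos t ^ 2)); [apply continuous_const |].
        apply pow_continuous, cos_continuous.
      * apply (continuous_mult (fun t => 2 * c * k * rho ^ 2) sn); [apply continuous_const |].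
        apply sn_continuous.
    + apply (continuous_mult (fun t => beta * rho * cos t) (fun t => zz k a t rho)); [| now apply zz_continuous].
      apply (continuous_mult (fun t => beta * rho) cos); [apply continuous_const | apply cos_continuous].
  - destruct (C11_bl _ _ _ (C11_jac k a R0 R0_small)) as [K [_ _ Hc]]. auto.
Qed.

Lemma melnikov_derive rho : - R0 < rho < R0 -> is_derive melnikov rho (melnikov' rho).
Proof.
  intros H. apply (flux_integral_derive k a R0 R0_small p q rho (fun t => div_coord t rho * jac k a t rho));
    auto.
  - intros t. now apply div_jac_continuous.
  - intros t. now rewrite divergence.
Qed.

Lemma melnikov_0 : melnikov 0 = 0.
Proof.
  unfold melnikov. rewrite (RInt_ext _ (fun _ => 0)).
  - rewrite RInt_const. unfold scal; simpl; unfold mult; simpl. ring.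
  - intros x _. apply flux_center.
Qed.

(** A first-order expansion of 1/z is enough for the terms in A and B, which will be small
    themselves. The c-term needs second order, because its leading term, proportional to sn/cs =
    -sin, has mean zero. *)
Definition melnikov_error (rho : R) :=
  (Rabs A + Rabs B * rho ^ 2) * (3 * (Om k a * rho ^ 2))
  + 2 * Rabs c * k * rho ^ 2 * (12 * (Om k a * rho ^ 2) ^ 2).

(* [1 / z = 1 - w + O(w ^ 2)] with [w = rho ^ 2 om] and [z ^ 2 = 1 + 2 w]. *)
Lemma inv_zz_expansion t rho : - R0 < rho < R0 ->
  Rabs (/ zz k a t rho - 1) <= 3 * (Om k a * rho ^ 2) /\
  Rabs (/ zz k a t rho - 1 + rho ^ 2 * om k a t) <= 12 * (Om k a * rho ^ 2) ^ 2.
Proof.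
  intros H. assert (Z := zz_bounds k a R0 R0_small t rho H).
  assert (Q := zz_sq k a R0 R0_small t rho H).
  destruct (om_small k a R0 R0_small t rho H) as [W _].
  set (w := rho ^ 2 * om k a t) in *. set (z := zz k a t rho) in *.
  set (W0 := Om k a * rho ^ 2) in *.
  replace (1 + 2 * rho ^ 2 * om k a t) with (1 + 2 * w) in Q by (unfold w; ring).
  assert (W0p := Rabs_pos w).
  assert (D : 3 / 4 <= z * (1 + z)) by nra.
  assert (Di : 0 < / (z * (1 + z)) <= 4 / 3).
  { split; [apply Rinv_0_lt_compat; lra |].
    replace (4 / 3) with (/ (3 / 4)) by field. apply Rinv_le_contravar; lra. }
  assert (E : / z - 1 = - (2 * w) * / (z * (1 + z))).
  { replace (2 * w) with (z * z - 1) by lra. field. lra. }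
  split.
  - rewrite E, Rabs_mult, Rabs_Ropp, Rabs_mult, (Rabs_pos_eq 2), (Rabs_pos_eq (/ _)) by lra. nra.
  - assert (E2 : / z - 1 + w = (2 * w * w * / (1 + z)) * ((z + 2) * / (z * (1 + z)))).
    { replace (2 * w * w) with (w * (z * z - 1)) by (rewrite Q; ring).
      rewrite E. field_simplify_eq; [| lra]. rewrite <- (Rplus_0_r w) at 1.
      replace w with ((z * z - 1) / 2) by lra. field. }
    rewrite E2, Rabs_mult.
    assert (Ji : 0 < / (1 + z) <= 2 / 3).
    { split; [apply Rinv_0_lt_compat; lra |].
      replace (2 / 3) with (/ (3 / 2)) by field. apply Rinv_le_contravar; lra. }
    rewrite (Rabs_pos_eq ((z + 2) * _)) by nra.
    assert (U1 : (z + 2) * / (z * (1 + z)) <= 16 / 3) by nra.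
    assert (U2 : Rabs (2 * w * w * / (1 + z)) <= 4 / 3 * W0 ^ 2).
    { replace (2 * w * w) with (2 * (w * w)) by ring.
      rewrite 2!Rabs_mult, (Rabs_pos_eq 2), (Rabs_pos_eq (/ (1 + z))), Rabs_mult by lra.
      assert (Rabs w * Rabs w <= W0 ^ 2) by nra.
      assert (0 <= Rabs w * Rabs w) by nra. nra. }
    assert (P0 := Rabs_pos (2 * w * w * / (1 + z))).
    assert (0 <= (z + 2) * / (z * (1 + z))) by nra.
    assert (0 <= W0 ^ 2) by (apply pow2_ge_0).
    apply Rle_trans with (4 / 3 * W0 ^ 2 * (16 / 3)); [| lra].
    apply Rmult_le_compat; auto.
Qed.

Lemma melnikov'_estimate rho : - R0 < rho < R0 ->
  Rabs (melnikov' rho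
    - 2 * k * rho ^ 2 * (A * J0 + B * rho ^ 2 * J2 - 2 * c * k ^ 2 * rho ^ 4 * JS))
  <= 2 * k * rho ^ 2 * melnikov_error rho * (2 * PI).
Proof.
  intros H. assert (PP := PI_RGT_0).
  (* [per] collects the periodic primitives of the mean-zero terms: sn/cs = -sin at first order, the
     cross term with [a] proportional to sin cos^2 at second order, and the beta-term. The latter
     leaves no error, since its factor [zz] cancels the one in [jac]. *)
  set (per := fun t => 2 * c * k * rho ^ 2 * cos t + 4 * a * c * k * rho ^ 4 / 3 * cos t ^ 3
    + beta * rho * atan (sin t / cs t)).
  set (per' := fun t => 2 * c * k * rho ^ 2 * - sin t
    + 4 * a * c * k * rho ^ 4 / 3 * (INR 3 * - sin t * cos t ^ pred 3)
    + beta * rho * (cos t / cs t)).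
  assert (Dper : forall t, is_derive per t (per' t)).
  { intros t. unfold per, per'.
    apply (is_derive_R_plus (fun t => 2 * c * k * rho ^ 2 * cos t + 4 * a * c * k * rho ^ 4 / 3 * cos t ^ 3)).
    - apply (is_derive_R_plus (fun t => 2 * c * k * rho ^ 2 * cos t)).
      + apply (is_derive_R_scal cos), is_derive_cos.
      + apply (is_derive_R_scal (fun t => cos t ^ 3)), (is_derive_pow cos), is_derive_cos.
    - apply (is_derive_R_scal (fun t => atan (sin t / cs t))), is_derive_atan_ratio. }
  set (G := fun t => 2 * k * rho ^ 2 * (A * RInt (fun t => / cs t) 0 t
    + B * rho ^ 2 * RInt (fun t => cos t ^ 2 / cs t) 0 t
    - 2 * c * k ^ 2 * rho ^ 4 * RInt (fun t => sn t ^ 2 / cs t) 0 t + per t)).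
  set (G' := fun t => 2 * k * rho ^ 2 * (A * / cs t + B * rho ^ 2 * (cos t ^ 2 / cs t)
    - 2 * c * k ^ 2 * rho ^ 4 * (sn t ^ 2 / cs t) + per' t)).
  assert (DG : forall t, is_derive G t (G' t)).
  { intros t. unfold G, G'.
    apply (is_derive_R_scal (fun t => A * RInt (fun t => / cs t) 0 t
      + B * rho ^ 2 * RInt (fun t => cos t ^ 2 / cs t) 0 t
      - 2 * c * k ^ 2 * rho ^ 4 * RInt (fun t => sn t ^ 2 / cs t) 0 t + per t)).
    apply (is_derive_R_plus (fun t => A * RInt (fun t => / cs t) 0 t
      + B * rho ^ 2 * RInt (fun t => cos t ^ 2 / cs t) 0 t
      - 2 * c * k ^ 2 * rho ^ 4 * RInt (fun t => sn t ^ 2 / cs t) 0 t)); auto.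
    apply (is_derive_R_minus (fun t => A * RInt (fun t => / cs t) 0 t
      + B * rho ^ 2 * RInt (fun t => cos t ^ 2 / cs t) 0 t)).
    - apply (is_derive_R_plus (fun t => A * RInt (fun t => / cs t) 0 t)).
      + apply (is_derive_R_scal (fun t => RInt (fun t => / cs t) 0 t)).
        apply (is_derive_Rint_upper (fun t => / cs t)), inv_cs_continuous.
      + apply (is_derive_R_scal (fun t => RInt (fun t => cos t ^ 2 / cs t) 0 t)).
        apply (is_derive_Rint_upper (fun t => cos t ^ 2 / cs t)), J2_continuous.
    - apply (is_derive_R_scal (fun t => RInt (fun t => sn t ^ 2 / cs t) 0 t)).
      apply (is_derive_Rint_upper (fun t => sn t ^ 2 / cs t)), JS_continuous. }
  assert (Eper : per (2 * PI) = per 0).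
  { unfold per, cs. rewrite sin_2PI, cos_2PI, sin_0, cos_0. reflexivity. }
  assert (EG : G (2 * PI) - G 0 =
    2 * k * rho ^ 2 * (A * J0 + B * rho ^ 2 * J2 - 2 * c * k ^ 2 * rho ^ 4 * JS)).
  { unfold G. rewrite !RInt_point, Eper. unfold J0, J2, JS, zero; simpl. ring. }
  rewrite <- EG.
  apply (RInt_near_primitive _ G G'); auto; [lra | intros; now apply div_jac_continuous |].
  intros t. assert (Z := zz_bounds k a R0 R0_small t rho H). assert (Q := cs_bounds t).
  destruct (inv_zz_expansion t rho H) as [X1 X2].
  assert (E : div_coord t rho * jac k a t rho - G' t = 2 * k * rho ^ 2 *
    ((A + B * rho ^ 2 * cos t ^ 2) * / cs t * (/ zz k a t rho - 1)
     - 2 * c * k * rho ^ 2 * sin t * (/ zz k a t rho - 1 + rho ^ 2 * om k a t))).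
  { unfold div_coord, jac, G', per', om, sn. simpl. field. lra. }
  rewrite E. set (e1 := / zz k a t rho - 1) in *. set (e2 := e1 + rho ^ 2 * om k a t) in *.
  assert (Pr := pow2_ge_0 rho).
  rewrite Rabs_mult, (Rabs_pos_eq (2 * k * rho ^ 2)) by nra.
  apply Rmult_le_compat_l; [nra |]. unfold melnikov_error.
  eapply Rle_trans; [apply Rabs_triang |]. rewrite Rabs_Ropp.
  assert (Ic : 0 < / cs t <= 1).
  { split; [apply Rinv_0_lt_compat; lra |]. rewrite <- Rinv_1. apply Rinv_le_contravar; lra. }
  assert (C2 : 0 <= cos t ^ 2 <= 1).
  { split; [apply pow2_ge_0 |]. assert (C := COS_bound t). nra. }
  assert (S1 : Rabs (sin t) <= 1) by (apply Rabs_le; apply SIN_bound).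
  apply Rplus_le_compat.
  - rewrite Rabs_mult. apply Rmult_le_compat; try apply Rabs_pos; auto.
    rewrite Rabs_mult, (Rabs_pos_eq (/ cs t)) by lra.
    assert (N : Rabs (A + B * rho ^ 2 * cos t ^ 2) <= Rabs A + Rabs B * rho ^ 2).
    { eapply Rle_trans; [apply Rabs_triang |]. apply Rplus_le_compat_l.
      rewrite !Rabs_mult, (Rabs_pos_eq (rho ^ 2)), (Rabs_pos_eq (cos t ^ 2)) by lra.
      assert (PB : 0 <= Rabs B * rho ^ 2) by (apply Rmult_le_pos; auto; apply Rabs_pos). nra. }
    assert (N0 := Rabs_pos (A + B * rho ^ 2 * cos t ^ 2)). nra.
  - rewrite Rabs_mult. apply Rmult_le_compat; try apply Rabs_pos; auto.
    rewrite !Rabs_mult, (Rabs_pos_eq 2), (Rabs_pos_eq k), (Rabs_pos_eq (rho ^ 2)) by lra.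
    assert (PC : 0 <= 2 * Rabs c * k * rho ^ 2).
    { apply Rmult_le_pos; [| auto]. assert (PA := Rabs_pos c). nra. }
    nra.
Qed.

End Asymptotics.

(** * Quantitative simple zeros of the averaged function *)

(** Mirrors the last three fields of [averageable]: a slope bound in place of a derivative, and
    definite signs at distance 3e inside the ends. *)
Definition simple_zero (M : R -> R) (lo hi e sg m : R) : Prop :=
  (forall x y, lo <= x -> x < y -> y <= hi -> sg * (M y - M x) <= - m * (y - x)) /\
  m <= sg * M (lo + 3 * e) /\ sg * M (hi - 3 * e) <= - m.

(** Freezing the radius outside [lo, hi] makes the scalar field bounded and Lipschitz on the whole
    line, as the Picard theorem requires; inside the annulus nothing changes. *)
Definition clamp (lo hi x : R) := Rmax lo (Rmin hi x).

Lemma clamp_in lo hi x : lo <= hi -> lo <= clamp lo hi x <= hi.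
Proof.
  intros H. unfold clamp, Rmax, Rmin. destruct (Rle_dec hi x); match goal with |- context [Rle_dec lo ?z] => destruct (Rle_dec lo z) end; lra.
Qed.

Lemma clamp_id lo hi x : lo <= x <= hi -> clamp lo hi x = x.
Proof.
  intros H. unfold clamp. rewrite Rmin_right, Rmax_right; lra.
Qed.

Lemma clamp_lip lo hi x y : Rabs (clamp lo hi x - clamp lo hi y) <= Rabs (x - y).
Proof.
  unfold clamp, Rmax, Rmin.
  destruct (Rle_dec hi x), (Rle_dec hi y);
    repeat match goal with |- context [Rle_dec lo ?z] => destruct (Rle_dec lo z) end;
    unfold Rabs; repeat destruct Rcase_abs; lra.
Qed.

(** All constants are computed from the single lower bound c/2 on h - eps G, so [K] does not depend
    on eps. The identity F/(h - eps G) - F/h = eps (F/h) G/(h - eps G) shows the factor eps that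
    [close_field] asks for, in value and in Lipschitz constant. *)
Lemma averaging_annulus (T e m lo0 hi0 lo hi sg c : R) (F G : R -> R -> R) (h : R -> R) :
  0 < T -> 0 < m -> 0 < e -> 0 < c -> sg = 1 \/ sg = -1 ->
  lo0 < lo -> hi < hi0 -> lo + 3 * e <= hi - 3 * e ->
  C11 lo0 hi0 F -> C11 lo0 hi0 G -> C11 lo0 hi0 (fun _ x => h x) ->
  (forall x, lo0 < x < hi0 -> c <= h x) ->
  (forall t x, F (t + T) x = F t x) -> (forall t x, G (t + T) x = G t x) ->
  simple_zero (fun x => RInt (fun t => F t x / h x) 0 T) lo hi e sg m ->
  exists eps0, 0 < eps0 /\ forall eps, 0 < eps < eps0 ->
    (forall t x, lo0 < x < hi0 -> c / 2 <= h x - eps * G t x) /\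
    isolated_periodic T e lo hi sg eps
      (fun t x => F t (clamp lo hi x) / (h (clamp lo hi x) - eps * G t (clamp lo hi x))).
Proof.
  intros HT Hm He Hc Hsg Hlo Hhi Hlh CF CG Ch Hh PF PG [Z1 [Z2 Z3]].
  destruct (C11_bl _ _ _ CF) as [KF BF]. destruct (C11_bl _ _ _ CG) as [KG BG].
  destruct (C11_bl _ _ _ Ch) as [Kh Bh].
  assert (Ci : C11 lo0 hi0 (fun _ x => / h x)) by (apply (C11_inv _ _ (fun _ x => h x) c); auto).
  assert (Cf : C11 lo0 hi0 (fun t x => F t x * / h x)) by (apply (C11_mult _ _ F (fun _ x => / h x)); auto).
  destruct (C11_bl _ _ _ Ci) as [Ki Bi]. destruct (C11_bl _ _ _ Cf) as [Kf Bf].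
  destruct (C11_second_difference _ _ _ Cf) as [Ks Bs].
  set (Kd := / (c / 2) + Rabs (Kh + Rabs KG) * (/ (c / 2) * / (c / 2))).
  set (Kg := 2 * Rabs KF * Rabs Kd).
  set (Kfg := 2 * Rabs (2 * Rabs Kf * Rabs KG) * Rabs Kd).
  set (K := Rabs Kf + Rabs Ks + Rabs Kg + Rabs Kfg + 1).
  assert (PK : forall x, x <= Rabs x /\ 0 <= Rabs x) by (intros; split; [apply Rle_abs | apply Rabs_pos]).
  assert (K1 : 0 < K /\ Kf <= K /\ Ks <= K /\ Kg <= K /\ Kfg <= K).
  { unfold K. assert (P1 := PK Kf). assert (P2 := PK Ks). assert (P3 := PK Kg). assert (P4 := PK Kfg).
    lra. }
  destruct K1 as [Kp [K1 [K2 [K3 K4]]]].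
  destruct (averaging T K m e HT Kp Hm He) as [eps0 [P0 Hav]].
  assert (PG' := Rabs_pos KG).
  exists (Rmin eps0 (Rmin 1 (c / (2 * (Rabs KG + 1))))). split.
  { repeat apply Rmin_case; try lra. apply Rdiv_lt_0_compat; lra. }
  intros eps [E0 E1]. apply Rmin_Rgt in E1. destruct E1 as [E1 E2]. apply Rmin_Rgt in E2.
  destruct E2 as [E2 E3].
  assert (E4 : eps * (Rabs KG + 1) <= c / 2).
  { apply Rmult_le_reg_r with (/ (Rabs KG + 1)); [apply Rinv_0_lt_compat; lra |].
    rewrite Rmult_assoc, Rinv_r, Rmult_1_r by lra.
    replace (c / 2 * / (Rabs KG + 1)) with (c / (2 * (Rabs KG + 1))) by (field; lra). lra. }
  assert (den : forall t x, lo0 < x < hi0 -> c / 2 <= h x - eps * G t x).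
  { intros t x Hx. specialize (Hh x Hx). assert (B := bl_bound _ _ _ _ BG t x Hx).
    assert (Q := PK KG). assert (Q' := PK (G t x)).
    assert (eps * G t x <= eps * (Rabs KG + 1)) by (apply Rmult_le_compat_l; lra). lra. }
  split; [exact den |].
  assert (Hlh' : lo <= hi) by lra.
  assert (cin : forall x, lo0 < clamp lo hi x < hi0).
  { intros x. assert (Q := clamp_in lo hi x Hlh'). lra. }
  assert (BeG : bounded_lipschitz lo0 hi0 (Rabs KG) (fun t x => - (eps * G t x))).
  { destruct BG as [B1 B2 B3]. split.
    - intros t x Hx. rewrite Rabs_Ropp, Rabs_mult, (Rabs_pos_eq eps) by lra.
      specialize (B1 t x Hx). assert (Q := PK KG). assert (Q' := PK (G t x)). nra.
    - intros t x y Hx Hy. replace (- (eps * G t x) - - (eps * G t y)) with (eps * - (G t x - G t y)) by ring.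
      rewrite Rabs_mult, (Rabs_pos_eq eps), Rabs_Ropp by lra.
      specialize (B2 t x y Hx Hy). assert (Q := PK KG). assert (Q' := PK (G t x - G t y)).
      assert (Q2 := PK (x - y)). nra.
    - intros t x Hx. apply (continuous_opp (V := R_NormedModule) (fun s => eps * G s x)).
      apply (continuous_scal_r eps (fun s => G s x)). auto. }
  assert (Bd : bounded_lipschitz lo0 hi0 Kd (fun t x => / (h x - eps * G t x))).
  { apply (bl_inv lo0 hi0 (Kh + Rabs KG) (c / 2) (fun t x => h x - eps * G t x)); [lra | exact den |].
    apply (bl_plus _ _ _ _ (fun _ x => h x) (fun t x => - (eps * G t x))); auto. }
  assert (Bg : bounded_lipschitz lo0 hi0 K (fun t x => F t x * / (h x - eps * G t x))).
  { apply bl_weaken with Kg; auto. now apply bl_mult. }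
  assert (Bfg : bounded_lipschitz lo0 hi0 K (fun t x => F t x * / h x * G t x * / (h x - eps * G t x))).
  { apply bl_weaken with Kfg; auto.
    apply (bl_mult _ _ _ _ (fun t x => F t x * / h x * G t x)); auto.
    apply (bl_mult _ _ _ _ (fun t x => F t x * / h x)); auto. }
  apply bl_weaken with (K' := K) in Bf; auto.
  assert (Efg : forall t x, lo0 < x < hi0 ->
    F t x * / (h x - eps * G t x) - F t x * / h x = eps * (F t x * / h x * G t x * / (h x - eps * G t x))).
  { intros t x Hx. specialize (den t x Hx). specialize (Hh x Hx). field. lra. }
  assert (cl := clamp_lip lo hi).
  assert (lipcl : forall H, bounded_lipschitz lo0 hi0 K H -> forall t x y,
    Rabs (H t (clamp lo hi x) - H t (clamp lo hi y)) <= K * Rabs (x - y)).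
  { intros H BH t x y. eapply Rle_trans; [apply (bl_lip _ _ _ _ BH); auto |].
    apply Rmult_le_compat_l; [lra | apply cl]. }
  unfold Rdiv.
  apply (Hav eps lo hi sg (fun t x => F t (clamp lo hi x) * / h (clamp lo hi x))); auto.
  - split.
    + intros x t. exact (bl_cont _ _ _ _ Bf t _ (cin x)).
    + intros t x. now rewrite PF.
    + exact (lipcl _ Bf).
    + intros t x y d Hx Hy Hxd Hyd. rewrite !clamp_id by lra.
      eapply Rle_trans; [apply Bs; lra |].
      apply Rmult_le_compat_r; [apply Rabs_pos |]. apply Rmult_le_compat_r; [apply Rabs_pos | auto].
    + intros x y Hx Hxy Hy. rewrite !clamp_id by lra. now apply Z1.
    + rewrite !clamp_id by lra. apply Z2.
    + rewrite !clamp_id by lra. apply Z3.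
  - split.
    + intros x t. exact (bl_cont _ _ _ _ Bg t _ (cin x)).
    + intros t x. now rewrite PF, PG.
    + intros t x. exact (bl_bound _ _ _ _ Bg t _ (cin x)).
    + exact (lipcl _ Bg).
    + intros t x. rewrite Efg by auto. rewrite Rabs_mult, (Rabs_pos_eq eps) by lra.
      apply Rmult_le_compat_l; [lra |]. exact (bl_bound _ _ _ _ Bfg t _ (cin x)).
    + intros t x y. rewrite !Efg by auto. rewrite <- Rmult_minus_distr_l, Rabs_mult, (Rabs_pos_eq eps), (Rmult_assoc eps) by lra.
      apply Rmult_le_compat_l; [lra |]. exact (lipcl _ Bfg t x y).
Qed.

(** A, B and N are found by matching 2k rho^2 (A J0 + B rho^2 J2 - 2 c k^2 rho^4 JS) with -2kN times
    the derivative of rho^7 - 3 mu^2 rho^5 + 2 mu^4 rho^3. The error constant is chosen before mu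
    and beta, so that mu can be shrunk afterwards. *)
Lemma melnikov_asymptotics (k a c R0 : R) :
  0 < k -> 0 < R0 -> 4 * Om k a * R0 ^ 2 <= 1 ->
  let N := 2 * c * k ^ 2 * JS / 7 in
  exists K1, 0 < K1 /\ forall mu beta p q, 0 < mu -> 2 * mu < R0 ->
    let A := - (6 * N * mu ^ 4 / J0) in
    let B := 15 * N * mu ^ 2 / J2 in
    (forall t rho, - R0 < rho < R0 ->
      poly2_du p (Ucrd t rho) (Vcrd k a t rho) + poly2_dv q (Ucrd t rho) (Vcrd k a t rho)
      = div_coord k a c A B beta t rho) ->
    forall rho, 0 <= rho <= 2 * mu ->
      is_derive (melnikov k a p q) rho (melnikov' k a c A B beta rho) /\
      Rabs (melnikov' k a c A B beta rho
        + 2 * k * N * (7 * rho ^ 6 - 15 * mu ^ 2 * rho ^ 4 + 6 * mu ^ 4 * rho ^ 2)) <= K1 * mu ^ 8 /\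
      Rabs (melnikov k a p q rho
        + 2 * k * N * (rho ^ 7 - 3 * mu ^ 2 * rho ^ 5 + 2 * mu ^ 4 * rho ^ 3)) <= 2 * K1 * mu ^ 9.
Proof.
  intros Hk HR0 HR N. assert (PP := PI_RGT_0).
  assert (P0 := J0_pos). assert (P2 := J2_pos).
  (* The value of [melnikov_error] divided by mu^6, using rho^2 <= 4 mu^2: 60 = 15 * 4, 12 = 3 * 4,
     8 = 2 * 4 and 192 = 12 * 4^2. *)
  set (E0 := (6 * Rabs N / J0 + 60 * Rabs N / J2) * (12 * Om k a)
    + 8 * Rabs c * k * (192 * Om k a ^ 2)).
  assert (PO := Om_nonneg k a). assert (PN := Rabs_pos N). assert (Pc := Rabs_pos c).
  assert (Q0 : 0 <= Rabs N / J0) by (apply Rcomplements.Rdiv_le_0_compat; lra).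
  assert (Q2 : 0 <= Rabs N / J2) by (apply Rcomplements.Rdiv_le_0_compat; lra).
  assert (PE : 0 <= E0).
  { unfold E0. assert (0 <= Om k a ^ 2) by apply pow2_ge_0.
    assert (0 <= (6 * (Rabs N / J0) + 60 * (Rabs N / J2)) * (12 * Om k a)) by nra.
    assert (0 <= Rabs c * k) by nra. assert (0 <= (Rabs c * k) * Om k a ^ 2) by nra.
    unfold Rdiv in *. lra. }
  exists (2 * k * 4 * E0 * (2 * PI) + 1).
  assert (PK0 : 0 <= 2 * k * 4 * E0) by (apply Rmult_le_pos; lra).
  assert (PK : 0 <= 2 * k * 4 * E0 * (2 * PI)) by (apply Rmult_le_pos; lra).
  split; [lra |].
  intros mu beta p q Hmu Hmu2 A B Hdiv.
  set (K1 := 2 * k * 4 * E0 * (2 * PI) + 1).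
  assert (der : forall rho, 0 <= rho <= 2 * mu ->
    is_derive (melnikov k a p q) rho (melnikov' k a c A B beta rho)).
  { intros rho Hrho. apply (melnikov_derive k a R0 c A B beta p q); auto. lra. }
  assert (est : forall rho, 0 <= rho <= 2 * mu ->
    Rabs (melnikov' k a c A B beta rho
      + 2 * k * N * (7 * rho ^ 6 - 15 * mu ^ 2 * rho ^ 4 + 6 * mu ^ 4 * rho ^ 2)) <= K1 * mu ^ 8).
  { intros rho Hrho.
    assert (H := melnikov'_estimate k a R0 c A B beta Hk HR rho ltac:(lra)).
    replace (2 * k * rho ^ 2 * (A * J0 + B * rho ^ 2 * J2 - 2 * c * k ^ 2 * rho ^ 4 * JS)) with
      (- (2 * k * N * (7 * rho ^ 6 - 15 * mu ^ 2 * rho ^ 4 + 6 * mu ^ 4 * rho ^ 2))) in H.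
    2:{ unfold A, B, N. field. lra. }
    unfold Rminus in H. rewrite Ropp_involutive in H.
    eapply Rle_trans; [apply H |].
    assert (r2 : 0 <= rho ^ 2 <= 4 * mu ^ 2) by nra.
    assert (m2 : 0 <= mu ^ 2) by nra.
    assert (EB : melnikov_error k a c A B rho <= E0 * mu ^ 6).
    { unfold melnikov_error.
      assert (AA : Rabs A = 6 * (Rabs N / J0) * mu ^ 4).
      { unfold A. rewrite Rabs_Ropp. unfold Rdiv. rewrite !Rabs_mult.
        rewrite (Rabs_pos_eq 6), (Rabs_pos_eq (mu ^ 4)), (Rabs_pos_eq (/ J0)).
        - ring.
        - left; now apply Rinv_0_lt_compat.
        - apply pow_le; lra.
        - lra. }
      assert (BB : Rabs B = 15 * (Rabs N / J2) * mu ^ 2).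
      { unfold B. unfold Rdiv. rewrite !Rabs_mult.
        rewrite (Rabs_pos_eq 15), (Rabs_pos_eq (mu ^ 2)), (Rabs_pos_eq (/ J2)).
        - ring.
        - left; now apply Rinv_0_lt_compat.
        - auto.
        - lra. }
      assert (W : 0 <= Om k a * rho ^ 2 <= 4 * Om k a * mu ^ 2) by nra.
      assert (W2 : (Om k a * rho ^ 2) ^ 2 <= (4 * Om k a * mu ^ 2) ^ 2) by (apply pow_incr; auto).
      assert (W3 := pow2_ge_0 (Om k a * rho ^ 2)).
      rewrite AA, BB.
      assert (U1 : 6 * (Rabs N / J0) * mu ^ 4 + 15 * (Rabs N / J2) * mu ^ 2 * rho ^ 2 <=
        (6 * (Rabs N / J0) + 60 * (Rabs N / J2)) * mu ^ 4).
      { assert (0 <= Rabs N / J2 * mu ^ 2) by nra.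
        assert (Rabs N / J2 * mu ^ 2 * rho ^ 2 <= Rabs N / J2 * mu ^ 2 * (4 * mu ^ 2))
          by (apply Rmult_le_compat_l; lra). nra. }
      assert (U0 : 0 <= 6 * (Rabs N / J0) * mu ^ 4 + 15 * (Rabs N / J2) * mu ^ 2 * rho ^ 2).
      { assert (0 <= Rabs N / J2 * mu ^ 2) by nra. assert (0 <= mu ^ 4) by (apply pow_le; lra). nra. }
      assert (V1 : (6 * (Rabs N / J0) * mu ^ 4 + 15 * (Rabs N / J2) * mu ^ 2 * rho ^ 2) * (3 * (Om k a * rho ^ 2))
        <= (6 * (Rabs N / J0) + 60 * (Rabs N / J2)) * mu ^ 4 * (3 * (4 * Om k a * mu ^ 2))).
      { apply Rmult_le_compat; lra. }
      assert (V2 : 2 * Rabs c * k * rho ^ 2 * (12 * (Om k a * rho ^ 2) ^ 2)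
        <= 2 * Rabs c * k * (4 * mu ^ 2) * (12 * (4 * Om k a * mu ^ 2) ^ 2)).
      { assert (0 <= 2 * Rabs c * k) by nra.
        apply Rmult_le_compat; try lra; [nra |]. apply Rmult_le_compat_l; lra. }
      eapply Rle_trans; [apply Rplus_le_compat; [apply V1 | apply V2] |].
      right. unfold E0, Rdiv. ring. }
    assert (EBp : 0 <= melnikov_error k a c A B rho).
    { unfold melnikov_error. assert (X1 := Rabs_pos A). assert (X2 := Rabs_pos B).
      assert (X3 := pow2_ge_0 (Om k a * rho ^ 2)).
      assert (0 <= Rabs B * rho ^ 2) by nra. assert (0 <= Om k a * rho ^ 2) by nra.
      assert (0 <= Rabs c * k) by nra. assert (0 <= Rabs c * k * rho ^ 2) by nra.
      assert (0 <= Rabs c * k * rho ^ 2 * (Om k a * rho ^ 2) ^ 2) by (apply Rmult_le_pos; auto).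
      assert (0 <= (Rabs A + Rabs B * rho ^ 2) * (Om k a * rho ^ 2)) by (apply Rmult_le_pos; lra). lra. }
    assert (V : 2 * k * rho ^ 2 * melnikov_error k a c A B rho <= 2 * k * (4 * mu ^ 2) * (E0 * mu ^ 6)).
    { apply Rmult_le_compat; auto; nra. }
    assert (m8 : 0 <= mu ^ 8) by (apply pow_le; lra).
    apply Rle_trans with (2 * k * (4 * mu ^ 2) * (E0 * mu ^ 6) * (2 * PI)).
    - apply Rmult_le_compat_r; lra.
    - unfold K1. replace (2 * k * (4 * mu ^ 2) * (E0 * mu ^ 6) * (2 * PI)) with
        (2 * k * 4 * E0 * (2 * PI) * mu ^ 8) by ring. nra. }
  intros rho Hrho. split; [now apply der |]. split; [now apply est |].
  (* The bound on the values follows by integrating the bound on the derivative from 0, where both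
     sides vanish; the length rho <= 2 mu accounts for the factor 2. *)
  set (D := fun r => melnikov k a p q r + 2 * k * N * (r ^ 7 - 3 * mu ^ 2 * r ^ 5 + 2 * mu ^ 4 * r ^ 3)).
  assert (D0 : D 0 = 0) by (unfold D; rewrite melnikov_0; ring).
  assert (L : Rabs (D rho - D 0) <= K1 * mu ^ 8 * Rabs (rho - 0)).
  { apply (derive_bound_lipschitz D (fun r => melnikov' k a c A B beta r
      + 2 * k * N * (7 * r ^ 6 - 15 * mu ^ 2 * r ^ 4 + 6 * mu ^ 4 * r ^ 2))).
    - intros t Ht. rewrite Rmin_left, Rmax_right in Ht by lra. unfold D.
      apply (is_derive_R_plus (melnikov k a p q)); [apply der; lra |].
      auto_derive; auto. ring.
    - intros t Ht. rewrite Rmin_left, Rmax_right in Ht by lra. apply est. lra. }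
  rewrite D0, !Rminus_0_r, (Rabs_pos_eq rho) in L by lra. fold (D rho).
  eapply Rle_trans; [apply L |].
  assert (m8 : 0 <= mu ^ 8) by (apply pow_le; lra).
  assert (K1 * mu ^ 8 * rho <= K1 * mu ^ 8 * (2 * mu)).
  { apply Rmult_le_compat_l; [| lra]. apply Rmult_le_pos; auto. unfold K1. lra. }
  eapply Rle_trans; [apply H |]. right; ring.
Qed.

Lemma simple_zero_ext (M M' : R -> R) lo hi e sg m :
  0 < e -> lo + 3 * e <= hi - 3 * e -> (forall x, lo <= x <= hi -> M x = M' x) ->
  simple_zero M lo hi e sg m -> simple_zero M' lo hi e sg m.
Proof.
  intros He Hlh E [Z1 [Z2 Z3]]. split; [| split].
  - intros x y Hx Hxy Hy. rewrite <- !E by lra. auto.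
  - rewrite <- E by lra. auto.
  - rewrite <- E by lra. auto.
Qed.

(** Put rho = r mu. The numerator becomes a multiple of r^3 (r^2 - 1)(r^2 - 2), and the derivative
    of I/x^3 is (x I' - 3 I)/x^4, whose leading polynomial is 4 r^7 - 6 r^5. Since the remainder is
    smaller by a factor of order mu^2, a smallness condition on mu transfers the strict inequalities
    on r to I. *)
Lemma simple_zero_scaled (I I' : R -> R) (k n N K1 mu al be th sg s : R) :
  0 < k -> 0 < n -> 0 < K1 -> 0 < mu -> 32 * K1 * mu ^ 2 <= k * n ->
  sg = 1 \/ sg = -1 -> - (sg * N) = s * n ->
  / 2 <= al -> be <= 2 -> 0 < th -> al + 3 * th <= be - 3 * th ->
  (forall r, al <= r <= be -> s * (4 * r ^ 7 - 6 * r ^ 5) <= - / 2) ->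
  / 20 <= s * ((al + 3 * th) ^ 7 - 3 * (al + 3 * th) ^ 5 + 2 * (al + 3 * th) ^ 3) ->
  s * ((be - 3 * th) ^ 7 - 3 * (be - 3 * th) ^ 5 + 2 * (be - 3 * th) ^ 3) <= - / 20 ->
  (forall rho, 0 <= rho <= 2 * mu ->
      is_derive I rho (I' rho) /\
      Rabs (I' rho + 2 * k * N * (7 * rho ^ 6 - 15 * mu ^ 2 * rho ^ 4 + 6 * mu ^ 4 * rho ^ 2)) <= K1 * mu ^ 8 /\
      Rabs (I rho + 2 * k * N * (rho ^ 7 - 3 * mu ^ 2 * rho ^ 5 + 2 * mu ^ 4 * rho ^ 3)) <= 2 * K1 * mu ^ 9) ->
  simple_zero (fun x => I x / (2 * k ^ 2 * x ^ 3)) (al * mu) (be * mu) (th * mu) sg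
    (Rmin (n * mu ^ 3 / (64 * k)) (n * mu ^ 4 / (1000 * k))).
Proof.
  intros Hk Hn HK Hmu Hsmall Hsg HN Hal Hbe Hth Hlh Hpoly Hlo Hhi HI.
  (* With Q = k n mu^7, the first entry is Q/2 over the largest slope denominator 32 k^2 mu^4. The
     second is a safe bound for the end values, which are at least 2Q/20 - Q/16 over 16 k^2 mu^3. *)
  set (m := Rmin _ _).
  assert (m1 : m <= n * mu ^ 3 / (64 * k)) by apply Rmin_l.
  assert (m2 : m <= n * mu ^ 4 / (1000 * k)) by apply Rmin_r.
  assert (mp : 0 <= m).
  { assert (P3 : 0 < mu ^ 3) by (apply pow_lt; auto). assert (P4 : 0 < mu ^ 4) by (apply pow_lt; auto).
    unfold m. apply Rmin_glb; apply Rcomplements.Rdiv_le_0_compat; nra. }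
  assert (m1' : m * (32 * k ^ 2 * mu ^ 4) <= k * n * mu ^ 7 / 2).
  { assert (P : 0 <= 32 * k ^ 2 * mu ^ 4).
    { assert (0 < k ^ 2) by (apply pow_lt; auto). assert (0 < mu ^ 4) by (apply pow_lt; auto). nra. }
    apply Rle_trans with (n * mu ^ 3 / (64 * k) * (32 * k ^ 2 * mu ^ 4)).
    - apply Rmult_le_compat_r; auto.
    - right. field. lra. }
  assert (m2' : m * (16 * k ^ 2 * mu ^ 3) <= k * n * mu ^ 7 * (/ 50)).
  { assert (P : 0 < 16 * k ^ 2 * mu ^ 3).
    { assert (0 < k ^ 2) by (apply pow_lt; auto). assert (0 < mu ^ 3) by (apply pow_lt; auto). nra. }
    assert (P7 : 0 < k * n * mu ^ 7).
    { assert (0 < mu ^ 7) by (apply pow_lt; auto). assert (0 < k * n) by nra. nra. }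
    apply Rle_trans with (n * mu ^ 4 / (1000 * k) * (16 * k ^ 2 * mu ^ 3)).
    - apply Rmult_le_compat_r; lra.
    - replace (n * mu ^ 4 / (1000 * k) * (16 * k ^ 2 * mu ^ 3)) with (k * n * mu ^ 7 * (16 / 1000))
        by (field; lra). lra. }
  clearbody m.
  assert (cancel : forall X D, 0 < D -> X * / D * D = X) by (intros; field; lra).
  assert (P7 : 0 < mu ^ 7) by (apply pow_lt; auto).
  assert (S9 : K1 * mu ^ 9 <= k * n * mu ^ 7 / 32).
  { replace (K1 * mu ^ 9) with (K1 * mu ^ 2 * mu ^ 7) by ring. nra. }
  set (Q := k * n * mu ^ 7) in *.
  assert (Qp : 0 < Q) by (unfold Q; assert (0 < k * n) by nra; nra).
  assert (val : forall r, al <= r <= be ->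
    Rabs (sg * I (r * mu) - 2 * Q * (s * (r ^ 7 - 3 * r ^ 5 + 2 * r ^ 3))) <= Q / 16).
  { intros r Hr. destruct (HI (r * mu)) as [_ [_ V]]; [nra |].
    replace (sg * I (r * mu) - 2 * Q * (s * (r ^ 7 - 3 * r ^ 5 + 2 * r ^ 3))) with
      (sg * (I (r * mu) + 2 * k * N * ((r * mu) ^ 7 - 3 * mu ^ 2 * (r * mu) ^ 5 + 2 * mu ^ 4 * (r * mu) ^ 3))).
    - rewrite Rabs_mult. replace (Rabs sg) with 1 by (destruct Hsg as [-> | ->]; unfold Rabs; destruct Rcase_abs; lra).
      lra.
    - unfold Q. replace (2 * (k * n * mu ^ 7) * (s * (r ^ 7 - 3 * r ^ 5 + 2 * r ^ 3))) with
        (2 * k * (s * n) * mu ^ 7 * (r ^ 7 - 3 * r ^ 5 + 2 * r ^ 3)) by ring.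
      rewrite <- HN. ring. }
  assert (den : forall x, al * mu <= x <= be * mu ->
    0 < 2 * k ^ 2 * x ^ 3 <= 16 * k ^ 2 * mu ^ 3 /\ 0 < 2 * k ^ 2 * x ^ 4 <= 32 * k ^ 2 * mu ^ 4).
  { intros x Hx. assert (xb : 0 < x <= 2 * mu) by nra.
    assert (X3 : 0 < x ^ 3 <= (2 * mu) ^ 3) by (split; [apply pow_lt | apply pow_incr]; lra).
    assert (X4 : 0 < x ^ 4 <= (2 * mu) ^ 4) by (split; [apply pow_lt | apply pow_incr]; lra).
    replace ((2 * mu) ^ 3) with (8 * mu ^ 3) in X3 by ring.
    replace ((2 * mu) ^ 4) with (16 * mu ^ 4) in X4 by ring.
    assert (K2 : 0 < k ^ 2) by (apply pow_lt; auto). split; nra. }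
  split; [| split].
  - intros x y Hx Hxy Hy.
    destruct (segment_mvt (fun x => sg * (I x / (2 * k ^ 2 * x ^ 3)))
      (fun x => sg * ((x * I' x - 3 * I x) / (2 * k ^ 2 * x ^ 4))) x y) as [z [Hz E]].
    + intros t Ht. rewrite Rmin_left, Rmax_right in Ht by lra.
      assert (It : al * mu <= t <= be * mu) by lra. assert (t0 : 0 < t <= 2 * mu) by nra.
      destruct (den t It) as [D1 _]. destruct (HI t) as [Dt _]; [lra |].
      apply (is_derive_R_scal (fun x => I x / (2 * k ^ 2 * x ^ 3))).
      apply is_derive_eq with ((I' t * (2 * k ^ 2 * t ^ 3) - I t * (6 * k ^ 2 * t ^ 2)) / (2 * k ^ 2 * t ^ 3) ^ 2).
      * apply (is_derive_div I (fun x => 2 * k ^ 2 * x ^ 3)); auto; [| lra].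
        auto_derive; auto. ring.
      * field. split; nra.
    + rewrite Rmin_left, Rmax_right in Hz by lra.
      rewrite Rmult_minus_distr_l, E. apply Rmult_le_compat_r; [lra |].
      assert (Iz : al * mu <= z <= be * mu) by lra. assert (z0 : 0 < z <= 2 * mu) by nra.
      destruct (den z Iz) as [_ D4]. destruct (HI z) as [_ [V1 V2]]; [lra |].
      set (r := z / mu). assert (Ez : z = r * mu) by (unfold r; field; lra).
      assert (Ir : al <= r <= be).
      { split; apply Rmult_le_reg_r with mu; auto; lra. }
      assert (B : sg * (z * I' z - 3 * I z) <= - (Q / 2)).
      { set (d1 := I' z + 2 * k * N * (7 * z ^ 6 - 15 * mu ^ 2 * z ^ 4 + 6 * mu ^ 4 * z ^ 2)) in *.
        set (d2 := I z + 2 * k * N * (z ^ 7 - 3 * mu ^ 2 * z ^ 5 + 2 * mu ^ 4 * z ^ 3)) in *.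
        assert (EI : sg * (z * I' z - 3 * I z) = sg * (z * d1 - 3 * d2)
          + 2 * Q * (s * (4 * r ^ 7 - 6 * r ^ 5))).
        { unfold Q. replace (2 * (k * n * mu ^ 7) * (s * (4 * r ^ 7 - 6 * r ^ 5))) with
            (2 * k * (s * n) * mu ^ 7 * (4 * r ^ 7 - 6 * r ^ 5)) by ring.
          rewrite <- HN. unfold d1, d2. rewrite Ez. ring. }
        rewrite EI. specialize (Hpoly r Ir).
        assert (T1 : sg * (z * d1 - 3 * d2) <= 8 * (K1 * mu ^ 9)).
        { apply Rle_trans with (Rabs (sg * (z * d1 - 3 * d2))); [apply Rle_abs |].
          rewrite Rabs_mult. replace (Rabs sg) with 1 by (destruct Hsg as [-> | ->]; unfold Rabs; destruct Rcase_abs; lra).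
          rewrite Rmult_1_l. eapply Rle_trans; [apply Rabs_triang |].
          rewrite Rabs_Ropp, !Rabs_mult, (Rabs_pos_eq z), (Rabs_pos_eq 3) by lra.
          assert (z * Rabs d1 <= 2 * mu * (K1 * mu ^ 8)).
          { apply Rmult_le_compat; try lra. apply Rabs_pos. }
          replace (8 * (K1 * mu ^ 9)) with (2 * mu * (K1 * mu ^ 8) + 3 * (2 * K1 * mu ^ 9)) by ring. lra. }
        nra. }
      replace (sg * ((z * I' z - 3 * I z) / (2 * k ^ 2 * z ^ 4))) with
        ((sg * (z * I' z - 3 * I z)) * / (2 * k ^ 2 * z ^ 4)) by (unfold Rdiv; ring).
      apply Rmult_le_reg_r with (2 * k ^ 2 * z ^ 4); [lra |].
      rewrite cancel by lra. nra.
  - replace (al * mu + 3 * (th * mu)) with ((al + 3 * th) * mu) by ring.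
    set (r := al + 3 * th) in *. assert (V := val r ltac:(unfold r in *; lra)).
    apply Rabs_le_between in V.
    destruct (den (r * mu) ltac:(unfold r in *; split; apply Rmult_le_compat_r; lra)) as [D3 _].
    replace (sg * (I (r * mu) / (2 * k ^ 2 * (r * mu) ^ 3))) with
        (sg * I (r * mu) * / (2 * k ^ 2 * (r * mu) ^ 3)) by (unfold Rdiv; ring).
    apply Rmult_le_reg_r with (2 * k ^ 2 * (r * mu) ^ 3); [lra |].
    rewrite cancel by lra. nra.
  - replace (be * mu - 3 * (th * mu)) with ((be - 3 * th) * mu) by ring.
    set (r := be - 3 * th) in *. assert (V := val r ltac:(unfold r in *; lra)).
    apply Rabs_le_between in V.
    destruct (den (r * mu) ltac:(unfold r in *; split; apply Rmult_le_compat_r; lra)) as [D3 _].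
    replace (sg * (I (r * mu) / (2 * k ^ 2 * (r * mu) ^ 3))) with
        (sg * I (r * mu) * / (2 * k ^ 2 * (r * mu) ^ 3)) by (unfold Rdiv; ring).
    apply Rmult_le_reg_r with (2 * k ^ 2 * (r * mu) ^ 3); [lra |].
    rewrite cancel by lra. nra.
Qed.

(** 4 r^7 - 6 r^5 = r^5 (4 r^2 - 6) changes sign at sqrt(3/2), which lies between the two
    windows. *)
Lemma poly_decreasing r : 9 / 10 <= r <= 11 / 10 -> 1 * (4 * r ^ 7 - 6 * r ^ 5) <= - / 2.
Proof.
  intros H. assert (r2 : r ^ 2 <= 121 / 100) by nra.
  assert (r5 : (9 / 10) ^ 5 <= r ^ 5) by (apply pow_incr; lra).
  replace (1 * (4 * r ^ 7 - 6 * r ^ 5)) with (r ^ 5 * (4 * r ^ 2 - 6)) by ring. nra.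
Qed.

Lemma poly_increasing r : 13 / 10 <= r <= 15 / 10 -> -1 * (4 * r ^ 7 - 6 * r ^ 5) <= - / 2.
Proof.
  intros H. assert (r2 : 169 / 100 <= r ^ 2) by nra.
  assert (r5 : 1 ^ 5 <= r ^ 5) by (apply pow_incr; lra).
  replace (-1 * (4 * r ^ 7 - 6 * r ^ 5)) with (- (r ^ 5 * (4 * r ^ 2 - 6))) by ring. nra.
Qed.

(** The windows surround the roots 1 and sqrt 2; with margin 3/50 the signs are tested at 0.96,
    1.04, 1.36 and 1.44. Consecutive simple roots have opposite slopes, so one cycle attracts and
    the other repels, the sign of N deciding which. *)
Lemma two_simple_zeros (I I' : R -> R) (k N K1 mu : R) :
  0 < k -> N <> 0 -> 0 < K1 -> 0 < mu -> 32 * K1 * mu ^ 2 <= k * Rabs N ->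
  (forall rho, 0 <= rho <= 2 * mu ->
      is_derive I rho (I' rho) /\
      Rabs (I' rho + 2 * k * N * (7 * rho ^ 6 - 15 * mu ^ 2 * rho ^ 4 + 6 * mu ^ 4 * rho ^ 2)) <= K1 * mu ^ 8 /\
      Rabs (I rho + 2 * k * N * (rho ^ 7 - 3 * mu ^ 2 * rho ^ 5 + 2 * mu ^ 4 * rho ^ 3)) <= 2 * K1 * mu ^ 9) ->
  exists sg m, (sg = 1 \/ sg = -1) /\ 0 < m /\
    simple_zero (fun x => I x / (2 * k ^ 2 * x ^ 3)) (9 / 10 * mu) (11 / 10 * mu) (/ 50 * mu) sg m /\
    simple_zero (fun x => I x / (2 * k ^ 2 * x ^ 3)) (13 / 10 * mu) (15 / 10 * mu) (/ 50 * mu) (- sg) m.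
Proof.
  intros Hk HN HK Hmu Hsmall HI.
  assert (Hn : 0 < Rabs N) by now apply Rabs_pos_lt.
  exists (if Rcase_abs N then 1 else -1).
  exists (Rmin (Rabs N * mu ^ 3 / (64 * k)) (Rabs N * mu ^ 4 / (1000 * k))).
  assert (P3 : 0 < mu ^ 3) by (apply pow_lt; auto). assert (P4 : 0 < mu ^ 4) by (apply pow_lt; auto).
  split; [destruct (Rcase_abs N); auto |]. split.
  { apply Rmin_case; apply Rdiv_lt_0_compat; nra. }
  split.
  - apply (simple_zero_scaled I I' k (Rabs N) N K1 mu (9 / 10) (11 / 10) (/ 50) _ 1); auto; try lra.
    + destruct (Rcase_abs N); auto.
    + unfold Rabs. destruct (Rcase_abs N); lra.
    + apply poly_decreasing.
  - apply (simple_zero_scaled I I' k (Rabs N) N K1 mu (13 / 10) (15 / 10) (/ 50) _ (-1)); auto; try lra.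
    + destruct (Rcase_abs N); [right | left]; lra.
    + unfold Rabs. destruct (Rcase_abs N); lra.
    + apply poly_increasing.
Qed.

(** * Time changes and uniqueness of planar orbits *)

(** Converts the angle t into the time of the planar system. As w >= c > 0, its primitive is a
    bijection of the line; the inverse is taken pointwise and differentiated through the mean value
    theorem. *)
Lemma time_change (w : R -> R) (c t0 : R) :
  0 < c -> (forall t, continuous w t) -> (forall t, c <= w t) ->
  exists Tm tau : R -> R,
    Tm t0 = 0 /\ (forall t, is_derive Tm t (w t)) /\
    (forall s, Tm (tau s) = s) /\ (forall t, tau (Tm t) = t) /\
    (forall s, is_derive tau s (/ w (tau s))).
Proof.
  intros Hc Cw Hw. set (Tm := (fun t => RInt w t0 t) : R -> R).
  assert (T0 : Tm t0 = 0) by (unfold Tm; rewrite RInt_point; reflexivity).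
  assert (DT : forall t, is_derive Tm t (w t)) by (intros; now apply is_derive_Rint_upper).
  assert (grow : forall s t, s <= t -> c * (t - s) <= Tm t - Tm s).
  { intros s t Hst.
    destruct (segment_mvt Tm w s t) as [z [_ ->]]; [intros; apply DT |].
    apply Rmult_le_compat_r; [lra | apply Hw]. }
  assert (CT : continuity Tm).
  { intros t. apply continuity_pt_filterlim. apply (ex_derive_continuous Tm t). eexists. apply DT. }
  assert (surj : forall s : R, exists t : R, Tm t = s).
  { intros s.
    assert (P : s = s / c * c) by (field; lra).
    destruct (IVT_gen Tm (t0 - Rabs (s / c)) (t0 + Rabs (s / c)) s CT) as [t [_ E]]; [| eauto].
    assert (G1 := grow (t0 - Rabs (s / c)) t0). assert (G2 := grow t0 (t0 + Rabs (s / c))).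
    assert (Q := Rabs_pos (s / c)). rewrite T0 in *.
    specialize (G1 ltac:(lra)). specialize (G2 ltac:(lra)).
    assert (A1 := Rle_abs (s / c)). assert (A2 := Rle_abs (- (s / c))). rewrite Rabs_Ropp in A2.
    rewrite Rmin_left, Rmax_right by nra. split; nra. }
  destruct (functional_choice _ surj) as [tau Htau].
  assert (inj : forall s t, Tm s = Tm t -> s = t).
  { intros s t E. destruct (Rtotal_order s t) as [L | [L | L]]; auto.
    - assert (G := grow s t ltac:(lra)). nra.
    - assert (G := grow t s ltac:(lra)). nra. }
  assert (tauT : forall t, tau (Tm t) = t) by (intros; apply inj; auto).
  assert (tau_lip : forall s t, Rabs (tau s - tau t) <= / c * Rabs (s - t)).
  { intros s t. apply Rmult_le_reg_l with c; auto.
    rewrite <- Rmult_assoc, Rinv_r, Rmult_1_l by lra.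
    rewrite <- (Htau s) at 2. rewrite <- (Htau t) at 2.
    assert (key : forall x y, x <= y -> c * Rabs (x - y) <= Rabs (Tm x - Tm y)).
    { intros x y L. assert (G := grow x y L). assert (0 <= c * (y - x)) by (apply Rmult_le_pos; lra).
      rewrite (Rabs_minus_sym x), (Rabs_minus_sym (Tm x)), !Rabs_pos_eq by lra. exact G. }
    destruct (Rle_dec (tau s) (tau t)) as [L | L]; [now apply key |].
    rewrite (Rabs_minus_sym (tau s)), (Rabs_minus_sym (Tm _)). apply key. lra. }
  exists Tm, tau. split; [auto |]. split; [auto |]. split; [auto |]. split; [auto |].
  intros s. apply is_derive_Reals. intros eps He.
  set (t := tau s). assert (Wt : c <= w t) by apply Hw.
  assert (Heps : 0 < eps * (c * w t)) by (apply Rmult_lt_0_compat; nra).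
  destruct (proj1 (filterlim_locally w (w t)) (Cw t) (mkposreal _ Heps)) as [d Hd].
  assert (Hdc : 0 < d * c) by (apply Rmult_lt_0_compat; auto; apply cond_pos).
  exists (mkposreal _ Hdc). intros h Hh Hh'. simpl in Hh'.
  assert (L := tau_lip (s + h) s). fold t in L. replace (s + h - s) with h in L by ring.
  assert (L' : Rabs (tau (s + h) - t) < d).
  { apply Rle_lt_trans with (1 := L). apply Rmult_lt_reg_l with c; auto.
    rewrite <- Rmult_assoc, Rinv_r by lra. lra. }
  destruct (segment_mvt Tm w t (tau (s + h))) as [z [Hz E]]; [intros; apply DT |].
  unfold t in E at 1. rewrite !Htau in E. replace (s + h - s) with h in E by ring.
  assert (Hz' : Rabs (w z - w t) < eps * (c * w t)).
  { apply Hd. change (Rabs (z - t) < d).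
    eapply Rle_lt_trans; [| apply L']. revert Hz. unfold Rmin, Rmax, Rabs.
    destruct (Rle_dec t (tau (s + h))); repeat destruct Rcase_abs; lra. }
  assert (Wz : c <= w z) by apply Hw.
  replace ((tau (s + h) - t) / h - / w t) with ((w t - w z) * / (w z * w t)).
  2:{ set (D := tau (s + h) - t) in *. replace D with (h / w z); [field; lra |].
      clearbody D. rewrite E. field. lra. }
  rewrite Rabs_mult, Rabs_minus_sym, (Rabs_pos_eq (/ _)) by (left; apply Rinv_0_lt_compat; nra).
  apply Rmult_lt_reg_r with (w z * w t); [nra |].
  rewrite Rmult_assoc, Rinv_l, Rmult_1_r by nra.
  apply Rlt_le_trans with (1 := Hz'). apply Rmult_le_compat_l; [lra |].
  apply Rmult_le_compat_r; lra.
Qed.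

Definition locally_lipschitz (F : R -> R -> R) : Prop :=
  forall M, exists K, forall u v u' v', Rabs u <= M -> Rabs v <= M -> Rabs u' <= M -> Rabs v' <= M ->
    Rabs (F u v - F u' v') <= K * (Rabs (u - u') + Rabs (v - v')).

Lemma ll_const c : locally_lipschitz (fun _ _ => c).
Proof.
  intros M. exists 0. intros. rewrite Rminus_diag, Rabs_R0. lra.
Qed.

Lemma ll_fst : locally_lipschitz (fun u _ => u).
Proof.
  intros M. exists 1. intros u v u' v' _ _ _ _. assert (P := Rabs_pos (v - v')). lra.
Qed.

Lemma ll_snd : locally_lipschitz (fun _ v => v).
Proof.
  intros M. exists 1. intros u v u' v' _ _ _ _. assert (P := Rabs_pos (u - u')). lra.
Qed.

Lemma ll_plus F G : locally_lipschitz F -> locally_lipschitz G ->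
  locally_lipschitz (fun u v => F u v + G u v).
Proof.
  intros HF HG M. destruct (HF M) as [K H]. destruct (HG M) as [K' H']. exists (K + K').
  intros u v u' v' A1 A2 A3 A4.
  replace (F u v + G u v - (F u' v' + G u' v')) with ((F u v - F u' v') + (G u v - G u' v')) by ring.
  eapply Rle_trans; [apply Rabs_triang |].
  specialize (H u v u' v' A1 A2 A3 A4). specialize (H' u v u' v' A1 A2 A3 A4). lra.
Qed.

Lemma ll_bounded F M : locally_lipschitz F ->
  exists B, 0 <= B /\ forall u v, Rabs u <= M -> Rabs v <= M -> Rabs (F u v) <= B.
Proof.
  intros HF. destruct (HF M) as [K H]. exists (Rabs (F 0 0) + Rabs K * (2 * Rabs M)). split.
  - assert (P := Rabs_pos (F 0 0)). assert (P1 := Rabs_pos K). assert (P2 := Rabs_pos M). nra.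
  - intros u v Hu Hv. assert (Pu := Rabs_pos u). assert (PM : 0 <= M) by lra.
    specialize (H u v 0 0 Hu Hv ltac:(rewrite Rabs_R0; lra) ltac:(rewrite Rabs_R0; lra)).
    rewrite !Rminus_0_r in H. rewrite (Rabs_pos_eq M) by auto.
    replace (F u v) with ((F u v - F 0 0) + F 0 0) by ring.
    eapply Rle_trans; [apply Rabs_triang |].
    assert (Q := Rle_abs K). assert (Q' := Rabs_pos K). assert (Pv := Rabs_pos v).
    assert (K * (Rabs u + Rabs v) <= Rabs K * (2 * M)) by nra. lra.
Qed.

Lemma ll_mult F G : locally_lipschitz F -> locally_lipschitz G ->
  locally_lipschitz (fun u v => F u v * G u v).
Proof.
  intros HF HG M. destruct (HF M) as [K H]. destruct (HG M) as [K' H'].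
  destruct (ll_bounded F M HF) as [B [B0 HB]]. destruct (ll_bounded G M HG) as [B' [B0' HB']].
  exists (B * Rabs K' + Rabs K * B').
  intros u v u' v' A1 A2 A3 A4.
  replace (F u v * G u v - F u' v' * G u' v') with
    (F u v * (G u v - G u' v') + (F u v - F u' v') * G u' v') by ring.
  eapply Rle_trans; [apply Rabs_triang |]. rewrite !Rabs_mult.
  specialize (H u v u' v' A1 A2 A3 A4). specialize (H' u v u' v' A1 A2 A3 A4).
  specialize (HB u v A1 A2). specialize (HB' u' v' A3 A4).
  set (D := Rabs (u - u') + Rabs (v - v')) in *.
  assert (PD : 0 <= D) by (unfold D; assert (P1 := Rabs_pos (u - u')); assert (P2 := Rabs_pos (v - v')); lra).
  assert (Q := Rle_abs K). assert (Q' := Rle_abs K').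
  assert (Rabs (F u v) * Rabs (G u v - G u' v') <= B * (Rabs K' * D)).
  { apply Rmult_le_compat; try apply Rabs_pos; auto. nra. }
  assert (Rabs (F u v - F u' v') * Rabs (G u' v') <= (Rabs K * D) * B').
  { apply Rmult_le_compat; try apply Rabs_pos; auto. nra. }
  lra.
Qed.

Lemma ll_pow F n : locally_lipschitz F -> locally_lipschitz (fun u v => F u v ^ n).
Proof.
  intros H. induction n as [| n IH]; simpl; [apply ll_const |].
  apply (ll_mult F (fun u v => F u v ^ n)); auto.
Qed.

Lemma ll_scal c F : locally_lipschitz F -> locally_lipschitz (fun u v => c * F u v).
Proof. intros H. apply (ll_mult (fun _ _ => c)); auto. apply ll_const. Qed.

Lemma ll_ext F G : (forall u v, F u v = G u v) -> locally_lipschitz F -> locally_lipschitz G.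
Proof.
  intros E H M. destruct (H M) as [K HK]. exists K. intros. rewrite <- !E. auto.
Qed.

Lemma ll_sum (F : nat -> R -> R -> R) n : (forall i, locally_lipschitz (F i)) ->
  locally_lipschitz (fun u v => sum_f_R0 (fun i => F i u v) n).
Proof.
  intros H. induction n as [| n IH]; simpl; [auto |].
  apply (ll_plus (fun u v => sum_f_R0 (fun i => F i u v) n) (F (S n))); auto.
Qed.

Lemma ll_poly2 a : locally_lipschitz (poly2 a).
Proof.
  unfold poly2. apply (ll_sum (fun i u v => sum_f_R0 (fun j => a i j * u ^ i * v ^ j) 3)).
  intros i. apply (ll_sum (fun j u v => a i j * u ^ i * v ^ j)). intros j.
  apply (ll_mult (fun u v => a i j * u ^ i) (fun u v => v ^ j)).
  - apply (ll_scal (a i j) (fun u v => u ^ i)). apply (ll_pow (fun u _ => u)), ll_fst.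
  - apply (ll_pow (fun _ v => v)), ll_snd.
Qed.

(** The equations are required only between 0 and b, because the curve built from polar coordinates
    solves the planar system only while its radius is in [lo, hi]. *)
Lemma planar_unique (F1 F2 : R -> R -> R) (x y x' y' : R -> R) (b : R) :
  locally_lipschitz F1 -> locally_lipschitz F2 ->
  (forall t, Rmin 0 b <= t <= Rmax 0 b ->
    is_derive x t (F1 (x t) (y t)) /\ is_derive y t (F2 (x t) (y t))) ->
  (forall t, Rmin 0 b <= t <= Rmax 0 b ->
    is_derive x' t (F1 (x' t) (y' t)) /\ is_derive y' t (F2 (x' t) (y' t))) ->
  x 0 = x' 0 -> y 0 = y' 0 -> x b = x' b /\ y b = y' b.
Proof.
  intros L1 L2 S S' Ex Ey.
  assert (bnd : forall z dz, (forall t, Rmin 0 b <= t <= Rmax 0 b -> is_derive z t (dz t)) ->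
    exists M, forall t, Rmin 0 b <= t <= Rmax 0 b -> Rabs (z t) <= M).
  { intros z dz Hz. destruct (bounded_continuity z (Rmin 0 b) (Rmax 0 b)) as [M HM].
    - intros t Ht. apply (ex_derive_continuous z t). exists (dz t). now apply Hz.
    - exists M. intros t Ht. left. now apply HM. }
  destruct (bnd x _ (fun t Ht => proj1 (S t Ht))) as [M1 B1].
  destruct (bnd y _ (fun t Ht => proj2 (S t Ht))) as [M2 B2].
  destruct (bnd x' _ (fun t Ht => proj1 (S' t Ht))) as [M3 B3].
  destruct (bnd y' _ (fun t Ht => proj2 (S' t Ht))) as [M4 B4].
  set (M := Rmax (Rmax M1 M2) (Rmax M3 M4)).
  assert (M1 <= M /\ M2 <= M /\ M3 <= M /\ M4 <= M) as [N1 [N2 [N3 N4]]].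
  { unfold M, Rmax. repeat (destruct Rle_dec; try lra). }
  destruct (L1 M) as [K1 HK1]. destruct (L2 M) as [K2 HK2].
  set (phi := fun t => (x t - x' t) * (x t - x' t) + (y t - y' t) * (y t - y' t)).
  (* In the rate, one factor 2 comes from differentiating the squares and another from (dx + dy)^2
     <= 2 (dx^2 + dy^2). *)
  assert (G : phi b <= phi 0 * exp (4 * (Rabs K1 + Rabs K2) * Rabs (b - 0))).
  { apply (gronwall phi (fun t => 2 * (x t - x' t) * (F1 (x t) (y t) - F1 (x' t) (y' t))
      + 2 * (y t - y' t) * (F2 (x t) (y t) - F2 (x' t) (y' t)))).
    - intros t Ht. destruct (S t Ht) as [A1 A2]. destruct (S' t Ht) as [A3 A4]. unfold phi.
      assert (D1 := is_derive_R_minus _ _ _ _ _ A1 A3). assert (D2 := is_derive_R_minus _ _ _ _ _ A2 A4).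
      eapply is_derive_eq.
      + apply (is_derive_R_plus (fun t => (x t - x' t) * (x t - x' t)) (fun t => (y t - y' t) * (y t - y' t))).
        * apply (is_derive_R_mult (fun t => x t - x' t) (fun t => x t - x' t)); eauto.
        * apply (is_derive_R_mult (fun t => y t - y' t) (fun t => y t - y' t)); eauto.
      + ring.
    - intros t Ht. specialize (B1 t Ht). specialize (B2 t Ht). specialize (B3 t Ht). specialize (B4 t Ht).
      assert (H1 := HK1 (x t) (y t) (x' t) (y' t) ltac:(lra) ltac:(lra) ltac:(lra) ltac:(lra)).
      assert (H2 := HK2 (x t) (y t) (x' t) (y' t) ltac:(lra) ltac:(lra) ltac:(lra) ltac:(lra)).
      eapply Rle_trans; [apply Rabs_triang |]. rewrite !Rabs_mult, (Rabs_pos_eq 2) by lra.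
      unfold phi.
      set (dx := Rabs (x t - x' t)) in *. set (dy := Rabs (y t - y' t)) in *.
      assert (Ea : (x t - x' t) * (x t - x' t) = dx * dx).
      { unfold dx. rewrite <- Rabs_mult, Rabs_pos_eq; auto. apply Rle_0_sqr. }
      assert (Eb : (y t - y' t) * (y t - y' t) = dy * dy).
      { unfold dy. rewrite <- Rabs_mult, Rabs_pos_eq; auto. apply Rle_0_sqr. }
      rewrite Ea, Eb.
      assert (Pa : 0 <= dx) by apply Rabs_pos. assert (Pb : 0 <= dy) by apply Rabs_pos.
      assert (Q1 := Rle_abs K1). assert (Q2 := Rle_abs K2).
      assert (R1 := Rabs_pos K1). assert (R2 := Rabs_pos K2).
      assert (H1' : Rabs (F1 (x t) (y t) - F1 (x' t) (y' t)) <= Rabs K1 * (dx + dy)) by nra.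
      assert (H2' : Rabs (F2 (x t) (y t) - F2 (x' t) (y' t)) <= Rabs K2 * (dx + dy)) by nra.
      assert (sq : (dx + dy) * (dx + dy) <= 2 * (dx * dx + dy * dy)).
      { assert (P := Rle_0_sqr (dx - dy)). unfold Rsqr in P. lra. }
      assert (X1 : 2 * dx * Rabs (F1 (x t) (y t) - F1 (x' t) (y' t)) <= 2 * (dx + dy) * (Rabs K1 * (dx + dy))).
      { apply Rmult_le_compat; try lra. apply Rabs_pos. }
      assert (X2 : 2 * dy * Rabs (F2 (x t) (y t) - F2 (x' t) (y' t)) <= 2 * (dx + dy) * (Rabs K2 * (dx + dy))).
      { apply Rmult_le_compat; try lra. apply Rabs_pos. }
      assert (X3 : (Rabs K1 + Rabs K2) * ((dx + dy) * (dx + dy))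
        <= (Rabs K1 + Rabs K2) * (2 * (dx * dx + dy * dy))) by (apply Rmult_le_compat_l; lra).
      lra. }
  unfold phi in G. rewrite Ex, Ey, !Rminus_diag, !Rmult_0_l, Rplus_0_r, Rmult_0_l in G.
  assert (P1 := Rle_0_sqr (x b - x' b)). assert (P2 := Rle_0_sqr (y b - y' b)). unfold Rsqr in *.
  split; apply Rminus_diag_uniq, Rsqr_0_uniq; unfold Rsqr; lra.
Qed.

(** * From periodic solutions to limit cycles *)

Lemma cos_sin_eq (x y : R) : cos x = cos y -> sin x = sin y -> exists n : Z, x = y + 2 * PI * IZR n.
Proof.
  intros Hc Hs.
  assert (E : cos (x - y) = 1).
  { rewrite cos_minus, Hc, Hs. assert (P := sin2_cos2 y). unfold Rsqr in P. lra. }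
  replace (x - y) with (2 * ((x - y) / 2)) in E by field.
  rewrite cos_2a_sin in E.
  assert (Z : sin ((x - y) / 2) = 0) by nra.
  apply sin_eq_0_0 in Z. destruct Z as [n Hn]. exists n. lra.
Qed.

Section Cycle.

Variables (h11 h20 h40 k R0 : R).
Hypothesis k_pos : 0 < k.
Hypothesis k_sq : k ^ 2 = - 16 * (h20 ^ 2 + h40).
Let a := 2 * h20 - h11 ^ 2.
Hypothesis R0_small : 4 * Om k a * R0 ^ 2 <= 1.

(** This is 2 H2 / k^2, normalised to equal rho^4; it recovers the radius from a point of the
    plane. *)
Definition energy4 (u v : R) := ((v + v ^ 2 / 2 + 2 * a * u ^ 2) / k) ^ 2 + u ^ 4.

Lemma Vcrd_square t rho : - R0 < rho < R0 ->
  Vcrd k a t rho + Vcrd k a t rho ^ 2 / 2 = rho ^ 2 * om k a t.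
Proof.
  intros H. unfold Vcrd. assert (Q := zz_sq k a R0 R0_small t rho H).
  replace (zz k a t rho - 1 + (zz k a t rho - 1) ^ 2 / 2) with ((zz k a t rho * zz k a t rho - 1) / 2) by field.
  rewrite Q. field.
Qed.

Lemma energy4_coord t rho : - R0 < rho < R0 -> energy4 (Ucrd t rho) (Vcrd k a t rho) = rho ^ 4.
Proof.
  intros H. unfold energy4. rewrite Vcrd_square by auto. unfold om, Ucrd.
  replace ((rho ^ 2 * (k * sn t - 2 * a * cos t ^ 2) + 2 * a * (rho * cos t) ^ 2) / k) with (rho ^ 2 * sn t)
    by (field; lra).
  replace ((rho ^ 2 * sn t) ^ 2) with (rho ^ 4 * sn t ^ 2) by ring. rewrite sn_sq. ring.
Qed.

(** One needs cos t = u / rho and [sn t] = W / (k rho^2), compatible by the energy relation. The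
    arccosine gives the solution with [sn t] <= 0 and its opposite the other sign; v > -1 selects
    the branch of the square root in [zz]. *)
Lemma coord_surjective u v rho : 0 < rho -> -1 < v -> energy4 u v = rho ^ 4 ->
  exists t, Ucrd t rho = u /\ Vcrd k a t rho = v.
Proof.
  intros Hr Hv HE. unfold energy4 in HE. set (Y := (v + v ^ 2 / 2 + 2 * a * u ^ 2) / k) in *.
  set (C := u / rho).
  assert (EC : u = C * rho) by (unfold C; field; lra).
  assert (P4 : 0 < rho ^ 4) by (apply pow_lt; auto).
  assert (EY : (Y / rho ^ 2) ^ 2 = 1 - C ^ 4).
  { replace ((Y / rho ^ 2) ^ 2) with (Y ^ 2 / rho ^ 4) by (field; lra).
    replace (Y ^ 2) with (rho ^ 4 - u ^ 4) by lra. rewrite EC. field. lra. }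
  assert (C1 : -1 <= C <= 1).
  { assert (P := pow2_ge_0 (Y / rho ^ 2)).
    assert (C4 : C ^ 2 * C ^ 2 <= 1) by (replace (C ^ 2 * C ^ 2) with (C ^ 4) by ring; lra).
    assert (P2 := pow2_ge_0 C). assert (C ^ 2 <= 1) by nra. nra. }
  assert (key : exists t, cos t = C /\ sn t = Y / rho ^ 2).
  { set (t := acos C). assert (Ct : cos t = C) by now apply cos_acos.
    assert (St : 0 <= sin t).
    { apply sin_ge_0; apply acos_bound. }
    assert (Q := cs_bounds t). assert (S2 := sn_sq t). rewrite Ct, <- EY in S2.
    assert (Sn : sn t <= 0) by (unfold sn; nra).
    destruct (Rle_dec (Y / rho ^ 2) 0) as [L | L].
    - exists t. split; auto. nra.
    - exists (- t). rewrite cos_neg. split; auto.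
      replace (sn (- t)) with (- sn t).
      + nra.
      + unfold sn, cs. rewrite sin_neg, cos_neg. ring. }
  destruct key as [t [Ct St]]. exists t. split.
  - unfold Ucrd. rewrite Ct, EC. ring.
  - unfold Vcrd, zz, om. rewrite Ct, St.
    replace (1 + 2 * rho ^ 2 * (k * (Y / rho ^ 2) - 2 * a * C ^ 2)) with ((1 + v) * (1 + v)).
    + rewrite sqrt_square by lra. ring.
    + replace (k * (Y / rho ^ 2) - 2 * a * C ^ 2) with ((k * Y - 2 * a * u ^ 2) / rho ^ 2) by (rewrite EC; field; lra).
      unfold Y. field. lra.
Qed.

(** The energy determines rho, then u gives cos t and v gives sin t. A planar return is thereby an
    integer number of turns with the same radius. *)
Lemma coord_injective t rho t' rho' :
  0 < rho < R0 -> 0 < rho' < R0 ->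
  Ucrd t rho = Ucrd t' rho' -> Vcrd k a t rho = Vcrd k a t' rho' ->
  rho = rho' /\ exists n : Z, t = t' + 2 * PI * IZR n.
Proof.
  intros H H' EU EV.
  assert (Er : rho = rho').
  { assert (E := energy4_coord t rho ltac:(lra)). rewrite EU, EV, energy4_coord in E by lra.
    assert (E' : (rho' ^ 2 - rho ^ 2) * (rho' ^ 2 + rho ^ 2) = 0) by (transitivity (rho' ^ 4 - rho ^ 4); [ring | lra]).
    assert (E2 : rho' ^ 2 - rho ^ 2 = 0) by (destruct (Rmult_integral _ _ E'); nra).
    assert (E3 : (rho' - rho) * (rho' + rho) = 0) by (rewrite <- E2; ring).
    destruct (Rmult_integral _ _ E3); lra. }
  split; auto. subst rho'. apply cos_sin_eq.
  - unfold Ucrd in EU. apply Rmult_eq_reg_l with rho; lra.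
  - assert (Ec : cos t = cos t') by (unfold Ucrd in EU; apply Rmult_eq_reg_l with rho; lra).
    assert (E := Vcrd_square t rho ltac:(lra)). rewrite EV, Vcrd_square in E by lra.
    assert (Eo : om k a t' = om k a t).
    { apply Rmult_eq_reg_l with (rho ^ 2); auto. assert (0 < rho ^ 2) by (apply pow_lt; lra). lra. }
    unfold om in Eo. rewrite Ec in Eo.
    assert (Es : sn t' = sn t) by (apply Rmult_eq_reg_l with k; lra).
    unfold sn in Es. assert (Ecs : cs t = cs t') by (unfold cs; now rewrite Ec).
    rewrite Ecs in Es. assert (Q := cs_bounds t').
    assert (- sin t' = - sin t) by (apply Rmult_eq_reg_r with (cs t'); lra). lra.
Qed.

Lemma coord_bounds t rho : 0 < rho < R0 ->
  Rabs (Ucrd t rho) <= rho /\ Rabs (Vcrd k a t rho) <= 2 * (Om k a * rho ^ 2) /\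
  - / 2 <= Vcrd k a t rho <= 1.
Proof.
  intros H. assert (Z := zz_bounds k a R0 R0_small t rho ltac:(lra)).
  assert (Cb := COS_bound t).
  split; [| split].
  - unfold Ucrd. rewrite Rabs_mult, (Rabs_pos_eq rho) by lra.
    assert (Rabs (cos t) <= 1) by (apply Rabs_le; lra). nra.
  - destruct (om_small k a R0 R0_small t rho ltac:(lra)) as [W _].
    assert (Q := zz_sq k a R0 R0_small t rho ltac:(lra)).
    replace (1 + 2 * rho ^ 2 * om k a t) with (1 + 2 * (rho ^ 2 * om k a t)) in Q by ring.
    set (w := rho ^ 2 * om k a t) in *. unfold Vcrd. set (z := zz k a t rho) in *.
    assert (E : Rabs ((z - 1) * (z + 1)) = 2 * Rabs w).
    { replace ((z - 1) * (z + 1)) with (2 * w) by lra. rewrite Rabs_mult, (Rabs_pos_eq 2); lra. }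
    rewrite Rabs_mult, (Rabs_pos_eq (z + 1)) in E by lra.
    assert (P := Rabs_pos (z - 1)). nra.
  - unfold Vcrd. lra.
Qed.

(* The chain rule for [H2 = k ^ 2 * rho ^ 4 / 2], solved for the partial derivatives of [H2]. *)
Lemma energy_identity t rho : - R0 < rho < R0 ->
  U_t t rho * (2 * k ^ 2 * rho ^ 3) = jac k a t rho * H2_v h11 h20 h40 (Ucrd t rho) (Vcrd k a t rho) /\
  V_t k a t rho * (2 * k ^ 2 * rho ^ 3) = - jac k a t rho * H2_u h11 h20 h40 (Ucrd t rho) (Vcrd k a t rho).
Proof.
  intros H. assert (Z := zz_bounds k a R0 R0_small t rho H). assert (Q := cs_bounds t).
  assert (S := Vcrd_square t rho H).
  assert (EV : 1 + Vcrd k a t rho = zz k a t rho) by (unfold Vcrd; ring).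
  set (u := Ucrd t rho) in *. set (v := Vcrd k a t rho) in *.
  assert (W : v + v ^ 2 / 2 + 2 * a * u ^ 2 = k * rho ^ 2 * sn t).
  { rewrite S. unfold om, u, Ucrd. ring. }
  split.
  - replace (H2_v h11 h20 h40 u v) with ((1 + v) * (v + v ^ 2 / 2 + 2 * a * u ^ 2)) by (unfold H2_v, a; field).
    rewrite EV, W. unfold U_t, jac, sn. field. lra.
  - replace (H2_u h11 h20 h40 u v) with
      (4 * a * u * (v + v ^ 2 / 2 + 2 * a * u ^ 2) + 2 * (- 16 * (h20 ^ 2 + h40)) * u ^ 3) by (unfold H2_u, a; field).
    rewrite W, <- k_sq. unfold V_t, jac, om', sn, u, Ucrd. field. lra.
Qed.

Section Field.

Variables (p q : nat -> nat -> R) (eps lo hi lo0 hi0 c : R).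
Hypothesis c_pos : 0 < c.
Hypothesis ann : 0 <= lo0 /\ lo0 < lo /\ lo < hi /\ hi < hi0 /\ hi0 <= R0.

Let h (rho : R) := 2 * k ^ 2 * rho ^ 3.
Let F1 (u v : R) := H2_v h11 h20 h40 u v + eps * poly2 p u v.
Let F2 (u v : R) := - H2_u h11 h20 h40 u v + eps * poly2 q u v.
Let speed (t rho : R) := h rho - eps * radial_flux k a p q t rho.
Let g (t x : R) := flux k a p q t (clamp lo hi x) / speed t (clamp lo hi x).

Hypothesis speed_pos : forall t x, lo0 < x < hi0 -> c / 2 <= speed t x.

(** Cramer's rule: U_t (h - eps (q U_r - p V_r)) + eps U_r (q U_t - p V_t) = U_t h + eps p [jac],
    and likewise for V with q. The unperturbed part is the energy identity. *)
Lemma polar_to_planar (x tau : R -> R) (s : R) :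
  lo <= x (tau s) <= hi ->
  is_derive x (tau s) (eps * g (tau s) (x (tau s))) ->
  is_derive tau s (speed (tau s) (x (tau s)) / jac k a (tau s) (x (tau s))) ->
  is_derive (fun s => Ucrd (tau s) (x (tau s))) s
    (F1 (Ucrd (tau s) (x (tau s))) (Vcrd k a (tau s) (x (tau s)))) /\
  is_derive (fun s => Vcrd k a (tau s) (x (tau s))) s
    (F2 (Ucrd (tau s) (x (tau s))) (Vcrd k a (tau s) (x (tau s)))).
Proof.
  intros Hx Dx Dtau. set (t := tau s) in *. set (rho := x t) in *.
  assert (Hr : 0 < rho < R0) by lra.
  assert (Hr' : - R0 < rho < R0) by lra.
  assert (Sp := speed_pos t rho ltac:(lra)).
  assert (Z := zz_bounds k a R0 R0_small t rho Hr'). assert (Q := cs_bounds t).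
  assert (Jp : 0 < jac k a t rho).
  { unfold jac. apply Rdiv_lt_0_compat; [| nra]. assert (0 < rho ^ 2) by (apply pow_lt; lra). nra. }
  destruct (energy_identity t rho Hr') as [E1 E2]. assert (JI := jac_identity k a R0 R0_small t rho Hr').
  assert (Eg : g t rho = flux k a p q t rho / speed t rho) by (unfold g; now rewrite clamp_id).
  assert (Dr := is_derive_R_comp x tau s _ _ Dx Dtau). fold t rho in Dr. rewrite Eg in Dr.
  assert (Dr' : is_derive (fun s => x (tau s)) s (eps * flux k a p q t rho / jac k a t rho)).
  { apply is_derive_eq with (1 := Dr). fold t rho. field. lra. }
  split.
  - unfold Ucrd at 1. eapply is_derive_eq.
    + apply (is_derive_R_mult (fun s => x (tau s)) (fun s => cos (tau s))); [exact Dr' |].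
      apply (is_derive_R_comp cos tau); [apply is_derive_cos | exact Dtau].
    + fold t rho. unfold F1.
      replace (H2_v h11 h20 h40 (Ucrd t rho) (Vcrd k a t rho)) with (U_t t rho * h rho / jac k a t rho)
        by (unfold h; rewrite E1; field; lra).
      apply Rmult_eq_reg_r with (jac k a t rho); [| lra].
      transitivity (U_r t rho * (eps * flux k a p q t rho) + U_t t rho * speed t rho).
      { unfold U_r, U_t. field. lra. }
      transitivity (U_t t rho * h rho + eps * poly2 p (Ucrd t rho) (Vcrd k a t rho) * jac k a t rho); [| field; lra].
      rewrite <- JI. unfold speed, flux, radial_flux. ring.
  - unfold Vcrd at 1. eapply is_derive_eq.
    + apply (is_derive_R_minus (fun s => zz k a (tau s) (x (tau s))) (fun _ => 1)); [| apply (is_derive_const 1)].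
      apply (is_derive_zz k a R0 R0_small tau (fun s => x (tau s))); [exact Hr' | exact Dtau | exact Dr'].
    + fold t rho. unfold F2, zero; simpl.
      replace (H2_u h11 h20 h40 (Ucrd t rho) (Vcrd k a t rho)) with (- (V_t k a t rho * h rho / jac k a t rho))
        by (unfold h; rewrite E2; field; lra).
      apply Rmult_eq_reg_r with (jac k a t rho); [| lra].
      transitivity (V_t k a t rho * speed t rho + V_r k a t rho * (eps * flux k a p q t rho)).
      { field. lra. }
      transitivity (V_t k a t rho * h rho + eps * poly2 q (Ucrd t rho) (Vcrd k a t rho) * jac k a t rho); [| field; lra].
      rewrite <- JI. unfold speed, flux, radial_flux. ring.
Qed.

Lemma ll_F1 : locally_lipschitz F1.
Proof.
  unfold F1. apply (ll_plus (H2_v h11 h20 h40)); [| apply ll_scal, ll_poly2].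
  apply (ll_ext (fun u v => v + (4 * h20 - 2 * h11 ^ 2) * u ^ 2 + 3 / 2 * v ^ 2
    + 2 * (2 * h20 - h11 ^ 2) * (u ^ 2 * v) + / 2 * v ^ 3)); [intros; unfold H2_v; ring |].
  apply ll_plus; [apply ll_plus; [apply ll_plus; [apply ll_plus |] |] |].
  - apply ll_snd.
  - apply ll_scal, (ll_pow (fun u _ => u)), ll_fst.
  - apply ll_scal, (ll_pow (fun _ v => v)), ll_snd.
  - apply ll_scal, (ll_mult (fun u _ => u ^ 2) (fun _ v => v)); [apply (ll_pow (fun u _ => u)), ll_fst | apply ll_snd].
  - apply ll_scal, (ll_pow (fun _ v => v)), ll_snd.
Qed.

Lemma ll_F2 : locally_lipschitz F2.
Proof.
  unfold F2. apply (ll_plus (fun u v => - H2_u h11 h20 h40 u v)); [| apply ll_scal, ll_poly2].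
  apply (ll_ext (fun u v => - 2 * (4 * h20 - 2 * h11 ^ 2) * (u * v)
    + - 4 * (2 * (h11 ^ 4 - 4 * h11 ^ 2 * h20 - 4 * h40)) * u ^ 3
    + - 2 * (2 * h20 - h11 ^ 2) * (u * v ^ 2))); [intros; unfold H2_u; ring |].
  apply ll_plus; [apply ll_plus |].
  - apply ll_scal, (ll_mult (fun u _ => u) (fun _ v => v)); [apply ll_fst | apply ll_snd].
  - apply ll_scal, (ll_pow (fun u _ => u)), ll_fst.
  - apply ll_scal, (ll_mult (fun u _ => u) (fun _ v => v ^ 2)); [apply ll_fst | apply (ll_pow (fun _ v => v)), ll_snd].
Qed.

Lemma ll_energy4 : locally_lipschitz energy4.
Proof.
  apply (ll_ext (fun u v => (/ k * (v + / 2 * v ^ 2 + 2 * a * u ^ 2)) ^ 2 + u ^ 4)).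
  { intros. unfold energy4. field. lra. }
  apply ll_plus; [| apply (ll_pow (fun u _ => u)), ll_fst].
  apply (ll_pow (fun u v => / k * (v + / 2 * v ^ 2 + 2 * a * u ^ 2))), ll_scal.
  apply ll_plus; [apply ll_plus |].
  - apply ll_snd.
  - apply ll_scal, (ll_pow (fun _ v => v)), ll_snd.
  - apply ll_scal, (ll_pow (fun u _ => u)), ll_fst.
Qed.

Let weight (x : R -> R) (t : R) := jac k a t (clamp lo hi (x t)) / speed t (clamp lo hi (x t)).

Lemma weight_regular (x : R -> R) : (forall t, continuous x t) ->
  (forall t, continuous (weight x) t) /\ exists cw, 0 < cw /\ forall t, cw <= weight x t.
Proof.
  intros Cx.
  assert (C2 : C11 lo0 hi0 speed).
  { unfold speed. apply C11_minus.
    - unfold h. apply C11_scal, C11_pow, C11_id.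
    - apply C11_scal. apply (C11_sub (- R0) R0); try lra. now apply C11_radial_flux. }
  assert (C3 : C11 lo0 hi0 (fun t rho => jac k a t rho * / speed t rho)).
  { apply (C11_mult _ _ (jac k a) (fun t rho => / speed t rho)).
    - apply (C11_sub (- R0) R0); try lra. now apply C11_jac.
    - apply (C11_inv _ _ speed (c / 2)); auto. lra. }
  destruct (C11_bl _ _ _ C2) as [K2 B2]. destruct (C11_bl _ _ _ C3) as [K3 B3].
  assert (cin : forall y, lo0 < clamp lo hi y < hi0).
  { intros y. assert (Q := clamp_in lo hi y ltac:(lra)). lra. }
  split.
  - intros t. apply (continuous_diag (fun t y => jac k a t (clamp lo hi y) * / speed t (clamp lo hi y)) x (Rabs K3)); auto.
    + intros y. exact (bl_cont _ _ _ _ B3 t _ (cin y)).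
    + intros s y y'. eapply Rle_trans; [exact (bl_lip _ _ _ _ B3 s _ _ (cin y) (cin y')) |].
      assert (Q := clamp_lip lo hi y y'). assert (Q' := Rle_abs K3).
      assert (P := Rabs_pos (clamp lo hi y - clamp lo hi y')). assert (P' := Rabs_pos K3). nra.
  - assert (P2 := Rabs_pos K2).
    (* [jac] is at least k lo^2 / 2 since cs * zz <= 4, and the speed is at most |K2| + 1. *)
    exists ((k * lo ^ 2 / 2) / (Rabs K2 + 1)).
    assert (l2 : 0 < lo ^ 2) by (apply pow_lt; lra).
    split; [apply Rdiv_lt_0_compat; nra |].
    intros t. unfold weight. set (y := clamp lo hi (x t)).
    assert (Iy := clamp_in lo hi (x t) ltac:(lra)). fold y in Iy.
    assert (Z := zz_bounds k a R0 R0_small t y ltac:(lra)). assert (Q := cs_bounds t).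
    assert (Sp := speed_pos t y ltac:(lra)).
    assert (Sb := bl_bound _ _ _ _ B2 t y ltac:(lra)). rewrite Rabs_pos_eq in Sb by lra.
    assert (SK := Rle_abs K2).
    unfold Rdiv at 1 3. apply Rmult_le_compat.
    + nra.
    + left. apply Rinv_0_lt_compat. lra.
    + unfold jac. apply Rmult_le_reg_r with (cs t * zz k a t y); [nra |].
      unfold Rdiv. rewrite (Rmult_assoc (2 * k * y ^ 2)), Rinv_l, Rmult_1_r by nra.
      assert (cs t * zz k a t y <= 4) by nra. assert (lo ^ 2 <= y ^ 2) by nra.
      assert (k * lo ^ 2 * / 2 * (cs t * zz k a t y) <= k * lo ^ 2 * / 2 * 4) by (apply Rmult_le_compat_l; nra).
      nra.
    + apply Rinv_le_contravar; lra.
Qed.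

(** The time change exists for all t thanks to the truncation, but the planar equation is claimed
    only where the radius lies in [lo, hi], since there the truncated equation is the true one. *)
Lemma polar_curve (x : R -> R) (t0 : R) : solves eps g x ->
  exists Tm tau : R -> R,
    Tm t0 = 0 /\ (forall t, is_derive Tm t (weight x t)) /\
    (forall s, Tm (tau s) = s) /\ (forall t, tau (Tm t) = t) /\
    (forall s t, s < t -> tau s < tau t) /\
    forall s, lo <= x (tau s) <= hi ->
      is_derive (fun s => Ucrd (tau s) (x (tau s))) s
        (F1 (Ucrd (tau s) (x (tau s))) (Vcrd k a (tau s) (x (tau s)))) /\
      is_derive (fun s => Vcrd k a (tau s) (x (tau s))) s
        (F2 (Ucrd (tau s) (x (tau s))) (Vcrd k a (tau s) (x (tau s)))).
Proof.
  intros Hx.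
  destruct (weight_regular x) as [Cw [cw [Pw Hw]]].
  { intros t. apply (ex_derive_continuous x t). eexists. apply Hx. }
  destruct (time_change (weight x) cw t0 Pw Cw Hw) as [Tm [tau [T1 [T2 [T3 [T4 T5]]]]]].
  exists Tm, tau. split; [auto |]. split; [auto |]. split; [auto |]. split; [auto |]. split.
  - intros s t Hst. destruct (Rlt_dec (tau s) (tau t)) as [L | L]; auto.
    exfalso. destruct (segment_mvt Tm (weight x) (tau t) (tau s)) as [z [_ E]]; [auto |].
    rewrite !T3 in E. specialize (Hw z). nra.
  - intros s Hs. apply polar_to_planar; auto.
    assert (E := T5 s). unfold weight in E. rewrite clamp_id in E by auto.
    apply is_derive_eq with (1 := E).
    assert (Sp := speed_pos (tau s) (x (tau s)) ltac:(lra)).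
    assert (Z := zz_bounds k a R0 R0_small (tau s) (x (tau s)) ltac:(lra)). assert (Q := cs_bounds (tau s)).
    assert (0 < jac k a (tau s) (x (tau s))).
    { unfold jac. apply Rdiv_lt_0_compat; [| nra]. assert (0 < x (tau s) ^ 2) by (apply pow_lt; lra). nra. }
    field. lra.
Qed.

Variables e sg : R.
Hypothesis e_pos : 0 < e.
Hypothesis e_lo : e <= lo.
Hypothesis sg_unit : sg = 1 \/ sg = -1.
Hypothesis iso : isolated_periodic (2 * PI) e lo hi sg eps g.

Definition polar_graph (xs : R -> R) (u v : R) : Prop :=
  exists t, Ucrd t (xs t) = u /\ Vcrd k a t (xs t) = v.

Lemma periodic_graph_orbit (xs : R -> R) :
  solves eps g xs -> (forall t, xs (t + 2 * PI) = xs t) -> (forall t, lo <= xs t <= hi) ->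
  periodic_orbit F1 F2 (polar_graph xs).
Proof.
  intros Hxs Hper Hin. assert (PP := PI_RGT_0).
  destruct (polar_curve xs 0 Hxs) as [Tm [tau [T1 [T2 [T3 [T4 [T5 T6]]]]]]].
  (* The weight along a 2 pi-periodic solution is 2 pi-periodic, so each turn takes the same planar
     time [Tm (2 * PI)], the period of the orbit. *)
  assert (Tshift : forall t, Tm (t + 2 * PI) = Tm t + Tm (2 * PI)).
  { intros t. set (D := fun t => Tm (t + 2 * PI) - Tm t).
    assert (E : Rabs (D t - D 0) <= 0 * Rabs (t - 0)).
    { apply (derive_bound_lipschitz D (fun t => weight xs (t + 2 * PI) * 1 - weight xs t)).
      - intros s _. unfold D. apply (is_derive_R_minus (fun t => Tm (t + 2 * PI)) Tm); auto.
        apply (is_derive_R_comp Tm (fun t => t + 2 * PI)); auto. auto_derive; auto.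
      - intros s _. unfold weight, speed. rewrite Hper, radial_flux_periodic.
        destruct (coord_periodic k a s (clamp lo hi (xs s))) as [_ [_ [_ [_ [_ [_ [_ [_ [_ J]]]]]]]]].
        rewrite J, Rmult_1_r, Rminus_diag, Rabs_R0. lra. }
    rewrite Rmult_0_l in E. assert (P := Rabs_pos (D t - D 0)).
    assert (Z : D t - D 0 = 0).
    { destruct (Req_dec (D t - D 0) 0) as [| NZ]; auto. apply Rabs_pos_lt in NZ. lra. }
    unfold D in Z. rewrite Rplus_0_l, T1 in Z. lra. }
  assert (Tpos : 0 < Tm (2 * PI)).
  { destruct (Rlt_dec 0 (Tm (2 * PI))) as [| N]; auto. exfalso.
    destruct (Req_dec (Tm (2 * PI)) 0) as [E | E].
    - assert (Z := T4 (2 * PI)). rewrite E, <- T1, T4 in Z. lra.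
    - assert (L : tau (Tm (2 * PI)) < tau (Tm 0)) by (apply T5; lra). rewrite !T4 in L. lra. }
  assert (tshift : forall s, tau (s + Tm (2 * PI)) = tau s + 2 * PI).
  { intros s. rewrite <- (T3 s) at 1. rewrite <- Tshift, T4. reflexivity. }
  exists (fun s => Ucrd (tau s) (xs (tau s))), (fun s => Vcrd k a (tau s) (xs (tau s))), (Tm (2 * PI)).
  split; [exact Tpos |]. split; [| split; [| split]].
  - intros s. destruct (T6 s (Hin _)) as [D1 D2]. split; now apply is_derive_Reals.
  - intros s. rewrite tshift, Hper.
    destruct (coord_periodic k a (tau s) (xs (tau s))) as [_ [_ [_ [E1 [E2 _]]]]]. now rewrite E1, E2.
  - exists (Tm 0), (Tm PI). left. rewrite !T4. unfold Ucrd. rewrite cos_0, cos_PI.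
    assert (H0 := Hin 0). assert (H1 := Hin PI). lra.
  - intros u v. split.
    + intros [t [Eu Ev]]. exists (Tm t). now rewrite T4.
    + intros [s [Eu Ev]]. now exists (tau s).
Qed.

(** A planar periodic orbit through a point of the annulus coincides, in the direction [sg], with
    the curve of the scalar solution [x] through that point, which never leaves the annulus.
    Periodicity then forces [x] to be the periodic solution. *)
Lemma orbit_near_graph (xs : R -> R) (x' y' : R -> R) (T' t' t0 : R) :
  solves eps g xs -> (forall t, xs (t + 2 * PI) = xs t) -> (forall t, lo <= xs t <= hi) ->
  0 < T' -> is_solution F1 F2 x' y' -> (forall t, x' (t + T') = x' t /\ y' (t + T') = y' t) ->
  forall x, solves eps g x ->
  x' t' = Ucrd t0 (x t0) -> y' t' = Vcrd k a t0 (x t0) -> lo <= x t0 <= hi ->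
  (x t0 = xs t0 -> forall t, x t = xs t) ->
  (forall t, 0 <= t -> lo <= x (t0 + sg * t) <= hi) ->
  (forall n, (0 < n)%nat -> x (t0 + sg * (INR n * (2 * PI))) = x t0 -> x t0 = xs t0) ->
  forall u v, (exists t, x' t = u /\ y' t = v) <-> polar_graph xs u v.
Proof.
  intros Hxs Hper Hin HT' Sol' Per' x Hx Ex Ey Hx0 U1 U2 U3. assert (PP := PI_RGT_0).
  destruct (polar_curve x t0 Hx) as [Tm [tau [T1 [T2 [T3 [T4 [T5 T6]]]]]]].
  assert (tau0 : tau 0 = t0) by (rewrite <- T1; apply T4).
  assert (sg2 : sg * sg = 1) by (destruct sg_unit as [-> | ->]; ring).
  assert (dir : forall s, 0 < sg * s -> 0 < sg * (tau s - t0)).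
  { intros s Hs. rewrite <- tau0. destruct sg_unit as [-> | ->].
    - assert (L := T5 0 s ltac:(lra)). lra.
    - assert (L := T5 s 0 ltac:(lra)). lra. }
  assert (inr : forall s, 0 <= sg * s -> lo <= x (tau s) <= hi).
  { intros s Hs. replace (tau s) with (t0 + sg * (sg * (tau s - t0))).
    - apply U2. destruct Hs as [Hs | Hs]; [left; now apply dir |].
      assert (s = 0) by (destruct sg_unit as [-> | ->]; lra). subst s. rewrite tau0. lra.
    - replace (sg * (sg * (tau s - t0))) with ((sg * sg) * (tau s - t0)) by ring. rewrite sg2. ring. }
  assert (agree : forall s, (forall r, Rmin 0 s <= r <= Rmax 0 s -> lo <= x (tau r) <= hi) ->
    Ucrd (tau s) (x (tau s)) = x' (t' + s) /\ Vcrd k a (tau s) (x (tau s)) = y' (t' + s)).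
  { intros s Hs.
    apply (planar_unique F1 F2 (fun s => Ucrd (tau s) (x (tau s))) (fun s => Vcrd k a (tau s) (x (tau s)))
      (fun s => x' (t' + s)) (fun s => y' (t' + s)) s ll_F1 ll_F2).
    - intros r Hr. apply T6. auto.
    - intros r _. destruct (Sol' (t' + r)) as [D1 D2]. apply is_derive_Reals in D1. apply is_derive_Reals in D2.
      split; (eapply is_derive_eq; [apply (is_derive_R_comp _ (fun r => t' + r)); [eassumption | auto_derive; auto] |]); ring.
    - rewrite tau0, Rplus_0_r. auto.
    - rewrite tau0, Rplus_0_r. auto. }
  (* Follow the orbit for one of its own periods T' in the direction [sg]. The same point is
     reached, so the angle has changed by 2 pi n with the radius unchanged; monotonicity of the
     angle gives n the sign of [sg], so |n| > 0 as [U3] demands. *)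
  assert (Eq0 : x t0 = xs t0).
  { destruct (agree (sg * T')) as [A1 A2].
    { intros r Hr. apply inr. destruct sg_unit as [-> | ->].
      - rewrite Rmin_left, Rmax_right in Hr by lra. lra.
      - rewrite Rmin_right, Rmax_left in Hr by lra. lra. }
    assert (back : x' (t' + sg * T') = x' t' /\ y' (t' + sg * T') = y' t').
    { destruct sg_unit as [-> | ->].
      - rewrite Rmult_1_l. apply Per'.
      - destruct (Per' (t' + -1 * T')) as [B1 B2]. rewrite <- B1, <- B2.
        replace (t' + -1 * T' + T') with t' by ring. auto. }
    destruct back as [B1 B2]. rewrite B1, Ex in A1. rewrite B2, Ey in A2.
    assert (In1 := inr (sg * T') ltac:(replace (sg * (sg * T')) with ((sg * sg) * T') by ring; rewrite sg2; lra)).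
    destruct (coord_injective (tau (sg * T')) (x (tau (sg * T'))) t0 (x t0)) as [Er [n En]]; auto; try lra.
    assert (D := dir (sg * T') ltac:(replace (sg * (sg * T')) with ((sg * sg) * T') by ring; rewrite sg2; lra)).
    rewrite En in D, Er. replace (t0 + 2 * PI * IZR n - t0) with (2 * PI * IZR n) in D by ring.
    destruct sg_unit as [Es | Es]; rewrite Es in *.
    - assert (Pn : 0 < IZR n) by nra. apply lt_IZR in Pn.
      apply (U3 (Z.to_nat n)); [lia |].
      rewrite INR_IZR_INZ, Z2Nat.id by lia. rewrite <- Er. f_equal. ring.
    - assert (Pn : IZR n < 0) by nra. apply lt_IZR in Pn.
      apply (U3 (Z.to_nat (- n))); [lia |].
      rewrite INR_IZR_INZ, Z2Nat.id, opp_IZR by lia. rewrite <- Er. f_equal. ring. }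
  assert (Exs := U1 Eq0).
  assert (agree' : forall s, Ucrd (tau s) (xs (tau s)) = x' (t' + s) /\ Vcrd k a (tau s) (xs (tau s)) = y' (t' + s)).
  { intros s. rewrite <- Exs. apply agree. intros r _. rewrite Exs. apply Hin. }
  intros u v. split.
  - intros [t [Eu Ev]]. exists (tau (t - t')). destruct (agree' (t - t')) as [A1 A2].
    rewrite A1, A2. replace (t' + (t - t')) with t by ring. auto.
  - intros [t [Eu Ev]]. exists (t' + Tm t). destruct (agree' (Tm t)) as [A1 A2].
    rewrite <- A1, <- A2, T4. auto.
Qed.

Lemma dist2_coord (u v u' v' r : R) : dist2 u v u' v' < r -> Rabs (u - u') < r /\ Rabs (v - v') < r.
Proof.
  unfold dist2. intros H.
  assert (P1 := pow2_ge_0 (u - u')). assert (P2 := pow2_ge_0 (v - v')).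
  split; (eapply Rle_lt_trans; [| apply H]).
  - rewrite <- (sqrt_Rsqr_abs (u - u')). apply sqrt_le_1; unfold Rsqr; lra.
  - rewrite <- (sqrt_Rsqr_abs (v - v')). apply sqrt_le_1; unfold Rsqr; lra.
Qed.

(** A periodic orbit meeting a small neighbourhood of the graph has there an energy close to xs^4,
    hence a radius within [e] of [xs]. It therefore starts where the isolation statement for the
    scalar equation applies. *)
Lemma limit_cycle_of_periodic :
  exists G, limit_cycle F1 F2 G /\
    forall u v, G u v -> exists t rho, lo <= rho <= hi /\ Ucrd t rho = u /\ Vcrd k a t rho = v.
Proof.
  destruct iso as [ex [xs [S1 [S2 [S3 S4]]]]].
  assert (Hin : forall t, lo <= xs t <= hi) by (intros t; specialize (S3 t); lra).
  exists (polar_graph xs). split.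
  2:{ intros u v [t [Eu Ev]]. exists t, (xs t). auto. }
  split; [now apply periodic_graph_orbit |].
  destruct (ll_energy4 (R0 + 2)) as [K HK].
  assert (PK := Rabs_pos K). assert (QK := Rle_abs K).
  assert (l3 : 0 < lo ^ 3) by (apply pow_lt; lra).
  (* The first bound keeps v' > -1, as v >= -1/2 on the graph. The second makes the energy change
     smaller than e lo^3. *)
  set (r := Rmin (/ 10) (e * lo ^ 3 / (4 * (Rabs K + 1)))).
  assert (r1 : r <= / 10) by apply Rmin_l.
  assert (r2 : r <= e * lo ^ 3 / (4 * (Rabs K + 1))) by apply Rmin_r.
  assert (rp : 0 < r).
  { apply Rmin_case; [lra |]. apply Rdiv_lt_0_compat; [nra | lra]. }
  assert (r3 : 2 * (Rabs K + 1) * r < e * lo ^ 3).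
  { apply Rle_lt_trans with (2 * (Rabs K + 1) * (e * lo ^ 3 / (4 * (Rabs K + 1)))).
    - apply Rmult_le_compat_l; lra.
    - replace (2 * (Rabs K + 1) * (e * lo ^ 3 / (4 * (Rabs K + 1)))) with (e * lo ^ 3 / 2) by (field; lra).
      assert (0 < e * lo ^ 3) by nra. lra. }
  clearbody r. exists r. split; [exact rp |].
  intros G' [x' [y' [T' [HT' [Sol' [Per' [_ HG']]]]]]] [u [v [u' [v' [[t [Eu Ev]] [Gu' Hd]]]]]].
  apply HG' in Gu'. destruct Gu' as [t' [Eu' Ev']].
  destruct (dist2_coord _ _ _ _ _ Hd) as [Du Dv].
  assert (Hxt := S3 t).
  destruct (coord_bounds t (xs t) ltac:(lra)) as [C1 [_ C2]].
  rewrite Eu in C1. rewrite Ev in C2.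
  assert (v'_lb : -1 < v') by (apply Rabs_lt_between in Dv; lra).
  assert (En := energy4_coord t (xs t) ltac:(lra)). rewrite Eu, Ev in En.
  assert (Dn : Rabs (energy4 u v - energy4 u' v') < e * lo ^ 3).
  { assert (B1 : Rabs u <= R0 + 2) by lra.
    assert (B2 : Rabs v <= R0 + 2) by (apply Rabs_le; lra).
    assert (B3 : Rabs u' <= R0 + 2).
    { replace u' with (u - (u - u')) by ring. eapply Rle_trans; [apply Rabs_triang |]. rewrite Rabs_Ropp. lra. }
    assert (B4 : Rabs v' <= R0 + 2) by (apply Rabs_lt_between in Dv; apply Rabs_le; lra).
    eapply Rle_lt_trans; [apply HK; auto |].
    assert (X1 := Rabs_pos (u - u')). assert (X2 := Rabs_pos (v - v')).
    apply Rle_lt_trans with ((Rabs K + 1) * (2 * r)); [| lra].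
    apply Rle_trans with ((Rabs K + 1) * (Rabs (u - u') + Rabs (v - v'))).
    - apply Rmult_le_compat_r; lra.
    - apply Rmult_le_compat_l; lra. }
  rewrite En in Dn.
  set (E := energy4 u' v') in *.
  assert (EP : 0 <= E).
  { unfold E, energy4. assert (X1 := pow2_ge_0 ((v' + v' ^ 2 / 2 + 2 * a * u' ^ 2) / k)).
    replace (u' ^ 4) with ((u' ^ 2) ^ 2) by ring. assert (X2 := pow2_ge_0 (u' ^ 2)). lra. }
  set (rho := sqrt (sqrt E)).
  assert (Rp : 0 <= rho) by apply sqrt_pos.
  assert (R4 : rho ^ 4 = E).
  { unfold rho. replace (sqrt (sqrt E) ^ 4) with ((sqrt (sqrt E) * sqrt (sqrt E)) * (sqrt (sqrt E) * sqrt (sqrt E))) by ring.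
    rewrite !sqrt_sqrt; auto. apply sqrt_pos. }
  (* Factor xs^4 - rho^4: the cofactor of xs - rho is at least lo^3, so a radial gap above [e] would
     change the energy by at least e lo^3. *)
  assert (close : Rabs (xs t - rho) <= e).
  { destruct (Rle_dec (Rabs (xs t - rho)) e) as [| N]; auto. exfalso.
    rewrite <- R4 in Dn.
    replace (xs t ^ 4 - rho ^ 4) with ((xs t - rho) * (xs t ^ 3 + xs t ^ 2 * rho + xs t * rho ^ 2 + rho ^ 3)) in Dn by ring.
    assert (X3 : lo ^ 3 <= xs t ^ 3) by (apply pow_incr; lra).
    assert (X2 : 0 <= xs t ^ 2 * rho) by (apply Rmult_le_pos; auto; apply pow_le; lra).
    assert (X1 : 0 <= xs t * rho ^ 2) by (apply Rmult_le_pos; [lra | apply pow_le; lra]).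
    assert (X0 : 0 <= rho ^ 3) by (apply pow_le; lra).
    rewrite Rabs_mult, (Rabs_pos_eq (_ + _)) in Dn by lra.
    assert (e * lo ^ 3 <= Rabs (xs t - rho) * (xs t ^ 3 + xs t ^ 2 * rho + xs t * rho ^ 2 + rho ^ 3)).
    { apply Rmult_le_compat; lra. }
    lra. }
  apply Rabs_le_between in close.
  destruct (coord_surjective u' v' rho) as [t0 [F1' F2']]; [lra | auto | auto |].
  destruct (ex t0 rho) as [x [X0 Hx]].
  assert (Hxi : lo + e <= x t0 <= hi - e).
  { rewrite X0. assert (S3' := S3 t). lra. }
  destruct (S4 x t0 Hx Hxi) as [U1 [U2 U3]].
  assert (Fin := orbit_near_graph xs x' y' T' t' t0 S1 S2 Hin HT' Sol' Per' x Hx).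
  rewrite X0, Eu', Ev' in Fin. specialize (Fin (eq_sym F1') (eq_sym F2') ltac:(lra)).
  rewrite X0 in U1, U3. specialize (Fin U1 U2 U3).
  intros u0 v0. rewrite HG'. apply Fin.
Qed.

End Field.

End Cycle.

(** * Choice of the parameters and the two limit cycles *)

(** A threshold rather than one value of eps is produced, so that the two cycles can share the same
    eps. The working annulus mu/2 < rho < 2 mu keeps 2 k^2 rho^3 bounded below. *)
Lemma cycle_of_simple_zero (h11 h20 h40 k R0 mu al be th sg m : R) (p q : nat -> nat -> R) :
  0 < k -> k ^ 2 = - 16 * (h20 ^ 2 + h40) ->
  4 * Om k (2 * h20 - h11 ^ 2) * R0 ^ 2 <= 1 ->
  0 < mu -> 2 * mu <= R0 -> / 2 < al -> be < 2 -> 0 < th -> th <= al ->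
  al + 3 * th <= be - 3 * th -> 0 < m -> sg = 1 \/ sg = -1 ->
  simple_zero (fun x => melnikov k (2 * h20 - h11 ^ 2) p q x / (2 * k ^ 2 * x ^ 3))
    (al * mu) (be * mu) (th * mu) sg m ->
  exists eps0, 0 < eps0 /\ forall eps, 0 < eps < eps0 -> exists G,
    limit_cycle (fun u v => H2_v h11 h20 h40 u v + eps * poly2 p u v)
      (fun u v => - H2_u h11 h20 h40 u v + eps * poly2 q u v) G /\
    forall u v, G u v -> exists t rho, al * mu <= rho <= be * mu /\
      Ucrd t rho = u /\ Vcrd k (2 * h20 - h11 ^ 2) t rho = v.
Proof.
  intros Hk Hk2 HR Hmu Hmu2 Hal Hbe Hth Hthal Hlh Hm Hsg Z.
  set (a := 2 * h20 - h11 ^ 2) in *.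
  assert (PP := PI_RGT_0).
  assert (k2 : 0 < k ^ 2) by (apply pow_lt; auto).
  assert (C1 : C11 (mu / 2) (2 * mu) (flux k a p q)).
  { apply (C11_sub (- R0) R0); try lra. now apply C11_flux. }
  assert (C2 : C11 (mu / 2) (2 * mu) (radial_flux k a p q)).
  { apply (C11_sub (- R0) R0); try lra. now apply C11_radial_flux. }
  set (c := 2 * k ^ 2 * (mu / 2) ^ 3).
  assert (cp : 0 < c).
  { unfold c. assert (0 < (mu / 2) ^ 3) by (apply pow_lt; lra). nra. }
  assert (mal : mu / 2 < al * mu) by nra.
  assert (mbe : be * mu < 2 * mu) by nra.
  assert (mth : 0 < th * mu) by nra.
  assert (mlh : al * mu + 3 * (th * mu) <= be * mu - 3 * (th * mu)) by nra.
  destruct (averaging_annulus (2 * PI) (th * mu) m (mu / 2) (2 * mu) (al * mu) (be * mu) sg c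
    (flux k a p q) (radial_flux k a p q) (fun rho => 2 * k ^ 2 * rho ^ 3)) as [eps0 [P0 Hav]]; auto; try lra.
  - apply (C11_scal _ _ (2 * k ^ 2) (fun _ x => x ^ 3)), (C11_pow _ _ (fun _ x => x)), C11_id.
  - intros x Hx. unfold c. apply Rmult_le_compat_l; [lra |]. apply pow_incr. lra.
  - intros. apply flux_periodic.
  - intros. apply radial_flux_periodic.
  - apply simple_zero_ext with (M := fun x => melnikov k a p q x / (2 * k ^ 2 * x ^ 3)); auto.
    intros x Hx. unfold melnikov, Rdiv.
    rewrite (RInt_ext (fun t => flux k a p q t x * / (2 * k ^ 2 * x ^ 3))
      (fun t => scal (/ (2 * k ^ 2 * x ^ 3)) (flux k a p q t x))).
    + rewrite (RInt_scal (fun t => flux k a p q t x)).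
      * unfold scal; simpl; unfold mult; simpl. ring.
      * apply ex_RInt_continuous_R. intros s. destruct (C11_bl _ _ _ C1) as [K [_ _ B]].
        apply B. lra.
    + intros t _. unfold scal; simpl; unfold mult; simpl. ring.
  - exists eps0. split; [exact P0 |]. intros eps Heps. destruct (Hav eps Heps) as [Sp Iso].
    apply (limit_cycle_of_periodic h11 h20 h40 k R0 Hk Hk2 HR p q eps (al * mu) (be * mu)
      (mu / 2) (2 * mu) c cp) with (e := th * mu) (sg := sg); auto; lra.
Qed.

Theorem theorem10 :
  forall (h11s h20s h40s c00s c02s c11s c20s : R),
    h20s^2 + h40s < 0 ->
    c00s = - c02s ->
    c02s <> 0 ->
    c20s = h11s*c11s - 2*c02s*(h11s^2 - h20s) ->
  forall (pc qc : coef_family),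
    deg_le3 pc -> deg_le3 qc ->
    linear_in_delta pc -> linear_in_delta qc ->
    div_condition pc qc ->
  forall (rV eta : R), 0 < rV -> 0 < eta ->
    exists eps c00 c02 c11 c20 h11 h20 h40,
      0 < Rabs eps < eta /\
      Rabs (c00 - c00s) < eta /\ Rabs (c02 - c02s) < eta /\
      Rabs (c11 - c11s) < eta /\ Rabs (c20 - c20s) < eta /\
      Rabs (h11 - h11s) < eta /\ Rabs (h20 - h20s) < eta /\
      Rabs (h40 - h40s) < eta /\
      h20^2 + h40 < 0 /\
      exists G1 G2 : R -> R -> Prop,
        limit_cycle (field_u pc eps h11 h20 h40 c00 c02 c11 c20)
                    (field_v qc eps h11 h20 h40 c00 c02 c11 c20) G1 /\
        limit_cycle (field_u pc eps h11 h20 h40 c00 c02 c11 c20)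
                    (field_v qc eps h11 h20 h40 c00 c02 c11 c20) G2 /\
        (forall a b, G1 a b -> dist2 a b 0 0 < rV) /\
        (forall a b, G2 a b -> dist2 a b 0 0 < rV) /\
        ~ (forall a b, G1 a b <-> G2 a b).
Proof.
  intros h11 h20 h40 c00s c c11 c20s Hkap Hc00 Hc Hc20 pc qc _ _ _ _ Hdiv rV eta HrV Heta.
  set (a := 2 * h20 - h11 ^ 2).
  set (k := 4 * sqrt (- (h20 ^ 2 + h40))).
  assert (Hk : 0 < k) by (unfold k; assert (0 < sqrt (- (h20 ^ 2 + h40))) by (apply sqrt_lt_R0; lra); lra).
  assert (Hk2 : k ^ 2 = - 16 * (h20 ^ 2 + h40)).
  { unfold k. replace ((4 * sqrt (- (h20 ^ 2 + h40))) ^ 2) with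
      (16 * (sqrt (- (h20 ^ 2 + h40)) * sqrt (- (h20 ^ 2 + h40)))) by ring.
    rewrite sqrt_sqrt; lra. }
  assert (PO := Om_nonneg k a).
  (* This gives 4 Om R0^2 = Om / (1 + Om)^2 <= 1. *)
  set (R0 := / (2 * (1 + Om k a))).
  assert (HR0 : 0 < R0) by (apply Rinv_0_lt_compat; lra).
  assert (HR : 4 * Om k a * R0 ^ 2 <= 1).
  { unfold R0. apply Rmult_le_reg_r with ((1 + Om k a) ^ 2); [apply pow_lt; lra |].
    replace (4 * Om k a * (/ (2 * (1 + Om k a))) ^ 2 * (1 + Om k a) ^ 2) with (Om k a) by (field; lra).
    nra. }
  set (N := 2 * c * k ^ 2 * JS / 7).
  assert (HN : N <> 0).
  { assert (P := JS_pos). assert (0 < k ^ 2) by (apply pow_lt; auto).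
    assert (0 < k ^ 2 * JS) by nra.
    intros E. apply Hc. apply Rmult_eq_reg_r with (k ^ 2 * JS); [unfold N in E; lra | lra]. }
  assert (PN : 0 < Rabs N) by now apply Rabs_pos_lt.
  destruct (melnikov_asymptotics k a c R0 Hk HR0 HR) as [K1 [HK1 Hmel]].
  assert (P0 := J0_pos). assert (P2 := J2_pos).
  (* Each q yields one upper bound on mu = 1/Q: 2 mu < R0, the smallness of the Melnikov remainder,
     the closeness of c00 and of c20 to their limits, and the size of the cycles, where |u| + |v| <=
     2 mu + 8 Om mu^2. *)
  set (q1 := 2 / R0). set (q2 := 32 * K1 / (k * Rabs N)).
  set (q3 := 6 * Rabs N / J0 / eta). set (q4 := 15 * Rabs N / J2 / eta).
  set (q5 := (2 + 8 * Om k a) / rV).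
  assert (kN : 0 < k * Rabs N) by nra.
  assert (B1 : 0 < q1) by (apply Rdiv_lt_0_compat; lra).
  assert (B2 : 0 < q2) by (apply Rdiv_lt_0_compat; lra).
  assert (B3 : 0 < q3) by (repeat apply Rdiv_lt_0_compat; lra).
  assert (B4 : 0 < q4) by (repeat apply Rdiv_lt_0_compat; lra).
  assert (B5 : 0 < q5) by (apply Rdiv_lt_0_compat; lra).
  set (Q := q1 + q2 + q3 + q4 + q5 + 2).
  set (mu := / Q).
  assert (Qp : 2 < Q) by (unfold Q; lra).
  assert (Hmu : 0 < mu) by (apply Rinv_0_lt_compat; lra).
  assert (small : forall x d, 0 < d -> x / d < Q -> mu * x < d).
  { intros x d Hd Hx. unfold mu. apply Rmult_lt_reg_l with Q; [lra |].
    rewrite <- Rmult_assoc, Rinv_r, Rmult_1_l by lra.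
    apply Rmult_lt_reg_r with (/ d); [now apply Rinv_0_lt_compat |].
    rewrite Rmult_assoc, Rinv_r, Rmult_1_r by lra. exact Hx. }
  assert (mu1 : mu < 1) by (rewrite <- (Rmult_1_r mu); apply small; lra).
  assert (s1 : mu * 2 < R0) by (apply small; auto; fold q1; unfold Q; lra).
  assert (s2 : mu * (32 * K1) < k * Rabs N) by (apply small; auto; fold q2; unfold Q; lra).
  assert (s3 : mu * (6 * Rabs N / J0) < eta) by (apply small; auto; fold q3; unfold Q; lra).
  assert (s4 : mu * (15 * Rabs N / J2) < eta) by (apply small; auto; fold q4; unfold Q; lra).
  assert (s5 : mu * (2 + 8 * Om k a) < rV) by (apply small; auto; fold q5; unfold Q; lra).
  clearbody mu.
  assert (mu2 : 0 < mu ^ 2 <= mu) by (split; [apply pow_lt; auto | nra]).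
  assert (mu4 : 0 < mu ^ 4 <= mu).
  { split; [apply pow_lt; auto |]. replace (mu ^ 4) with (mu ^ 2 * mu ^ 2) by ring. nra. }
  set (A := - (6 * N * mu ^ 4 / J0)). set (B := 15 * N * mu ^ 2 / J2).
  (* c00 enters the divergence with coefficient 1 and c20 with coefficient 4, hence the quarter. *)
  set (c00 := c00s + A). set (c20 := c20s + B / 4).
  set (p := pc h11 h20 h40 c00 c c11 c20). set (q := qc h11 h20 h40 c00 c c11 c20).
  assert (HA : Rabs (c00 - c00s) < eta).
  { unfold c00. replace (c00s + A - c00s) with A by ring. unfold A.
    rewrite Rabs_Ropp. unfold Rdiv. rewrite !Rabs_mult, (Rabs_pos_eq 6), (Rabs_pos_eq (mu ^ 4)), (Rabs_pos_eq (/ J0));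
      try lra; [| left; now apply Rinv_0_lt_compat].
    apply Rle_lt_trans with (2 := s3).
    assert (0 < 6 * Rabs N / J0) by (apply Rdiv_lt_0_compat; lra).
    replace (6 * Rabs N * mu ^ 4 * / J0) with (mu ^ 4 * (6 * Rabs N / J0)) by (unfold Rdiv; ring).
    apply Rmult_le_compat_r; lra. }
  assert (HB : Rabs (c20 - c20s) < eta).
  { unfold c20. replace (c20s + B / 4 - c20s) with (/ 4 * B) by field.
    rewrite Rabs_mult, (Rabs_pos_eq (/ 4)) by lra.
    assert (L : Rabs B <= mu * (15 * Rabs N / J2)).
    { unfold B, Rdiv. rewrite !Rabs_mult, (Rabs_pos_eq 15), (Rabs_pos_eq (mu ^ 2)), (Rabs_pos_eq (/ J2));
        try lra; [| left; now apply Rinv_0_lt_compat].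
      assert (0 < 15 * Rabs N / J2) by (apply Rdiv_lt_0_compat; lra).
      replace (15 * Rabs N * mu ^ 2 * / J2) with (mu ^ 2 * (15 * Rabs N / J2)) by (unfold Rdiv; ring).
      apply Rmult_le_compat_r; lra. }
    assert (P := Rabs_pos B). lra. }
  assert (Hdv : forall t rho, - R0 < rho < R0 ->
    poly2_du p (Ucrd t rho) (Vcrd k a t rho) + poly2_dv q (Ucrd t rho) (Vcrd k a t rho)
    = div_coord k a c A B (- 2 * c11 + 4 * h11 * c) t rho).
  { intros t rho Hr. unfold p, q. rewrite Hdiv. unfold div_target, div_coord.
    assert (S := Vcrd_square h11 h20 k R0 HR t rho Hr). fold a in S.
    assert (EV : zz k a t rho = 1 + Vcrd k a t rho) by (unfold Vcrd; ring). rewrite EV.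
    set (v := Vcrd k a t rho) in *. set (u := Ucrd t rho).
    (* The equalities on delta_0 are used here: they leave A as constant term and B + 4 a c as
       coefficient of u^2. The part 4 a c then combines with 2 c (v + v^2/2) into 2 c W. *)
    transitivity (A + 2 * c * (v + v ^ 2 / 2) + (- 2 * c11 + 4 * h11 * c) * u * (1 + v)
      + (B + 4 * a * c) * u ^ 2).
    - unfold c00, c20, a. rewrite Hc00, Hc20. field.
    - rewrite S. unfold om, u, Ucrd. ring. }
  specialize (Hmel mu (- 2 * c11 + 4 * h11 * c) p q Hmu ltac:(lra) Hdv). fold N A B in Hmel.
  destruct (two_simple_zeros (melnikov k a p q) (melnikov' k a c A B (- 2 * c11 + 4 * h11 * c)) k N K1 mu)
    as [sg [m [Hsg [Hm [Z1 Z2]]]]]; auto.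
  { nra. }
  assert (Hsg' : - sg = 1 \/ - sg = -1) by (destruct Hsg as [-> | ->]; [right | left]; ring).
  destruct (cycle_of_simple_zero h11 h20 h40 k R0 mu (9 / 10) (11 / 10) (/ 50) sg m p q)
    as [e1 [He1 Cy1]]; auto; try lra.
  destruct (cycle_of_simple_zero h11 h20 h40 k R0 mu (13 / 10) (15 / 10) (/ 50) (- sg) m p q)
    as [e2 [He2 Cy2]]; auto; try lra.
  fold a in Cy1, Cy2.
  set (eps := Rmin eta (Rmin e1 e2) / 2).
  assert (M1 : Rmin eta (Rmin e1 e2) <= eta) by apply Rmin_l.
  assert (M2 : Rmin eta (Rmin e1 e2) <= e1) by (eapply Rle_trans; [apply Rmin_r | apply Rmin_l]).
  assert (M3 : Rmin eta (Rmin e1 e2) <= e2) by (eapply Rle_trans; [apply Rmin_r | apply Rmin_r]).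
  assert (M0 : 0 < Rmin eta (Rmin e1 e2)) by (repeat apply Rmin_case; lra).
  destruct (Cy1 eps ltac:(unfold eps; lra)) as [G1 [L1 D1]].
  destruct (Cy2 eps ltac:(unfold eps; lra)) as [G2 [L2 D2]].
  assert (near : forall t rho, 0 < rho <= 2 * mu -> dist2 (Ucrd t rho) (Vcrd k a t rho) 0 0 < rV).
  { intros t rho Hr. destruct (coord_bounds h11 h20 k R0 HR t rho ltac:(lra)) as [X1 [X2 _]]. fold a in X2.
    unfold dist2. rewrite !Rminus_0_r.
    set (u := Ucrd t rho) in *. set (v := Vcrd k a t rho) in *.
    apply Rle_lt_trans with (Rabs u + Rabs v).
    - assert (Pu := Rabs_pos u). assert (Pv := Rabs_pos v).
      rewrite <- (sqrt_square (Rabs u + Rabs v)) by lra.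
      apply sqrt_le_1; [assert (Q1 := pow2_ge_0 u); assert (Q2 := pow2_ge_0 v); lra | nra |].
      rewrite <- (pow2_abs u), <- (pow2_abs v). nra.
    - assert (rho ^ 2 <= 4 * mu ^ 2) by nra. nra. }
  assert (pos0 : forall x, Rabs (x - x) < eta) by (intros; rewrite Rminus_diag, Rabs_R0; lra).
  (* Only c00 and c20 are moved; the remaining parameters keep their values in delta_0 and
     sigma_0. *)
  exists eps, c00, c, c11, c20, h11, h20, h40.
  split; [rewrite Rabs_pos_eq; unfold eps; lra |].
  do 7 (split; [auto |]). split; [exact Hkap |].
  exists G1, G2. split; [exact L1 |]. split; [exact L2 |]. split; [| split].
  - intros u v Huv. destruct (D1 u v Huv) as [t [rho [Hr [<- <-]]]]. apply near. lra.
  - intros u v Huv. destruct (D2 u v Huv) as [t [rho [Hr [<- <-]]]]. apply near. lra.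
  (* A common point would have a radius both at most 11/10 mu and at least 13/10 mu. *)
  - intros E. destruct L1 as [[x [y [T [_ [_ [_ [_ HG]]]]]]] _].
    assert (I1 : G1 (x 0) (y 0)) by (apply HG; eauto). assert (I2 := I1). apply E in I2.
    destruct (D1 _ _ I1) as [t [rho [Hr [E1 E2]]]]. destruct (D2 _ _ I2) as [t' [rho' [Hr' [E1' E2']]]].
    destruct (coord_injective h11 h20 k R0 Hk HR t rho t' rho') as [Er _]; try lra; fold a; congruence.
Qed.
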